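(* Let $T>0$ and $M>0$. There exists a constant $C_M$, depending only on $M$ and $T$, such that for all $X_\alpha,X_\beta\in\mathcal{H}^M$ and all $t\in[0,T]$, $$d_M(\bar S_tX_\alpha,\bar S_tX_\beta)\le C_M\,d_M(X_\alpha,X_\beta).$$
   Context: **Function spaces.** ''Periodic'' means 1-periodic on $\mathbb{R}$. $V_1=\{f\in W^{1,1}_{\rm loc}(\mathbb{R}): f(\xi+1)=f(\xi)+1\ \forall\xi\}$; $V=\{f\in W^{1,1}_{\rm loc}(\mathbb{R}):\exists\alpha\in\mathbb{R},\ f(\xi+1)=f(\xi)+\alpha\ \forall\xi\}$ with norm $\|f\|_V=\|f\|_{L^\infty([0,1])}+\|f_\xi\|_{L^1([0,1])}$; $W^{1,1}_{\rm per}$ is the space of periodic functions in $W^{1,1}_{\rm loc}(\mathbb{R})$ with the same norm; $L^1_{\rm per}$ is the space of periodic $L^1_{\rm loc}$ functions with norm $\|\cdot\|_{L^1([0,1])}$; $W^{1,\infty}_{\rm per}$ is the space of periodic functions in $W^{1,\infty}_{\rm loc}(\mathbb{R})$. $E=V\times W^{1,1}_{\rm per}\times L^1_{\rm per}$ with the sum norm. **Lagrangian set.** $\mathcal{F}$ is the set of $X=(y,U,\nu)\in E$ with $y\in V_1$; $y,U\in W^{1,\infty}_{\rm loc}(\mathbb{R})$; $\nu\in L^\infty$; $y_\xi\ge0$, $\nu\ge0$ and $y_\xi+\nu\ge c$ a.e. for some constant $c>0$; $y_\xi\nu=y_\xi^2U^2+U_\xi^2$ a.e. For $X\in\mathcal{F}$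 write $h=\|\nu\|_{L^1([0,1])}$. **Lagrangian flow.** For $X=(y,U,\nu)\in E$ with $y\in V_1$, $$Q(\xi)=-\tfrac14\int_{\mathbb{R}}\operatorname{sign}(\xi-\eta)e^{-\operatorname{sign}(\xi-\eta)(y(\xi)-y(\eta))}(U^2y_\xi+\nu)(\eta)\,d\eta,\qquad P(\xi)=\tfrac14\int_{\mathbb{R}}e^{-\operatorname{sign}(\xi-\eta)(y(\xi)-y(\eta))}(U^2y_\xi+\nu)(\eta)\,d\eta.$$ For $X_0\in\mathcal{F}$, $S_t(X_0)=X(t)$, where $X\in C^1([0,\infty),E)$ is the unique global solution, which stays in $\mathcal{F}$, of $y_t=U$, $U_t=-Q$, $\nu_t=-2QUy_\xi+(3U^2-2P)U_\xi$ with $X(0)=X_0$. **Relabeling.** $G$ is the group (under composition) of invertible $f\colon\mathbb{R}\to\mathbb{R}$ with $f\in W^{1,\infty}_{\rm loc}(\mathbb{R})$, $f(\xi+1)=f(\xi)+1$ for all $\xi$, and $f-\mathrm{id},f^{-1}-\mathrm{id}\in W^{1,\infty}_{\rm per}$. For $X=(y,U,\nu)\in\mathcal{F}$, $f\in G$: $X\bullet f=(y\circ f,U\circ f,(\nu\circ f)f_\xi)\in\mathcal{F}$. $\mathcal{F}_0=\{X\in\mathcal{F}: y_\xi+\nu=1+h \text{ a.e.}\}$ and $\mathcal{H}=\{(y,U,\nu)\in\mathcal{F}_0:\int_0^1y\,d\xi=0\}$. $\Pi_1\colon\mathcal{F}\to\mathcal{F}_0$, $\Pi_1(X)=X\bullet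 f^{-1}$ with $f(\xi)=\frac1{1+h}\big(y(\xi)+\int_0^\xi\nu\,d\eta\big)$; $\Pi_2\colon\mathcal{F}_0\to\mathcal{H}$, $\Pi_2(X)=X(\cdot-a)$ with $a=\int_0^1y\,d\xi$; $\Pi=\Pi_2\circ\Pi_1\colon\mathcal{F}\to\mathcal{H}$. $\bar S_t=\Pi\circ S_t\colon\mathcal{H}\to\mathcal{H}$. **Metric.** $J(X,Y)=\inf_{f,g\in G}\|X\bullet f-Y\bullet g\|_E$ for $X,Y\in\mathcal{F}$. For $M>0$, $\mathcal{H}^M=\{X\in\mathcal{H}: h\le M\}$, and for $X,Y\in\mathcal{H}^M$, $d_M(X,Y)=\inf\sum_{n=1}^NJ(X_{n-1},X_n)$ over all finite sequences $\{X_n\}_{n=0}^N$ in $\mathcal{H}^M$ with $X_0=X$, $X_N=Y$. *)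

(* Defs.v *)
From HB Require Import structures.
From mathcomp Require Import all_boot all_order all_algebra.
From mathcomp Require Import all_classical all_reals all_analysis.

Set Implicit Arguments.
Unset Strict Implicit.
Unset Printing Implicit Defensive.

Import Order.TTheory GRing.Theory Num.Theory.
Import numFieldNormedType.Exports.

Local Open Scope classical_set_scope.
Local Open Scope ring_scope.

(** Elements of the function spaces are represented by functions R -> R.
    W^{1,p}_loc functions are represented by their continuous representative,
    so that their functional equations hold everywhere; L^p functions are
    arbitrary Borel representatives, and their equations hold a.e. *)

Section sobolev.
Context {R : realType}.
Implicit Types f g : R -> R.

Definition L1loc : set (R -> R) := [set f | locally_integrable setT f].

Definition Linfloc : set (R -> R) := [set f | measurable_fun setT f /\
  forall K : set R, compact K ->
    ('N[lebesgue_measure]_+oo [EFin \o (f \_ K)] < +oo)%E].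

(** C^1 compactly supported test functions define the same weak derivatives as
    C^oo ones. *)
Definition test_function : set (R -> R) := [set phi : R -> R^o |
  [/\ forall x, derivable phi x 1, continuous (derive1 phi) &
      exists r : R, forall x, r < `|x| -> phi x = 0]].

Definition weak_derivative f g := forall phi : R -> R^o, test_function phi ->
  \int[lebesgue_measure]_x (f x * derive1 phi x) =
  - \int[lebesgue_measure]_x (g x * phi x).

Definition sobolev_loc (L : set (R -> R)) : set (R -> R) := [set f |
  [/\ continuous f, L f & exists2 g, L g & weak_derivative f g]].

Definition W11loc := sobolev_loc L1loc.

Definition W1infloc := sobolev_loc Linfloc.

(** A representative of f_xi, determined up to a.e. equality when f is in
    W^{1,1}_loc. *)
Definition wderiv f : R -> R :=
  xget (fun=> 0) [set g | L1loc g /\ weak_derivative f g].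

Definition V1 : set (R -> R) :=
  [set f | W11loc f /\ forall x, f (x + 1) = f x + 1].

Definition V : set (R -> R) :=
  [set f | W11loc f /\ exists alpha, forall x, f (x + 1) = f x + alpha].

Definition W11per : set (R -> R) :=
  [set f | W11loc f /\ forall x, f (x + 1) = f x].

Definition L1per : set (R -> R) :=
  [set f | L1loc f /\ {ae lebesgue_measure, forall x, f (x + 1) = f x}].

Definition W1infper : set (R -> R) :=
  [set f | W1infloc f /\ forall x, f (x + 1) = f x].

Definition normLinf f : \bar R :=
  'N[lebesgue_measure]_+oo [EFin \o (f \_ `[0, 1])].

Definition normL1 f : \bar R :=
  'N[lebesgue_measure]_1 [EFin \o (f \_ `[0, 1])].

Definition normV f : \bar R := (normLinf f + normL1 (wderiv f))%E.

End sobolev.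

Definition triple (R : realType) : Type :=
  ((R -> R^o) * (R -> R^o) * (R -> R^o))%type.

Section lagrangian.
Context {R : realType}.
Implicit Types X Y : triple R.

Definition yof X : R -> R := X.1.1.
Definition Uof X : R -> R := X.1.2.
Definition nuof X : R -> R := X.2.

Definition E : set (triple R) :=
  [set X | [/\ V (yof X), W11per (Uof X) & L1per (nuof X)]].

Definition normE X : \bar R :=
  (normV (yof X) + normV (Uof X) + normL1 (nuof X))%E.

Definition F : set (triple R) := [set X |
  let y := yof X in let U := Uof X in let nu := nuof X in
  let y' := wderiv y in let U' := wderiv U in
  [/\ E X /\ V1 y,
      W1infloc y /\ W1infloc U,
      nu \in Lfun lebesgue_measure +oo,
      [/\ {ae lebesgue_measure, forall x, 0 <= y' x},
          {ae lebesgue_measure, forall x, 0 <= nu x} &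
          exists2 c : R, 0 < c & {ae lebesgue_measure, forall x, c <= y' x + nu x}] &
      {ae lebesgue_measure, forall x,
        y' x * nu x = y' x ^+ 2 * U x ^+ 2 + U' x ^+ 2}]].

Definition h X : R := fine (normL1 (nuof X)).

Definition Q X : R -> R := fun xi =>
  let y := yof X in let U := Uof X in let nu := nuof X in
  - 4^-1 * \int[lebesgue_measure]_eta
    (Num.sg (xi - eta) * expR (- Num.sg (xi - eta) * (y xi - y eta)) *
      (U eta ^+ 2 * wderiv y eta + nu eta)).

Definition P X : R -> R := fun xi =>
  let y := yof X in let U := Uof X in let nu := nuof X in
  4^-1 * \int[lebesgue_measure]_eta
    (expR (- Num.sg (xi - eta) * (y xi - y eta)) *
      (U eta ^+ 2 * wderiv y eta + nu eta)).

(** The right-hand side (y_t, U_t, nu_t) of the evolution equation. *)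
Definition vfield X : triple R :=
  let y := yof X in let U := Uof X in
  ((U, fun x => - Q X x),
   fun x => - 2 * Q X x * U x * wderiv y x
            + (3 * U x ^+ 2 - 2 * P X x) * wderiv U x).

(** X is of class C^1 on [0, +oo[ with values in the normed space E, with
    derivative X' (one-sided at 0). *)
Definition C1E (X X' : R -> triple R) := forall t : R, 0 <= t ->
  [/\ E (X t), E (X' t),
      normE ((s - t)^-1 *: (X s - X t) - X' t)
        @[s --> within `[0, +oo[ t^'] --> 0%E &
      normE (X' s - X' t) @[s --> within `[0, +oo[ (nbhs t)] --> 0%E].

Definition global_solution (X0 : triple R) : set (R -> triple R) := [set X |
  [/\ X 0 = X0, forall t : R, 0 <= t -> V1 (yof (X t)) &
      C1E X (fun t => vfield (X t))]].

(** The semigroup S_t; the default value is irrelevant for X0 in F, where the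
    global solution exists. *)
Definition St (t : R) (X0 : triple R) : triple R :=
  xget (fun=> X0) (global_solution X0) t.

Definition inverse (f : R -> R) : R -> R := 'pinv_(fun=> 0) setT f.

Definition G : set (R -> R) := [set f |
  [/\ bijective f, W1infloc f, forall x, f (x + 1) = f x + 1,
      W1infper (fun x => f x - x) & W1infper (fun x => inverse f x - x)]].

Definition relabel X (f : R -> R) : triple R :=
  ((yof X \o f, Uof X \o f), fun x => nuof X (f x) * wderiv f x).

Definition F0 : set (triple R) := [set X | F X /\
  {ae lebesgue_measure, forall x, wderiv (yof X) x + nuof X x = 1 + h X}].

Definition H : set (triple R) := [set X | F0 X /\
  \int[lebesgue_measure]_(x in `[0, 1]) yof X x = 0].

(** The oriented integral of f from 0 to x. *)
Definition primitive (f : R -> R) (x : R) : R :=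
  if 0 <= x then \int[lebesgue_measure]_(s in `[0, x]) f s
  else - \int[lebesgue_measure]_(s in `[x, 0]) f s.

Definition Pi1 X : triple R :=
  relabel X (inverse
    (fun xi => (1 + h X)^-1 * (yof X xi + primitive (nuof X) xi))).

Definition Pi2 X : triple R :=
  let a := \int[lebesgue_measure]_(x in `[0, 1]) yof X x in
  ((fun x => yof X (x - a), fun x => Uof X (x - a)), fun x => nuof X (x - a)).

Definition Pi X : triple R := Pi2 (Pi1 X).

Definition Sbar (t : R) X : triple R := Pi (St t X).

Definition J X Y : \bar R :=
  ereal_inf [set normE (relabel X f - relabel Y g) | f in G & g in G].

Definition HM (M : R) : set (triple R) := [set X | H X /\ h X <= M].

Definition dM (M : R) X Y : \bar R :=
  ereal_inf [set d | exists (N : nat) (Z : nat -> triple R),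
    [/\ Z 0%N = X, Z N = Y, forall n, (n <= N)%N -> HM M (Z n) &
        d = (\sum_(n < N) J (Z n) (Z n.+1))%E]].

End lagrangian.

(* Main.v *)
Require Import Defs.
From HB Require Import structures.
From mathcomp Require Import all_boot all_order all_algebra.
From mathcomp Require Import all_classical all_reals all_analysis.
From mathcomp Require Import measurable_realfun ess_sup_inf lra.

Set Implicit Arguments.
Unset Strict Implicit.
Unset Printing Implicit Defensive.

Import Order.TTheory GRing.Theory Num.Theory.
Import numFieldNormedType.Exports.

Local Open Scope classical_set_scope.
Local Open Scope ring_scope.

(** The right-hand side of the Lagrangian system is Lipschitz, for the norm of E,
    on the set of states whose components are bounded by a given B, and on F such
    a B is controlled by h alone: y_xi + nu and the identity
    y_xi nu = y_xi^2 U^2 + U_xi^2 bound U and U_xi in terms of h, which the flow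
    preserves. The flow commutes with relabelings, which are isometries of E, so
    Gronwall's lemma applied to the relabeled solutions t |-> S_t X . f and
    t |-> S_t Y . g gives
      || S_t X . f - S_t Y . g || <= e^(LT) || X . f - Y . g ||
    with L depending on M only. As Pi X is itself a relabeling of X, taking the
    infimum over f and g yields J (Sbar_t X) (Sbar_t Y) <= e^(LT) J X Y, and one
    sums over chains.

    Since S_t is defined by choice, the solution must also be constructed. Euler's
    scheme is run pointwise in xi on everywhere defined periodic bounded
    representatives of (y, U, y_xi, U_xi, nu), with the right-hand side multiplied
    by a cut-off of the L^1 size of the state. The cut-off is a scalar, hence only
    changes the speed along trajectories: the identity, the positivity of y_xi and
    nu, and h are still conserved, and they show that it is constantly 1. *)

(* [lra] reifies every hypothesis in sight, unfolding local definitions on the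
   way, so removing what it cannot use saves much time. Not to be used under
   section hypotheses, which [lra] requires to be present. *)
Ltac rlra :=
  repeat match goal with H : ?P |- _ =>
    lazymatch type of P with Prop =>
      lazymatch P with is_true _ => fail | @eq _ _ _ => fail | _ => clear H end
    end end;
  solve [repeat match goal with x := _ |- _ => clearbody x end; lra | lra].

(** * Local integrability and oriented integrals *)

(** The Lipschitz constant has to survive relabeling. It may therefore depend only on the L^1 norms
    of y_xi, U_xi and nu and on the sup norm of U, which a relabeling does not change; pointwise
    bounds on y_xi or nu depend on the state and on f. This is why the estimates on the field keep
    |y_xi| and |U_xi| as weights until they are integrated. Euler's scheme reads the same pointwise
    estimates in the sup norm, where they are only locally Lipschitz. Uniform convergence of y and
    y_xi together then preserves absolute continuity in the limit. Positivity is the delicate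
    conservation law. The identity forces y_xi nu >= 0 and (y_xi + nu)^2 >= y_xi^2 + U_xi^2 + nu^2.
    The system is linear in (y_xi, U_xi, nu), so this sum of squares cannot reach 0 in finite time;
    hence y_xi + nu cannot change sign. The integrals over the line that define P and Q are folded
    onto one period by y(xi + 1) = y(xi) + 1, so that their derivatives, their Lipschitz bounds and
    their behaviour under relabeling become statements about integrals over one period. *)

Section loc.
Context {R : realType}.
Implicit Types (f g : R -> R) (a b c x : R).
Local Notation mu := (@lebesgue_measure R).

Lemma L1locP f : L1loc f <->
  measurable_fun setT f /\ forall a b, mu.-integrable `[a, b] (EFin \o f).
Proof.
split=> [[mf _ lf]|[mf intf]]; last first.
  split=> //; first exact: openT.
  move=> K _ cK.
  have [M [Mreal HM]] := compact_bounded cK.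
  have KM : K `<=` `[- (M + 1), M + 1].
    move=> x Kx /=; rewrite in_itv /= -ler_norml; apply: HM => //.
    by rewrite ltrDl.
  have /integrableP[_] := intf (- (M + 1)) (M + 1).
  apply: le_lt_trans; apply: ge0_subset_integral => //=.
  - exact: compact_measurable.
  - apply/measurable_EFinP; apply/measurableT_comp => //.
    exact: measurable_funTS.
split=> // a b; apply/integrableP; split.
  by apply/measurable_EFinP; exact: measurable_funTS.
by apply: lf => //; exact: segment_compact.
Qed.

Lemma L1loc_meas f : L1loc f -> measurable_fun setT f.
Proof. by case/L1locP. Qed.

Lemma L1loc_int f a b : L1loc f -> mu.-integrable `[a, b] (EFin \o f).
Proof. by case/L1locP. Qed.

Lemma L1loc_le f g : measurable_fun setT f -> L1loc g ->
  (forall x, `|f x| <= `|g x|) -> L1loc f.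
Proof.
move=> mf /L1locP[mg ig] fg; apply/L1locP; split=> // a b.
apply: le_integrable (ig a b) => //.
  by apply/measurable_EFinP; exact: measurable_funTS.
by move=> x _; rewrite /= lee_fin.
Qed.

Lemma L1locD f g : L1loc f -> L1loc g -> L1loc (fun x => f x + g x).
Proof. exact: locally_integrableD. Qed.

Lemma L1locN f : L1loc f -> L1loc (fun x => - f x).
Proof. exact: locally_integrableN. Qed.

Lemma L1locB f g : L1loc f -> L1loc g -> L1loc (fun x => f x - g x).
Proof. exact: locally_integrableB. Qed.

Lemma L1loc_abs f : L1loc f -> L1loc (fun x => `|f x|).
Proof.
move=> lf; apply: (L1loc_le _ lf) => [|x]; last by rewrite normr_id.
by apply: measurableT_comp => //; exact: L1loc_meas.
Qed.

Definition locbd f := forall a b, exists M, forall x, a <= x <= b -> `|f x| <= M.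

Lemma locbd_cont f : continuous f -> locbd f.
Proof.
move=> cf a b; have [ab|ba] := leP a b; last first.
  by exists 0 => x /andP[ax xb]; move: (le_lt_trans xb ba); rewrite ltNge ax.
have cabs : continuous (fun x => `|f x|).
  by move=> x; apply: (@continuous_comp _ _ _ f (fun y => `|y|)); [exact: cf|exact: norm_continuous].
have [c _ Hc] := @EVT_max _ (fun x => `|f x|) _ _ ab
  (continuous_subspaceT cabs).
by exists `|f c| => x xab; apply: Hc; rewrite in_itv.
Qed.

Lemma L1locM_locbd f g : measurable_fun setT f -> locbd f -> L1loc g ->
  L1loc (fun x => f x * g x).
Proof.
move=> mf bf /L1locP[mg ig]; apply/L1locP; split=> [|a b].
  exact: measurable_funM.
have [M HM] := bf a b.
have iM : mu.-integrable `[a, b] (fun x => M%:E * (EFin \o g) x)%E.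
  by apply: integrableZl.
apply: le_integrable iM => //.
  by apply/measurable_EFinP/measurable_funTS/measurable_funM.
move=> x /= /[!in_itv]/= xab; rewrite !lee_fin !normrM ler_wpM2r//.
exact: le_trans (HM _ xab) (ler_norm _).
Qed.

Lemma cont_meas f : continuous f -> measurable_fun setT f.
Proof. exact: continuous_measurable_fun. Qed.

Lemma L1loc_cst c : L1loc (fun=> c : R).
Proof.
apply/L1locP; split=> // a b; have muab : (mu `[a, b] < +oo)%E.
  by rewrite lebesgue_measure_itv/=; case: ifP => _; rewrite -?EFinB ltry.
apply: measurable_bounded_integrable => //.
by exists `|c|; split => [|M cM x _]; [exact: num_real|exact: ltW].
Qed.

Lemma L1locM_cont f g : continuous f -> L1loc g -> L1loc (fun x => f x * g x).
Proof. by move=> cf; apply: L1locM_locbd; [exact: cont_meas|exact: locbd_cont]. Qed.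

Lemma L1loc_locbd f : measurable_fun setT f -> locbd f -> L1loc f.
Proof.
move=> mf bf; have -> : f = (fun x => f x * 1) by apply/funext => x; rewrite mulr1.
exact/L1locM_locbd/L1loc_cst.
Qed.

Lemma L1loc_cont f : continuous f -> L1loc f.
Proof. by move=> cf; apply: L1loc_locbd; [exact: cont_meas|exact: locbd_cont]. Qed.

Lemma L1locZ c f : L1loc f -> L1loc (fun x => c * f x).
Proof. by apply: L1locM_cont; exact: cst_continuous. Qed.

Lemma aeS (A B : R -> Prop) : (forall x, A x -> B x) ->
  {ae mu, forall x, A x} -> {ae mu, forall x, B x}.
Proof.
move=> AB; exact: (@filterS _ (almost_everywhere mu) (ae_filter_ringOfSetsType mu) A B AB).
Qed.

Lemma aeS2 (A B C : R -> Prop) : (forall x, A x -> B x -> C x) ->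
  {ae mu, forall x, A x} -> {ae mu, forall x, B x} -> {ae mu, forall x, C x}.
Proof.
move=> AB; exact: (@filterS2 _ (almost_everywhere mu) (ae_filter_ringOfSetsType mu) A B C AB).
Qed.

Lemma aeS3 (A B C D : R -> Prop) : (forall x, A x -> B x -> C x -> D x) ->
  {ae mu, forall x, A x} -> {ae mu, forall x, B x} -> {ae mu, forall x, C x} ->
  {ae mu, forall x, D x}.
Proof.
move=> AB; exact: (@filterS3 _ (almost_everywhere mu) (ae_filter_ringOfSetsType mu) A B C D AB).
Qed.

Lemma aeT (A : R -> Prop) : (forall x, A x) -> {ae mu, forall x, A x}.
Proof. by move=> h; exact: aeW. Qed.

Definition aeeq f g := {ae mu, forall x, f x = g x}.

Lemma aeeq_sym f g : aeeq f g -> aeeq g f.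
Proof. by apply: aeS => x ->. Qed.

Lemma aeeq_refl f : aeeq f f.
Proof. exact: aeT. Qed.

Lemma L1loc_ae f g : measurable_fun setT g -> L1loc f -> aeeq f g -> L1loc g.
Proof.
move=> mg /L1locP[mf lf] fg; apply/L1locP; split=> // a b.
apply/integrableP; split.
  by apply/measurable_EFinP; exact: measurable_funTS.
have /integrableP[_] := lf a b.
suff -> : (\int[mu]_(x in `[a, b]) `|(EFin \o f) x| =
  \int[mu]_(x in `[a, b]) `|(EFin \o g) x|)%E by [].
apply: ae_eq_integral => //.
- by apply/measurable_EFinP/measurableT_comp => //; exact: measurable_funTS.
- by apply/measurable_EFinP/measurableT_comp => //; exact: measurable_funTS.
- by apply: aeS fg => x /= -> _.
Qed.

(** Going through [primitive] makes Chasles' relation and antisymmetry mere algebra, whatever the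
    order of the bounds. *)
Definition Int f a b := primitive f b - primitive f a.

Lemma Int_itv f a b : L1loc f -> a <= b ->
  Int f a b = \int[mu]_(x in `[a, b]) f x.
Proof.
move=> lf ab; rewrite /Int /primitive.
have cut a' b' c' : a' <= b' -> b' <= c' ->
  \int[mu]_(x in `[a', c']) f x =
  \int[mu]_(x in `[a', b']) f x + \int[mu]_(x in `[b', c']) f x.
  move=> h1 h2.
  have := @Rintegral_itvB _ f (BLeft a') (BRight c') b' (L1loc_int a' c' lf).
  rewrite !bnd_simp => /(_ h1 h2).
  rewrite Rintegral_itv_obnd_cbnd; last first.
    apply: integrableS (L1loc_int b' c' lf) => //.
    by apply: subset_itv; rewrite bnd_simp.
  by move=> <-; rewrite addrC subrK.
have [b0|b0] := leP 0 b; have [a0|a0] := leP 0 a.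
- by rewrite (cut _ _ _ a0 ab) addrC addKr.
- by rewrite opprK addrC (cut _ _ _ (ltW a0) b0).
- by have := lt_le_trans b0 (le_trans a0 ab); rewrite ltxx.
- by rewrite opprK addrC (cut _ _ _ ab (ltW b0)) addrK.
Qed.

Lemma Int_chasles f a b c : Int f a b + Int f b c = Int f a c.
Proof. by rewrite /Int addrC subrKA. Qed.

Lemma Intxx f a : Int f a a = 0.
Proof. by rewrite /Int subrr. Qed.

Lemma Int_swap f a b : Int f b a = - Int f a b.
Proof. by rewrite /Int opprB. Qed.

Lemma IntD f g a b : L1loc f -> L1loc g ->
  Int (fun x => f x + g x) a b = Int f a b + Int g a b.
Proof.
move=> lf lg; wlog ab : a b / a <= b.
  move=> H; have [/H//|/ltW/H ba] := leP a b.
  by rewrite Int_swap ba opprD -!Int_swap.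
rewrite !Int_itv//; first by apply: RintegralD => //; exact: L1loc_int.
exact: L1locD.
Qed.

Lemma IntZ f c a b : L1loc f -> Int (fun x => c * f x) a b = c * Int f a b.
Proof.
move=> lf; wlog ab : a b / a <= b.
  move=> H; have [/H//|/ltW/H ba] := leP a b.
  by rewrite Int_swap ba -mulrN -!Int_swap.
rewrite !Int_itv//; first by apply: RintegralZl => //; exact: L1loc_int.
exact: L1locZ.
Qed.

Lemma IntN f a b : L1loc f -> Int (fun x => - f x) a b = - Int f a b.
Proof.
move=> lf; rewrite -mulN1r -IntZ//; congr Int.
by apply/funext => x; rewrite mulN1r.
Qed.

Lemma IntB f g a b : L1loc f -> L1loc g ->
  Int (fun x => f x - g x) a b = Int f a b - Int g a b.
Proof. by move=> lf lg; rewrite IntD// ?IntN//; exact: L1locN. Qed.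

Lemma Int_ae f g a b : L1loc f -> L1loc g -> aeeq f g -> Int f a b = Int g a b.
Proof.
move=> lf lg fg; wlog ab : a b / a <= b.
  move=> H; have [/H//|/ltW/H ba] := leP a b.
  by rewrite Int_swap ba -!Int_swap.
rewrite !Int_itv//; congr fine; apply: ae_eq_integral => //.
- by apply/measurable_EFinP/measurable_funTS; exact: L1loc_meas.
- by apply/measurable_EFinP/measurable_funTS; exact: L1loc_meas.
- by apply: aeS fg => x /= -> _.
Qed.

Lemma Int_le f g a b : L1loc f -> L1loc g -> a <= b ->
  {ae mu, forall x, f x <= g x} -> Int f a b <= Int g a b.
Proof.
move=> lf lg ab fg.
(* Replacing g by max(f, g), which is a.e. equal to it, turns the a.e. inequality into one that
   holds everywhere. *)
have mmax : measurable_fun setT (fun x => Num.max (f x) (g x)).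
  by apply: measurable_maxr; exact: L1loc_meas.
have e : aeeq g (fun x => Num.max (f x) (g x)).
  by apply: aeS fg => x h; rewrite max_r.
have lm := L1loc_ae mmax lg e.
rewrite (Int_ae a b lg lm e) !Int_itv//.
apply: le_Rintegral => //; [exact: L1loc_int|exact: L1loc_int|].
by move=> x _; rewrite le_max lexx.
Qed.

Lemma Int_leW f g a b : L1loc f -> L1loc g -> a <= b ->
  (forall x, f x <= g x) -> Int f a b <= Int g a b.
Proof. by move=> lf lg ab fg; apply: Int_le => //; exact: aeT. Qed.

Lemma Int_cst c a b : Int (fun=> c) a b = c * (b - a).
Proof.
wlog ab : a b / a <= b.
  move=> H; have [/H//|/ltW/H ba] := leP a b.
  by rewrite Int_swap ba -mulrN opprB.
rewrite Int_itv//; last exact: L1loc_cst.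
transitivity (c * fine (mu `[a, b])); first exact: Rintegral_cst.
rewrite lebesgue_measure_itv/= lte_fin.
by case: ltgtP ab => // ->; rewrite subrr.
Qed.

Lemma Int_ge0 f a b : L1loc f -> a <= b -> {ae mu, forall x, 0 <= f x} -> 0 <= Int f a b.
Proof.
move=> lf ab f0; apply: le_trans (Int_le (L1loc_cst 0) lf ab f0).
by rewrite Int_cst mul0r.
Qed.

Lemma Int_ge0W f a b : L1loc f -> a <= b -> (forall x, 0 <= f x) -> 0 <= Int f a b.
Proof. by move=> lf ab f0; apply: Int_ge0 => //; exact: aeT. Qed.

Lemma Int_abs f a b : L1loc f -> a <= b ->
  `|Int f a b| <= Int (fun x => `|f x|) a b.
Proof.
move=> lf ab; rewrite !Int_itv//; last exact: L1loc_abs.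
by apply: le_normr_Rintegral => //; exact: L1loc_int.
Qed.

Lemma Int_bd f g a b : L1loc f -> L1loc g -> a <= b ->
  {ae mu, forall x, `|f x| <= g x} -> `|Int f a b| <= Int g a b.
Proof.
move=> lf lg ab fg; apply: le_trans (Int_abs lf ab) _.
by apply: Int_le => //; exact: L1loc_abs.
Qed.

Lemma Int_bdW f g a b : L1loc f -> L1loc g -> a <= b ->
  (forall x, `|f x| <= g x) -> `|Int f a b| <= Int g a b.
Proof. by move=> lf lg ab fg; apply: Int_bd => //; exact: aeT. Qed.

Lemma Int_eq_in f g a b : L1loc f -> L1loc g -> a <= b ->
  (forall x, a <= x <= b -> f x = g x) -> Int f a b = Int g a b.
Proof.
move=> lf lg ab fg; rewrite !Int_itv//; apply: eq_Rintegral => x.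
by rewrite inE/= in_itv/=; exact: fg.
Qed.

Lemma Int_le_in f g a b : L1loc f -> L1loc g -> a <= b ->
  (forall x, a <= x <= b -> f x <= g x) -> Int f a b <= Int g a b.
Proof.
move=> lf lg ab fg; rewrite !Int_itv//; apply: le_Rintegral; [by []|exact: L1loc_int|exact: L1loc_int|].
by move=> x /=; rewrite in_itv/=; exact: fg.
Qed.

Lemma Int_bd_in f g a b : L1loc f -> L1loc g -> a <= b ->
  (forall x, a <= x <= b -> `|f x| <= g x) -> `|Int f a b| <= Int g a b.
Proof.
move=> lf lg ab fg; apply: le_trans (Int_abs lf ab) _.
by apply: Int_le_in => //; exact: L1loc_abs.
Qed.

Lemma L1loc_patch f (A : set R) : measurable A -> L1loc f -> L1loc (f \_ A).
Proof.
move=> mA lf; apply: (L1loc_le _ lf) => [|x].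
  apply/(measurable_restrictT _ _).1 => //.
  by apply: measurable_funTS; exact: L1loc_meas.
by rewrite patchE; case: ifPn => // _; rewrite normr0.
Qed.

Lemma Int_le_aein f g a b : L1loc f -> L1loc g -> a <= b ->
  {ae mu, forall x, a <= x <= b -> f x <= g x} -> Int f a b <= Int g a b.
Proof.
move=> lf lg ab fg.
have E k : L1loc k -> Int k a b = Int (k \_ `[a, b]) a b.
  move=> lk; apply: Int_eq_in => //; first exact: L1loc_patch.
  by move=> x xab; rewrite patchE mem_set//= in_itv.
rewrite (E f)// (E g)//; apply: Int_le => //; [exact: L1loc_patch|exact: L1loc_patch|].
apply: aeS fg => x H; rewrite !patchE; case: ifPn => // /set_mem/=.
by rewrite in_itv/=.
Qed.

Lemma Int_bd_aein f g a b : L1loc f -> L1loc g -> a <= b ->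
  {ae mu, forall x, a <= x <= b -> `|f x| <= g x} -> `|Int f a b| <= Int g a b.
Proof.
move=> lf lg ab fg; apply: le_trans (Int_abs lf ab) _.
by apply: Int_le_aein => //; exact: L1loc_abs.
Qed.

Lemma Int_sub f a b c d : L1loc f -> (forall x, 0 <= f x) ->
  c <= a -> a <= b -> b <= d -> Int f a b <= Int f c d.
Proof.
move=> lf f0 ca ab bd.
rewrite -(Int_chasles f c a d) -(Int_chasles f a b d).
have := Int_ge0W lf ca f0; have := Int_ge0W lf bd f0; rlra.
Qed.

(** [primitive] changes formula at 0. Measured from x - 1 instead, it is near x a single integral
    with a fixed left end, up to a constant. *)
Lemma primitive_cont f : L1loc f -> continuous (primitive f).
Proof.
move=> lf x.
have Hab : {within `[x - 1, x + 1], continuous (fun z => \int[mu]_(t in `[x - 1, z]) f t)}.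
  by apply: (parameterized_integral_continuous _ (L1loc_int _ _ lf)); rlra.
have Hx : x \in `](x - 1), (x + 1)[ by rewrite in_itv/=; apply/andP; split; rlra.
have ltab : x - 1 < x + 1 by rlra.
have [/(_ x Hx) H _ _] := (continuous_within_itvP _ ltab).1 Hab.
have E : \forall z \near x, primitive f z = (\int[mu]_(t in `[x - 1, z]) f t) + primitive f (x - 1).
  near=> z; rewrite -Int_itv ?subrK//.
  apply/ltW; near: z; apply: lt_nbhsr; rlra.
have E0 := nbhs_singleton E; rewrite /continuous_at [X in _ --> X]E0.
have E' : {near x, (fun z => (\int[mu]_(t in `[x - 1, z]) f t) + primitive f (x - 1)) =1 primitive f}.
  by apply: filterS E => z ->.
apply: cvg_trans; first exact: near_eq_cvg E'.
by apply: cvgD => //; exact: cvg_cst.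
Unshelve. all: by end_near. Qed.

End loc.

(** * Absolutely continuous functions *)

Section ac.
Context {R : realType}.
Implicit Types (f g : R -> R) (a b c x : R).
Local Notation mu := (@lebesgue_measure R).

(** Consider the supremum of the t such that A holds on all of [a, t]. A holds at this supremum by
    the last hypothesis and, were it below b, would hold a little further by the one before. This
    drives the continuity arguments below. *)
Lemma real_induction (A : R -> Prop) a b : a <= b -> A a ->
  (forall t, a <= t < b -> A t ->
     exists2 d, 0 < d & forall s, t < s -> s < t + d -> s <= b -> A s) ->
  (forall t, a < t <= b -> (forall s, a <= s < t -> A s) -> A t) ->
  A b.
Proof.
move=> ab Aa Aopen Aclosed.
pose S := [set t | a <= t <= b /\ forall s, a <= s <= t -> A s].
have Sa : S a.
  split; first by rewrite lexx.
  by move=> s h; have -> : s = a by apply/eqP; rewrite eq_le andbC.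
have S0 : S !=set0 by exists a.
have ubS : ubound S b by move=> t [/andP[]].
have hsS : has_sup S by split=> //; exists b.
have cb : sup S <= b by apply: ge_sup.
have ac : a <= sup S by apply: ub_le_sup => //; exists b.
have below s : a <= s < sup S -> A s.
  move=> /andP[as_ /(sup_gt S0)[t [_ h] st]].
  by apply: h; rewrite as_ ltW.
have Ac : A (sup S).
  move: ac; rewrite le_eqVlt => /predU1P[<-//|ac].
  by apply: Aclosed => //; rewrite ac.
move: cb; rewrite le_eqVlt => /predU1P[<-//|cb].
have [d d0 Hd] := Aopen (sup S) (introT andP (conj ac cb)) Ac.
pose s := Num.min b (sup S + d / 2).
have ss : sup S < s by rewrite lt_min cb/=; rlra.
have sb : s <= b by rewrite ge_min lexx.
have sd : s < sup S + d by rewrite /s gt_min; apply/orP; right; rlra.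
have : S s.
  split; first by rewrite sb andbT ltW// (le_lt_trans ac).
  move=> r /andP[ar rs]; have [rS|] := ltP r (sup S).
    by apply: below; rewrite ar.
  rewrite le_eqVlt => /predU1P[<-//|Sr].
  by apply: Hd => //; [exact: le_lt_trans rs sd|exact: le_trans rs sb].
move=> /(ub_le_sup _)/= H; have : s <= sup S by apply: H; exists b.
by rewrite leNgt ss.
Qed.

Lemma contP f : continuous f <-> forall x e, 0 < e ->
  exists2 d, 0 < d & forall s, `|s - x| < d -> `|f s - f x| < e.
Proof.
split=> [cf x e e0|H x].
  have /cvgrPdist_lt/(_ _ e0)/nbhs_ballP[d /= d0 Hd] := cf x.
  exists d => // s sx; rewrite distrC; apply: Hd.
  by rewrite /ball/= distrC.
apply/cvgrPdist_lt => e e0; have [d d0 Hd] := H x e e0.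
apply/nbhs_ballP; exists d => //= s; rewrite /ball/= => h.
by rewrite distrC; apply: Hd; rewrite distrC.
Qed.

(** For each e the bound |Phi t - Phi a| <= e (m t - m a) propagates by [real_induction]; then e
    tends to 0. With m the primitive of an integrable function, this proves the product and chain
    rules without differentiating at almost every point. *)
Lemma flat_const (Phi m : R -> R) : continuous Phi -> continuous m ->
  (forall x e, 0 < e -> exists2 d, 0 < d & forall s, x <= s -> s < x + d ->
     `|Phi s - Phi x| <= e * (m s - m x)) ->
  forall a b, Phi a = Phi b.
Proof.
move=> cP cm H a b; wlog ab : a b / a <= b.
  by move=> h; have [/h//|/ltW/h] := leP a b.
have step e : 0 < e -> `|Phi b - Phi a| <= e * (m b - m a).
  move=> e0.
  apply: (@real_induction (fun t => `|Phi t - Phi a| <= e * (m t - m a)) a b) => //.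
  - by rewrite !subrr normr0 mulr0.
  - move=> t _ At; have [d d0 Hd] := H t e e0; exists d => // s ts sd _.
    have := Hd s (ltW ts) sd; have := ler_distD (Phi t) (Phi s) (Phi a).
    rlra.
  - move=> t /andP[at_ tb] Hs; rewrite leNgt; apply/negP => lt.
    pose u s := `|Phi s - Phi a| - e * (m s - m a).
    have cu : continuous u.
      move=> s; apply: cvgB.
        by apply: cvg_norm; apply: cvgB; [exact: cP|exact: cvg_cst].
      by apply: cvgM; [exact: cvg_cst|apply: cvgB; [exact: cm|exact: cvg_cst]].
    have ut : 0 < u t by rewrite subr_gt0.
    have [d d0 Hd] := (contP u).1 cu t _ ut.
    pose s := Num.max a (t - d / 2).
    have sa : a <= s by rewrite le_max lexx.
    have st : s < t by rewrite /s gt_max at_/=; rlra.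
    have sd : t - d / 2 <= s by rewrite /s le_max lexx orbT.
    have : u s <= 0 by rewrite /u subr_le0; apply: Hs; rewrite sa.
    have : `|s - t| < d by rewrite ltr_norml; apply/andP; split; rlra.
    by move=> /Hd; rewrite ltr_norml => /andP[]; rlra.
apply/esym/eqP; rewrite -subr_eq0 -normr_le0 leNgt; apply/negP => D0.
set D := `|_| in step D0.
have k0 : 0 < 2 * (`|m b - m a| + 1) by rewrite mulr_gt0// ltr_wpDl.
have := step _ (divr_gt0 D0 k0).
have : D / (2 * (`|m b - m a| + 1)) * (m b - m a) < D; last by rlra.
rewrite mulrAC ltr_pdivrMr// ltr_pM2l//.
have := ler_norm (m b - m a); have := normr_ge0 (m b - m a); rlra.
Qed.

(* The pair of a W^{1,1}_loc function and a representative of its derivative. *)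
Definition abscont f g := L1loc g /\ forall a b, f b - f a = Int g a b.

Lemma AC_L1 f g : abscont f g -> L1loc g. Proof. by case. Qed.

Lemma ACE f g a b : abscont f g -> f b - f a = Int g a b. Proof. by case. Qed.

Lemma AC_prim f : L1loc f -> abscont (primitive f) f.
Proof. by []. Qed.

Lemma AC_cont f g : abscont f g -> continuous f.
Proof.
move=> [lg fg].
have -> : f = (fun x => primitive g x + (f 0 - primitive g 0)).
  by apply/funext => x; have := fg 0 x; rewrite /Int; rlra.
by move=> x; apply: cvgD; [exact: primitive_cont|exact: cvg_cst].
Qed.

Lemma AC_ae f g g' : abscont f g -> L1loc g' -> aeeq g g' -> abscont f g'.
Proof. by move=> [lg fg] lg' gg; split=> // a b; rewrite fg; exact: Int_ae. Qed.

Lemma AC_cst c : abscont (fun=> c) (fun=> 0).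
Proof. by split; [exact: L1loc_cst|move=> a b; rewrite Int_cst subrr mul0r]. Qed.

Lemma AC_id : abscont id (fun=> 1).
Proof. by split; [exact: L1loc_cst|move=> a b; rewrite Int_cst mul1r]. Qed.

Lemma ACD f f' g g' : abscont f f' -> abscont g g' ->
  abscont (fun x => f x + g x) (fun x => f' x + g' x).
Proof.
move=> [lf Hf] [lg Hg]; split; first exact: L1locD.
by move=> a b; rewrite IntD// -Hf -Hg; rlra.
Qed.

Lemma ACZ f f' c : abscont f f' -> abscont (fun x => c * f x) (fun x => c * f' x).
Proof.
move=> [lf Hf]; split; first exact: L1locZ.
by move=> a b; rewrite IntZ// -Hf; rlra.
Qed.

Lemma ACN f f' : abscont f f' -> abscont (fun x => - f x) (fun x => - f' x).
Proof.
move=> [lf Hf]; split; first exact: L1locN.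
by move=> a b; rewrite IntN// -Hf; rlra.
Qed.

Lemma ACB f f' g g' : abscont f f' -> abscont g g' ->
  abscont (fun x => f x - g x) (fun x => f' x - g' x).
Proof. by move=> /ACD H /ACN/H. Qed.

Lemma AC_cvg f f' a b : abscont f f' -> a <= b -> `|f b - f a| <= Int (fun x => `|f' x|) a b.
Proof. by move=> [lf Hf] ab; rewrite Hf; exact: Int_abs. Qed.

Lemma Int_cont_bd f g a b e : continuous f -> L1loc g -> a <= b ->
  (forall x, a <= x <= b -> `|f x| <= e) ->
  `|Int (fun x => f x * g x) a b| <= e * Int (fun x => `|g x|) a b.
Proof.
move=> cf lg ab H; rewrite -IntZ; last exact: L1loc_abs.
apply: Int_bd_in => //; [exact: L1locM_cont|exact/L1locZ/L1loc_abs|].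
by move=> x /H h; rewrite normrM ler_wpM2r.
Qed.

Lemma ACM f f' g g' : abscont f f' -> abscont g g' ->
  abscont (fun x => f x * g x) (fun x => f' x * g x + f x * g' x).
Proof.
move=> Hf Hg; have cf := AC_cont Hf; have cg := AC_cont Hg.
have lf := AC_L1 Hf; have lg := AC_L1 Hg.
have l1 : L1loc (fun x => f' x * g x).
  by under eq_fun do rewrite mulrC; exact: L1locM_cont.
have l2 : L1loc (fun x => f x * g' x) by exact: L1locM_cont.
have l : L1loc (fun x => f' x * g x + f x * g' x) by exact: L1locD.
split=> // a b.
pose Phi x := f x * g x - primitive (fun x => f' x * g x + f x * g' x) x.
suff: Phi a = Phi b by rewrite /Phi /Int; rlra.
have lA : L1loc (fun x => `|f' x| + `|g' x|) by apply: L1locD; exact: L1loc_abs.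
apply: (@flat_const _ (primitive (fun x => `|f' x| + `|g' x|))).
- move=> x; apply: cvgB; first by apply: cvgM; [exact: cf|exact: cg].
  exact: primitive_cont.
- exact: primitive_cont.
move=> x e e0; have e2 : 0 < e / 2 by rlra.
have [d1 d10 H1] := (contP f).1 cf x _ e2.
have [d2 d20 H2] := (contP g).1 cg x _ e2.
exists (Num.min d1 d2); first by rewrite lt_min d10.
move=> s xs; rewrite -ltrBlDl lt_min => /andP[sd1 sd2].
have cg' : continuous (fun r => g s - g r).
  by move=> r; apply: cvgB; [exact: cvg_cst|exact: cg].
have cf' : continuous (fun r => f x - f r).
  by move=> r; apply: cvgB; [exact: cvg_cst|exact: cf].
(* Freezing g at the right end and f at the left end makes the increment of the product exact: g s
   (f s - f x) + f x (g s - g x). What remains are the two derivatives weighted by oscillations of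
   size at most e. *)
have -> : Phi s - Phi x = Int (fun r => (g s - g r) * f' r) x s
                        + Int (fun r => (f x - f r) * g' r) x s.
  have -> : Int (fun r => (g s - g r) * f' r) x s =
            g s * (f s - f x) - Int (fun x => f' x * g x) x s.
    rewrite (ACE _ _ Hf) -IntZ// -IntB//; last exact: L1locZ.
    by congr Int; apply/funext => r; rlra.
  have -> : Int (fun r => (f x - f r) * g' r) x s =
            f x * (g s - g x) - Int (fun x => f x * g' x) x s.
    rewrite (ACE _ _ Hg) -IntZ// -IntB//; last exact: L1locZ.
    by congr Int; apply/funext => r; rlra.
  have : Phi s - Phi x = f s * g s - f x * g x
    - Int (fun x => f' x * g x + f x * g' x) x s by rewrite /Phi /Int; rlra.
  by move=> ->; rewrite IntD//; rlra.
have near1 r : x <= r <= s -> `|r - x| < d1 /\ `|r - x| < d2.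
  by move=> /andP[xr rs]; rewrite ger0_norm ?subr_ge0//; split; rlra.
have snear := near1 s (introT andP (conj xs (lexx s))).
have B1 : `|Int (fun r => (g s - g r) * f' r) x s| <= e * Int (fun x => `|f' x|) x s.
  apply: Int_cont_bd => // r /near1[_ h].
  have := H2 _ snear.2; have := H2 _ h; rewrite !ltr_norml ler_norml.
  by move=> /andP[? ?] /andP[? ?]; apply/andP; split; rlra.
have B2 : `|Int (fun r => (f x - f r) * g' r) x s| <= e * Int (fun x => `|g' x|) x s.
  apply: Int_cont_bd => // r /near1[h _].
  have := H1 _ h; rewrite !ltr_norml ler_norml.
  by move=> /andP[? ?]; apply/andP; split; rlra.
have -> : forall F, primitive F s - primitive F x = Int F x s by [].
rewrite IntD; [|exact: L1loc_abs|exact: L1loc_abs].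
rewrite mulrDr; apply: le_trans (ler_normD _ _) _; exact: lerD.
Qed.

(** Near f x, psi is its tangent up to e |v - f x|, and |f s - f x| is at most the increment of the
    primitive of |f'|; so [flat_const] applies with that primitive as m. *)
Lemma AC_comp (psi psi' : R -> R) f f' : continuous psi' ->
  (forall u : R, is_derive u (1 : R) psi (psi' u)) -> abscont f f' ->
  abscont (fun x => psi (f x)) (fun x => psi' (f x) * f' x).
Proof.
move=> cpsi' dpsi Hf; have cf := AC_cont Hf; have lf := AC_L1 Hf.
have cpsi : continuous psi.
  move=> u; apply/differentiable_continuous/derivable1_diffP.
  by case: (dpsi u).
have cpf : continuous (fun x => psi' (f x)).
  by move=> x; apply: (@continuous_comp _ _ _ f psi'); [exact: cf|exact: cpsi'].
have l : L1loc (fun x => psi' (f x) * f' x) by exact: L1locM_cont.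
split=> // a b.
pose Phi x := psi (f x) - primitive (fun x => psi' (f x) * f' x) x.
suff: Phi a = Phi b by rewrite /Phi /Int; rlra.
apply: (@flat_const _ (primitive (fun x => `|f' x|))).
- move=> x; apply: cvgB; last exact: primitive_cont.
  by apply: (@continuous_comp _ _ _ f psi); [exact: cf|exact: cpsi].
- by apply: primitive_cont; exact: L1loc_abs.
move=> x e e0; have e2 : 0 < e / 2 by rlra.
have [d1 d10 H1] := (contP _).1 cpf x _ e2.
have [d2 d20 H2] : exists2 d, 0 < d & forall v, `|v - f x| < d ->
    `|psi v - psi (f x) - psi' (f x) * (v - f x)| <= e / 2 * `|v - f x|.
  have [dv <-] := dpsi (f x).
  have /cvgrPdist_le/(_ _ e2)/nbhs_ballP[d /= d0 Hd] := dv.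
  exists d => // v vd; have [->|vf] := eqVneq v (f x).
    by rewrite !subrr mulr0 subr0 normr0 mulr0.
  have := Hd (v - f x); rewrite /ball/= sub0r normrN => /(_ vd).
  rewrite subr_eq0 => /(_ vf); rewrite /GRing.scale/= mulr1 subrK.
  have vf0 : v - f x != 0 by rewrite subr_eq0.
  rewrite -/('D_1 psi (f x)) => h.
  have -> : psi v - psi (f x) - 'D_1 psi (f x) * (v - f x) =
    - ('D_1 psi (f x) - (v - f x)^-1 * (psi v - psi (f x))) * (v - f x).
    by rewrite opprB mulrBl mulrAC mulVf// mul1r.
  by rewrite normrM normrN ler_wpM2r.
have [d3 d30 H3] := (contP f).1 cf x _ d20.
exists (Num.min d1 d3); first by rewrite lt_min d10.
move=> s xs; rewrite -ltrBlDl lt_min => /andP[sd1 sd3].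
have sx : `|s - x| < d3 by rewrite ger0_norm ?subr_ge0.
have c' : continuous (fun r => psi' (f r) - psi' (f x)).
  by move=> r; apply: cvgB; [exact: cpf|exact: cvg_cst].
have -> : Phi s - Phi x = psi (f s) - psi (f x) - psi' (f x) * (f s - f x)
   - Int (fun r => (psi' (f r) - psi' (f x)) * f' r) x s.
  rewrite (_ : Int (fun r => (psi' (f r) - psi' (f x)) * f' r) x s =
    Int (fun r => psi' (f r) * f' r) x s - psi' (f x) * (f s - f x)); last first.
    rewrite (ACE _ _ Hf) -IntZ// -IntB//; last exact: L1locZ.
    by congr Int; apply/funext => r; rewrite mulrBl.
  by rewrite /Phi /Int; rlra.
have B1 := H2 _ (H3 _ sx).
have B1' := AC_cvg Hf xs.
have B2 : `|Int (fun r => (psi' (f r) - psi' (f x)) * f' r) x s| <=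
    e / 2 * Int (fun r => `|f' r|) x s.
  apply: Int_cont_bd => // r /andP[xr rs].
  by apply/ltW/H1; rewrite ger0_norm ?subr_ge0//; rlra.
have -> : forall F, primitive F s - primitive F x = Int F x s by [].
apply: le_trans (ler_normB _ _) _.
have : e / 2 * `|f s - f x| <= e / 2 * Int (fun x => `|f' x|) x s by rewrite ler_wpM2l// ltW.
rlra.
Qed.

Lemma AC_expR f f' : abscont f f' -> abscont (fun x => expR (f x)) (fun x => expR (f x) * f' x).
Proof. by apply: AC_comp => //; exact: continuous_expR. Qed.

Lemma AC_C1 (psi psi' : R -> R) : continuous psi' ->
  (forall u : R, is_derive u (1 : R) psi (psi' u)) -> abscont psi psi'.
Proof.
move=> c d; have := AC_comp c d AC_id.
by under [X in abscont _ X]eq_fun do rewrite mulr1.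
Qed.

End ac.

(** * Weak derivatives *)

Section weak.
Context {R : realType}.
Implicit Types (f g : R -> R) (a b c x : R).
Local Notation mu := (@lebesgue_measure R).

Lemma is_derive_primitive f x : L1loc f -> lebesgue_pt f x ->
  is_derive x (1 : R) (primitive f) (f x).
Proof.
move=> lf fx.
have xu : x < x + 1 by rlra.
have ax : (((x - 1)%:E < x%:E)%E) by rewrite lte_fin; rlra.
have [df Ef] := FTC1_lebesgue_pt xu (L1loc_int (x - 1) (x + 1) lf) ax fx.
apply: (@near_eq_is_derive _ _ _
  (fun z => (\int[mu]_(t in `[x - 1, z]) f t) + primitive f (x - 1))).
  near=> z; rewrite -Int_itv ?subrK//.
  by apply/ltW; near: z; apply: lt_nbhsr; rlra.
rewrite -[f x]addr0; apply: is_deriveD.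
by rewrite -Ef derive1E; exact: DeriveDef.
Unshelve. all: by end_near. Qed.

(** At a Lebesgue point f is the limit of its averages over shrinking intervals, so intervals of
    length at most 1 decide its sign. *)
Lemma Int_ge0_ae f : L1loc f -> (forall a b, a <= b -> b <= a + 1 -> 0 <= Int f a b) ->
  {ae mu, forall x, 0 <= f x}.
Proof.
move=> lf H; have := lebesgue_differentiation lf.
apply: aeS => x /(is_derive_primitive lf)[dx <-].
apply: limr_ge; first exact: dx.
near=> h; rewrite /= /GRing.scale/= mulr1.
have h0 : h != 0 by near: h; exact: nbhs_dnbhs_neq.
have h1 : `|h| < 1.
  near: h; apply: dnbhs0_lt; exact: ltr01.
have [hp|hn] := leP 0 h.
  apply: mulr_ge0; first by rewrite invr_ge0.
  by apply: H; move: h1; rewrite ltr_norml => /andP[]; rlra.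
apply: mulr_le0; first by rewrite invr_le0 ltW.
by rewrite -oppr_ge0 opprB; apply: H; move: h1; rewrite ltr_norml => /andP[]; rlra.
Unshelve. all: by end_near. Qed.

Lemma AC_nondecr_ge0 f g : abscont f g -> (forall a b, a <= b -> b <= a + 1 -> f a <= f b) ->
  {ae mu, forall x, 0 <= g x}.
Proof.
move=> [lg fg] H; apply: Int_ge0_ae => // a b ab b1.
by rewrite -fg subr_ge0; exact: H.
Qed.

Lemma AC_uniq f g g' : abscont f g -> abscont f g' -> aeeq g g'.
Proof.
move=> [lg H] [lg' H'].
have : {ae mu, forall x, 0 <= g x - g' x}.
  apply: Int_ge0_ae => [|a b _ _]; first exact: L1locB.
  by rewrite IntB// -H -H' subrr.
have : {ae mu, forall x, 0 <= g' x - g x}.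
  apply: Int_ge0_ae => [|a b _ _]; first exact: L1locB.
  by rewrite IntB// -H -H' subrr.
by apply: aeS2 => x h1 h2; apply/eqP; rewrite eq_le; apply/andP; split; rlra.
Qed.

Lemma AC_lip_bd f g K : abscont f g -> (forall a b, a <= b -> b <= a + 1 -> `|f b - f a| <= K * (b - a)) ->
  {ae mu, forall x, `|g x| <= K}.
Proof.
move=> Hf H.
have H1 : {ae mu, forall x, 0 <= K * 1 - g x}.
  apply: AC_nondecr_ge0 (ACB (ACZ K (@AC_id R)) Hf) _ => a b ab /(H a b ab).
  by rewrite ler_norml => /andP[]; rlra.
have H2 : {ae mu, forall x, 0 <= K * 1 + g x}.
  apply: AC_nondecr_ge0 (ACD (ACZ K (@AC_id R)) Hf) _ => a b ab /(H a b ab).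
  by rewrite ler_norml => /andP[]; rlra.
by apply: aeS2 H1 H2 => x h1 h2; rewrite ler_norml; apply/andP; split; rlra.
Qed.

Lemma AC_test (phi : R -> R^o) : test_function phi -> abscont phi (derive1 phi).
Proof.
move=> [dphi cphi _]; apply: AC_C1 => // u.
by rewrite derive1E; exact: DeriveDef.
Qed.

Lemma test_supp (phi : R -> R^o) : test_function phi ->
  exists2 r, 0 <= r & forall x, r < `|x| -> phi x = 0 /\ derive1 phi x = 0.
Proof.
move=> [dphi cphi [r Hr]]; exists (Num.max r 0); first by rewrite le_max lexx orbT.
move=> x; rewrite gt_max => /andP[rx _]; split; first exact: Hr.
rewrite derive1E (@near_eq_derive _ _ _ _ (fun=> 0)) ?derive_cst//.
near=> z; apply: Hr; near: z.
have : (fun z : R => `|z|) z @[z --> x] --> `|x| by exact: norm_continuous.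
by move=> /cvgr_gt; apply.
Unshelve. all: by end_near. Qed.

Lemma Rint_supp F r : L1loc F -> 0 <= r -> (forall x, r < `|x| -> F x = 0) ->
  \int[mu]_x F x = Int F (- r) r.
Proof.
move=> lF r0 HF; rewrite Int_itv//; last rlra.
rewrite [RHS]Rintegral_mkcond; congr (Rintegral _ _ _); apply/funext => x.
rewrite patchE; case: ifPn => //; rewrite notin_setE /= in_itv/= => /negP.
rewrite -ler_norml -ltNge; exact: HF.
Qed.

Lemma AC_weak f g : abscont f g -> weak_derivative f g.
Proof.
move=> Hf phi tphi; have [r r0 Hr] := test_supp tphi.
have aphi := AC_test tphi; have [_ cphi' _] := tphi.
have lg := AC_L1 Hf; have cf := AC_cont Hf.
have l1 : L1loc (fun x => f x * derive1 phi x).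
  by apply: L1locM_cont => //; exact: L1loc_cont.
have l2 : L1loc (fun x => g x * phi x).
  by under eq_fun do rewrite mulrC; apply: L1locM_cont => //; exact: AC_cont aphi.
have r1 : 0 <= r + 1 by rlra.
have big x : r + 1 < `|x| -> r < `|x| by rlra.
rewrite (Rint_supp l1 r1) => [|x /big/Hr[_ ->]]; last by rewrite mulr0.
rewrite (Rint_supp l2 r1) => [|x /big/Hr[-> _]]; last by rewrite mulr0.
have := (ACM Hf aphi).2 (- (r + 1)) (r + 1).
rewrite IntD//.
have h1 : r < `|r + 1| by rewrite ger0_norm; rlra.
have h2 : r < `|- (r + 1)| by rewrite normrN.
have [-> _] := Hr _ h1; have [-> _] := Hr _ h2; rlra.
Qed.

(** The positive part of e - |x|, a hat supported in [-e, e]. *)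
Definition tent (e x : R) := (e - `|x| + `|e - `|x| |) / 2.

Lemma tent_cont e : continuous (tent e).
Proof.
move=> x; apply: cvgM; last exact: cvg_cst.
have c1 : (fun z => e - `|z|) z @[z --> x] --> e - `|x|.
  by apply: cvgB; [exact: cvg_cst|exact: norm_continuous].
by apply: cvgD => //; exact: cvg_norm.
Qed.

Lemma tent_ge0 e x : 0 <= tent e x.
Proof.
rewrite /tent; move: (e - _) => y; have := ler_norm (- y); rewrite normrN => h.
by apply: divr_ge0 => //; rlra.
Qed.

Lemma tent_out e x : e <= `|x| -> tent e x = 0.
Proof. by move=> h; rewrite /tent (@ler0_norm _ (e - _)) ?subr_le0//; rlra. Qed.

Lemma tent_in e x : `|x| <= e -> tent e x = e - `|x|.
Proof. by move=> h; rewrite /tent (@ger0_norm _ (e - _)) ?subr_ge0//; rlra. Qed.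

Lemma is_derive_prim_cont k x : continuous k -> is_derive x (1 : R) (primitive k) (k x).
Proof.
move=> ck; apply: is_derive_primitive; first exact: L1loc_cont.
apply: (@continuous_lebesgue_pt _ _ _ setT) => //; last exact: ck.
- by split=> //; exact: openT.
- exact: cont_meas.
Qed.

Lemma tent_prim_pos e : 0 < e -> primitive (tent e) (- e) < primitive (tent e) e.
Proof.
move=> e0; rewrite -subr_gt0 -/(Int (tent e) (- e) e).
have lt := L1loc_cont (@tent_cont e).
have e2 : - (e / 2) <= e / 2 by rlra.
apply: lt_le_trans (_ : Int (tent e) (- (e / 2)) (e / 2) <= _).
  apply: lt_le_trans (_ : Int (fun=> e / 2) (- (e / 2)) (e / 2) <= _).
    by rewrite Int_cst; nra.
  apply: Int_le_in => //; first exact: L1loc_cst.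
  move=> x; rewrite -ler_norml => xe.
  by rewrite tent_in; rlra.
by apply: Int_sub => //; [exact: tent_ge0|rlra|rlra].
Qed.

Lemma tent_prim_hi e x : 0 < e -> e <= x -> primitive (tent e) x = primitive (tent e) e.
Proof.
move=> e0 ex; apply/eqP; rewrite -subr_eq0 -/(Int _ _ _).
rewrite (@Int_eq_in _ _ (fun=> 0))//; [by rewrite Int_cst mul0r|exact/L1loc_cont/tent_cont|exact: L1loc_cst|].
by move=> y /andP[ey _]; apply: tent_out; rewrite (le_trans ey)// ler_norm.
Qed.

Lemma tent_prim_lo e x : 0 < e -> x <= - e -> primitive (tent e) x = primitive (tent e) (- e).
Proof.
move=> e0 ex; apply/esym/eqP; rewrite -subr_eq0 -/(Int _ _ _).
rewrite (@Int_eq_in _ _ (fun=> 0))//; [by rewrite Int_cst mul0r|exact/L1loc_cont/tent_cont|exact: L1loc_cst|].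
by move=> y /andP[_ ey]; apply: tent_out; rewrite ler0_norm; rlra.
Qed.

(** Du Bois-Reymond's lemma. The test function is the difference of two smoothed steps centred at a
    and b, whose derivative is the difference of two tents of equal mass K. The hypothesis equates
    the integrals of u against the two tents, and for small e each is within |u a - u b| K / 4 of K
    times the value of u at the centre. *)
Lemma weak0_const u : continuous u -> weak_derivative u (fun=> 0) ->
  forall a b, u a = u b.
Proof.
move=> cu wu a b; apply/eqP; rewrite -subr_eq0 -normr_le0 leNgt; apply/negP => D0.
set D := `|_| in D0.
have D4 : 0 < D / 4 by rlra.
have [da da0 Ha] := (contP u).1 cu a _ D4.
have [db db0 Hb] := (contP u).1 cu b _ D4.
pose e := Num.min da db / 2.
have e0 : 0 < e by rewrite divr_gt0// lt_min da0.
have eda : e < da by have : Num.min da db <= da by [rewrite ge_min lexx]; rewrite /e; rlra.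
have edb : e < db.
  by have : Num.min da db <= db by [rewrite ge_min lexx orbT]; rewrite /e; rlra.
pose th c x := primitive (tent e) (x - c).
pose dth c x := tent e (x - c).
have dth_der c x : is_derive x (1 : R) (th c) (dth c x).
  rewrite -[dth c x]mulr1; apply: (@is_derive1_comp _ (primitive (tent e)) (fun x => x - c)).
    exact/is_derive_prim_cont/tent_cont.
  by apply: (is_derive_eq (is_deriveB (is_derive_id x 1) (is_derive_cst c x 1))); rewrite subr0.
have dth_cont c : continuous (dth c).
  move=> x; apply: (@continuous_comp _ _ _ (fun x => x - c) (tent e)); last exact: tent_cont.
  by apply: cvgB; [exact: cvg_id|exact: cvg_cst].
pose phi : R -> R^o := fun x => th a x - th b x.
have dphi x : is_derive x (1 : R) phi (dth a x - dth b x) by apply: is_deriveB.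
have dphiE : derive1 phi = (fun x => dth a x - dth b x).
  by apply/funext => x; rewrite derive1E; case: (dphi x).
pose r := `|a| + `|b| + e.
have rge c : `|c| <= `|a| + `|b| -> e <= r - c /\ - r - c <= - e.
  by move=> h; have := ler_norm c; have := ler_norm (- c); rewrite normrN /r; split; rlra.
have r0 : 0 <= r by rewrite /r !addr_ge0// ltW.
have ha : `|a| <= `|a| + `|b| by rewrite lerDl.
have hb : `|b| <= `|a| + `|b| by rewrite lerDr.
have tphi : test_function phi.
  split; first by move=> x; case: (dphi x).
    by rewrite dphiE => x; apply: cvgB; exact: dth_cont.
  exists r => x; rewrite /phi /th; have [x0|x0] := leP 0 x.
    rewrite ger0_norm// => rx; have [? _] := rge _ ha; have [? _] := rge _ hb.
    by rewrite !tent_prim_hi ?subrr//; rlra.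
  rewrite ltr0_norm// => rx; have [_ ?] := rge _ ha; have [_ ?] := rge _ hb.
  by rewrite !tent_prim_lo ?subrr//; rlra.
have Ic c : `|c| <= `|a| + `|b| ->
    Int (dth c) (- r) r = primitive (tent e) e - primitive (tent e) (- e).
  move=> /rge[h1 h2]; rewrite -((AC_C1 (@dth_cont c) (dth_der c)).2 (- r) r).
  by rewrite /th (tent_prim_hi e0 h1) (tent_prim_lo e0 h2).
set K := primitive _ _ - _ in Ic.
have K0 : 0 < K by rewrite subr_gt0; exact: tent_prim_pos.
have rr : - r <= r by rlra.
have est c d : `|c| <= `|a| + `|b| -> e < d ->
    (forall s, `|s - c| < d -> `|u s - u c| < D / 4) ->
    `|Int (fun x => u x * dth c x) (- r) r - u c * K| <= D / 4 * K.
  move=> hc ed Hc; rewrite -(Ic c hc) -!IntZ; [|exact: L1loc_cont..].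
  rewrite -IntB; [|exact/L1locM_cont/L1loc_cont|exact/L1locZ/L1loc_cont].
  apply: Int_bdW => //.
    by apply: L1locB; [exact/L1locM_cont/L1loc_cont|exact/L1locZ/L1loc_cont].
    exact/L1locZ/L1loc_cont.
  move=> x; rewrite -mulrBl normrM [`|dth c x|]ger0_norm; last exact: tent_ge0.
  have [xe|xe] := leP e `|x - c|; first by rewrite /dth tent_out// !mulr0.
  by rewrite ler_wpM2r ?tent_ge0// ltW// Hc// (lt_trans xe).
have E1 := est _ _ ha eda Ha; have E2 := est _ _ hb edb Hb.
have := wu phi tphi; rewrite (Rint_supp (r := r))//; last 2 first.
- by apply: L1locM_cont => //; apply: L1loc_cont; rewrite dphiE => x; apply: cvgB; exact: dth_cont.
- move=> x rx; rewrite dphiE /dth !tent_out ?subrr ?mulr0//.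
    by rewrite distrC; have := ler_distD 0 x b; rewrite !subr0 sub0r /r in rx *; have := ler_normD (x - b) b; rewrite subrK distrC; have := normr_ge0 a; rlra.
    by have := ler_normD (x - a) a; rewrite subrK; have := normr_ge0 b; rewrite /r in rx; rlra.
rewrite dphiE (_ : (fun x => _) = (fun x => u x * dth a x - u x * dth b x)); last first.
  by apply/funext => x; rewrite mulrBr.
rewrite IntB; [|exact/L1locM_cont/L1loc_cont..].
under eq_Rintegral do rewrite mul0r.
rewrite Rintegral_cst// mul0r oppr0 => /eqP; rewrite subr_eq0 => /eqP eqab.
rewrite eqab in E1.
have : `|(u a - u b) * K| <= D / 2 * K.
  move: E1 E2; move: (Int _ _ _) => I E1 E2; clear -E1 E2.
  by move: E1 E2; rewrite mulrBl !ler_norml => /andP[? ?] /andP[? ?]; apply/andP; split; rlra.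
rewrite normrM (gtr0_norm K0) ler_pM2r// -/D; rlra.
Qed.

(** The primitive of g also has weak derivative g, so f minus it is continuous with weak derivative
    0, hence constant. *)
Lemma weak_AC f g : continuous f -> L1loc g -> weak_derivative f g -> abscont f g.
Proof.
move=> cf lg wfg.
have Ha := AC_prim lg.
have cp := AC_cont Ha.
have cu : continuous (fun x => f x - primitive g x).
  by move=> x; apply: cvgB; [exact: cf|exact: cp].
have wu : weak_derivative (fun x => f x - primitive g x) (fun=> 0).
  move=> phi tphi; have := wfg phi tphi; have := AC_weak Ha tphi.
  have [r r0 Hr] := test_supp tphi; have [_ c' _] := tphi.
  have L1 (F : R -> R) : continuous F -> L1loc (fun x => F x * derive1 phi x).
    by move=> cF; apply: L1locM_cont => //; exact: L1loc_cont.
  have E (F : R -> R) : continuous F -> \int[mu]_x (F x * derive1 phi x) =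
      Int (fun x => F x * derive1 phi x) (- r) r.
    move=> cF; apply: Rint_supp => //; first exact: L1.
    by move=> x /Hr[_ ->]; rewrite mulr0.
  rewrite !E// (_ : (fun x => (f x - _) * _) =
    (fun x => f x * derive1 phi x - primitive g x * derive1 phi x)); last first.
    by apply/funext => x; rewrite mulrBl.
  rewrite IntB; [|exact: L1|exact: L1].
  move=> -> ->; rewrite subrr.
  under eq_Rintegral do rewrite mul0r.
  by rewrite Rintegral_cst// mul0r oppr0.
split=> // a b; have := weak0_const cu wu a b; rewrite /Int; rlra.
Qed.

Lemma W11locP f : W11loc f <-> exists g, abscont f g.
Proof.
split=> [[cf _ [g lg wg]]|[g Hg]]; first by exists g; exact: weak_AC.
have cf := AC_cont Hg.
split=> //; first exact: L1loc_cont.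
by exists g; [exact: AC_L1 Hg|exact: AC_weak].
Qed.

Lemma AC_wderiv f : W11loc f -> abscont f (wderiv f).
Proof.
move=> [cf _ [g lg wg]]; rewrite /wderiv.
have [l w] := xgetPex (fun=> 0 : R) (ex_intro _ g (conj lg wg) :
  exists h, [set h | L1loc h /\ weak_derivative f h] h).
by apply: weak_AC; [exact: cf|exact: l|exact: w].
Qed.

Lemma wderivE f g : abscont f g -> aeeq (wderiv f) g.
Proof.
move=> Hf; have Wf : W11loc f by apply/W11locP; exists g.
exact: AC_uniq (AC_wderiv Wf) Hf.
Qed.

End weak.

(** * Change of variables and relabelings *)

Section density.
Context {R : realType}.
Local Notation mu := (@lebesgue_measure R).
Variables (w f : R -> R).
Hypotheses (mw : measurable_fun setT w) (w0 : forall x, 0 <= w x).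
Hypotheses (mf : measurable_fun setT f)
  (fitv : forall a b, a < b -> (\int[mu]_(x in f @^-1` `]a, b]) (w x)%:E = (b - a)%:E)%E).

(** The image under f of the measure with density w. By [fitv] it agrees with Lebesgue measure on
    half-open intervals, which determines it. *)
Let dens (A : set (measurableTypeR R)) := (\int[mu]_(x in f @^-1` A) (w x)%:E)%E.

Let mEw (A : set R) : measurable_fun A (EFin \o w).
Proof. by apply/measurable_EFinP; exact: measurable_funTS. Qed.

Let mfpre (A : set R) : measurable A -> measurable (f @^-1` A).
Proof. by move=> mA; rewrite -[X in measurable X]setTI; exact: mf. Qed.

Let dens0 : dens set0 = 0%E.
Proof. by rewrite /dens preimage_set0 integral_set0. Qed.

Let dens_ge0 A : (0 <= dens A)%E.
Proof. by apply: integral_ge0 => x _; rewrite lee_fin. Qed.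

Let dens_sigma : semi_sigma_additive dens.
Proof.
move=> /= F mF tF mUF; rewrite /dens; apply: cvg_toP.
  apply: ereal_nondecreasing_is_cvgn => m n mn.
  by apply: lee_sum_nneg_natr => // k _ _; exact: dens_ge0.
rewrite preimage_bigcup ge0_integral_bigcup//.
- move=> k; apply: mfpre; exact: mF.
- exact: mEw.
- by move=> x _; rewrite lee_fin.
- apply/trivIsetP => /= i j _ _ ij; rewrite -preimage_setI.
  by move/trivIsetP : tF => /(_ _ _ _ _ ij) ->//; rewrite preimage_set0.
Qed.

HB.instance Definition _ := isMeasure.Build _ _ _ dens dens0 dens_ge0 dens_sigma.

Lemma dens_preimage A : measurable A ->
  mu A = (\int[mu]_(x in f @^-1` A) (w x)%:E)%E.
Proof.
move=> mA.
apply: (@lebesgue_measure_unique _ dens _ _ mA) => _ [[a b] _ <-] /=.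
rewrite lebesgue_measure_itv/= lte_fin.
have [ab|ba] := ltP a b; first by rewrite /dens fitv// EFinB.
by rewrite set_itv_ge ?bnd_simp -?leNgt// measure0.
Qed.

Import HBNNSimple.

(** For a simple function this is [dens_preimage] on each level set. Monotone convergence then
    applies on both sides, to the simple approximations of psi and to their composites with f. *)
Lemma ge0_subst (psi : R -> R) : measurable_fun setT psi -> (forall x, 0 <= psi x) ->
  (\int[mu]_x (psi x)%:E = \int[mu]_x (psi (f x) * w x)%:E)%E.
Proof.
move=> mpsi psi0.
have mE : measurable_fun setT (EFin \o psi) by exact/measurable_EFinP.
have E0 x : [set: R] x -> (0 <= (EFin \o psi) x)%E by rewrite /= lee_fin.
pose k := nnsfun_approx measurableT mE.
have mk n : measurable_fun [set: R] (k n) := measurable_funPT (k n).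
have kcvg x : (k n x)%:E @[n --> \oo] --> (psi x)%:E.
  exact: (cvg_nnsfun_approx measurableT mE E0).
have knd x a b : (a <= b)%N -> k a x <= k b x.
  by move=> ab; exact/lefP/nd_nnsfun_approx.
have -> : (\int[mu]_x (psi x)%:E = lim (\int[mu]_x (k n x)%:E @[n --> \oo]))%E.
  transitivity (\int[mu]_x (lim ((k n x)%:E @[n --> \oo])))%E.
    by apply: eq_integral => x _; apply/esym/cvg_lim => //; exact: kcvg.
  apply: monotone_convergence => //.
  - by move=> n; apply/measurable_EFinP; exact: mk.
  - by move=> n x _; rewrite lee_fin.
  - by move=> x _ a b ab; rewrite lee_fin knd.
have -> : (\int[mu]_x (psi (f x) * w x)%:E =
    lim (\int[mu]_x ((k n (f x)) * w x)%:E @[n --> \oo]))%E.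
  transitivity (\int[mu]_x (lim ((k n (f x) * w x)%:E @[n --> \oo])))%E.
    apply: eq_integral => x _; apply/esym/cvg_lim => //; rewrite EFinM.
    under eq_fun do rewrite EFinM.
    by apply: cvgeZr => //; exact: kcvg.
  apply: monotone_convergence => //.
  - move=> n; apply/measurable_EFinP; apply: measurable_funM => //.
    by apply: measurableT_comp => //; exact: mk.
  - by move=> n x _; rewrite lee_fin mulr_ge0.
  - by move=> x _ a b ab; rewrite lee_fin ler_wpM2r// knd.
suff suf n : (\int[mu]_x (k n x)%:E = \int[mu]_x (k n (f x) * w x)%:E)%E.
  by under eq_fun do rewrite suf.
have mk1 y : measurable (k n @^-1` [set y]) by exact: measurable_sfunP.
have y0 y : y \in range (k n) -> 0 <= y by rewrite inE => -[x _ <-].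
have mi y : measurable_fun [set: R] (\1_(k n @^-1` [set y]) : R -> R).
  exact: measurable_indic.
have mif y : measurable_fun [set: R] (fun x => \1_(k n @^-1` [set y]) (f x) : R).
  by apply: (measurableT_comp (mi y)).
transitivity (\sum_(y \in range (k n)) (y%:E * mu (k n @^-1` [set y])))%E.
  transitivity (\int[mu]_x (\sum_(y \in range (k n)) (y%:E * (\1_(k n @^-1` [set y]) x)%:E)))%E.
    apply: eq_integral => x _; rewrite /= fimfunE -fsumEFin//.
  rewrite ge0_integral_fsum//.
  - apply: eq_fsbigr => y /y0 yy.
    rewrite ge0_integralZl//; last (apply/measurable_EFinP; exact: (mi y)).
    congr (_ * _)%E; rewrite integral_indic//; last exact: (mk1 y).
    by congr (mu _); exact: setIT.
  - by move=> y; apply: emeasurable_funM => //; (apply/measurable_EFinP; exact: (mi y)).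
  - by move=> y x _; exact: nnfun_muleindic_ge0.
transitivity (\int[mu]_x (\sum_(y \in range (k n)) (y%:E * (\1_(k n @^-1` [set y]) (f x) * w x)%:E)))%E; last first.
  apply: eq_integral => x _; rewrite [in RHS]fimfunE mulr_fsuml// -fsumEFin//.
  by apply: eq_fsbigr => y _; rewrite -mulrA.
have mifw y : measurable_fun [set: R] (fun x => \1_(k n @^-1` [set y]) (f x) * w x).
  exact: measurable_funM.
have ge y x : y \in range (k n) -> (0 <= y%:E * (\1_(k n @^-1` [set y]) (f x) * w x)%:E)%E.
  by move=> /y0 yy; rewrite mule_ge0 ?lee_fin// mulr_ge0// indicE.
rewrite ge0_integral_fsum//.
- apply: eq_fsbigr => y /y0 yy.
  rewrite ge0_integralZl//; [|(apply/measurable_EFinP; exact: (mifw y))|by move=> x _; rewrite lee_fin mulr_ge0// indicE].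
  rewrite (dens_preimage (mk1 y)); congr (_ * _)%E.
  rewrite [LHS]integral_mkcond; apply: eq_integral => x _.
  have -> : \1_(k n @^-1` [set y]) (f x) = (x \in f @^-1` (k n @^-1` [set y]))%:R :> R.
    by rewrite indicE; congr (nat_of_bool _)%:R; apply/idP/idP; rewrite !inE.
  by rewrite patchE; case: (x \in _); rewrite ?mul1r ?mul0r.
- by move=> y; apply: emeasurable_funM => //; (apply/measurable_EFinP; exact: (mifw y)).
- move=> y x _; rewrite EFinM muleA; apply: mule_ge0; last by rewrite lee_fin.
  exact: nnfun_muleindic_ge0.
Qed.

End density.

(** * Quasi-periodic functions and essential bounds *)

Section relabelings.
Context {R : realType}.
Implicit Types (f g k : R -> R) (a b c x : R).
Local Notation mu := (@lebesgue_measure R).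

(** The increment al is 1 for y and for relabelings, 0 for periodic functions. *)
Definition qper (al : R) f := forall x, f (x + 1) = f x + al.

Lemma qper_nat al f n x : qper al f -> f (x + n%:R) = f x + n%:R * al.
Proof.
move=> pf; elim: n => [|n IHn]; first by rewrite addr0 mul0r addr0.
by rewrite -natr1 addrA pf IHn mulrDl mul1r addrA.
Qed.

Lemma qper_int al f (n : int) x : qper al f -> f (x + n%:~R) = f x + n%:~R * al.
Proof.
move=> pf; case: n => n; first exact: qper_nat.
rewrite NegzE mulrNz -[n.+1%:~R]/(n.+1%:R); set m := n.+1.
by have := qper_nat m (x - m%:R) pf; rewrite subrK => ->; rlra.
Qed.

Lemma floor_itvR x : exists n : int, 0 <= x - n%:~R < 1.
Proof.
exists (Num.floor x); have /andP[h1 h2] := floor_itv x.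
by rewrite subr_ge0 h1 /= ltrBlDr; move: h2; rewrite intrD addrC.
Qed.

Lemma Lnorm_infP (f : R -> R) (K : set R) (M : R) :
  ('N[mu]_+oo [EFin \o (f \_ K)] <= M%:E)%E <-> {ae mu, forall x, `|(f \_ K) x| <= M}.
Proof.
(* The norm of exponent +oo is the essential supremum only when the whole space has positive
   measure. *)
rewrite unlock ifT; last first.
  have : (mu (`[0%R, 1%R] : set R) <= mu setT)%E by apply: le_measure; rewrite ?inE//.
  by apply: lt_le_trans; rewrite lebesgue_measure_itv/= lte_fin ltr01 oppr0 adde0 lte_fin.
by split=> [/ess_supP|H]; [|apply/ess_supP; move: H]; apply: aeS => x /=; rewrite lee_fin.
Qed.

Lemma Lnorm_inf_fin (f : R -> R) (K : set R) :
  ('N[mu]_+oo [EFin \o (f \_ K)] < +oo)%E ->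
  exists M, {ae mu, forall x, `|(f \_ K) x| <= M}.
Proof.
move=> h; exists (fine ('N[mu]_+oo [EFin \o (f \_ K)])).
by apply/Lnorm_infP; rewrite fineK// ge0_fin_numE// Lnorm_ge0.
Qed.

Lemma LinflocP g : Linfloc g <-> measurable_fun setT g /\
  forall a b, exists M, {ae mu, forall x, a <= x <= b -> `|g x| <= M}.
Proof.
split=> [[mg H]|[mg H]]; split=> //.
  move=> a b; have [M HM] := Lnorm_inf_fin (H _ (@segment_compact _ a b)).
  exists M; apply: aeS HM => x + xab.
  by rewrite patchE mem_set//= in_itv/=.
move=> K cK; have [M [_ HM]] := compact_bounded cK.
have M1 : M < M + 1 by rlra.
have [C HC] := H (- (M + 1)) (M + 1).
apply: (@le_lt_trans _ _ (Num.max C 0)%:E); last exact: ltry.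
apply/Lnorm_infP; apply: aeS HC => x h.
rewrite patchE; case: ifPn => [/set_mem Kx|_]; last by rewrite normr0 le_max lexx orbT.
by rewrite le_max h// -ler_norml; apply: HM.
Qed.

Lemma Linfloc_cont g : continuous g -> Linfloc g.
Proof.
move=> cg; apply/LinflocP; split; first exact: cont_meas.
by move=> a b; have [M HM] := locbd_cont cg a b; exists M; apply: aeT.
Qed.

Lemma W1infloc_AC f : W1infloc f -> exists2 g, abscont f g & Linfloc g.
Proof.
move=> [cf _ [g lg wg]]; exists g => //; apply: weak_AC => //.
move: lg => /LinflocP[mg H]; apply/L1locP; split=> // a b.
have [M HM] := H a b.
have mgab : measurable_fun (`[a, b] : set R) g by exact: measurable_funTS.
apply/integrableP; split; first exact/measurable_EFinP.
have : (\int[mu]_(x in `[a, b]) `|(Num.max M 0)%:E| < +oo)%E.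
  by have /integrableP[_] := L1loc_int a b (L1loc_cst (Num.max M 0)).
apply: le_lt_trans; apply: ae_ge0_le_integral => //.
  by apply/measurable_EFinP/measurableT_comp.
apply: aeS HM => x /= h xab; rewrite lee_fin.
rewrite [leRHS]ger0_norm ?le_max ?lexx ?orbT//; apply/orP; left; apply: h.
by move: xab; rewrite in_itv.
Qed.

Lemma AC_W1infloc f g K : abscont f g -> {ae mu, forall x, `|g x| <= K} -> W1infloc f.
Proof.
move=> Hf gK; have cf := AC_cont Hf; split=> //; first exact: Linfloc_cont.
exists g; last exact: AC_weak.
apply/LinflocP; split; first by apply: L1loc_meas; exact: AC_L1 Hf.
by move=> a b; exists K; apply: aeS gK.
Qed.

Lemma AC_lip f g K a b : abscont f g -> {ae mu, forall x, `|g x| <= K} -> a <= b ->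
  `|f b - f a| <= K * (b - a).
Proof.
move=> [lg fg] gK ab; rewrite fg -Int_cst.
by apply: Int_bd => //; exact: L1loc_cst.
Qed.

(** An integer translation brings any interval of length at most 1 into [0, 2], where the essential
    bound holds; this makes f Lipschitz on short intervals everywhere, hence bounds its derivative
    a.e. The window has length 2 because the left end is only brought into [0, 1). *)
Lemma qper_Linf al f g : qper al f -> W1infloc f -> abscont f g ->
  exists K, {ae mu, forall x, `|g x| <= K}.
Proof.
move=> pf /W1infloc_AC[h Hf /LinflocP[mh Hh]] Hg.
have [K HK] := Hh 0 2; exists K.
suff : {ae mu, forall x, `|h x| <= K} by apply: aeS2 (AC_uniq Hf Hg) => x ->.
apply: (AC_lip_bd Hf) => a b ab ba.
have [n /andP[an na]] := floor_itvR a.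
have E c : f c = f (c - n%:~R) + n%:~R * al by rewrite -qper_int// subrK.
rewrite (E b) (E a).
have -> : K * (b - a) = Int (fun=> K) (a - n%:~R) (b - n%:~R) by rewrite Int_cst; rlra.
have -> : f (b - n%:~R) + n%:~R * al - (f (a - n%:~R) + n%:~R * al) =
  f (b - n%:~R) - f (a - n%:~R) by rlra.
rewrite (ACE _ _ Hf).
have ab' : a - n%:~R <= b - n%:~R by rlra.
have lh := AC_L1 Hf.
apply: Int_bd_aein => //; first exact: L1loc_cst.
by apply: aeS HK => x H /andP[h1 h2]; apply: H; apply/andP; split; rlra.
Qed.

End relabelings.

(** * Bi-Lipschitz relabelings: substitution, inverse, composition *)

Section rlb.
Context {R : realType}.
Implicit Types (f g k : R -> R) (a b c x : R).
Local Notation mu := (@lebesgue_measure R).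

(* The elements of G, with their derivative; see rlb_G and G_rlb. *)
Definition rlb f f' := [/\ abscont f f', qper 1 f &
  exists c C, 0 < c /\ {ae mu, forall x, c <= f' x <= C}].

Lemma rlb_bilip f f' : rlb f f' -> exists c C, 0 < c /\
  forall a b, a <= b -> c * (b - a) <= f b - f a <= C * (b - a).
Proof.
move=> [[lf Hf] _ [c [C [c0 H]]]]; exists c, C; split=> // a b ab.
rewrite Hf -!Int_cst; apply/andP; split; apply: Int_le => //; try exact: L1loc_cst.
  by apply: aeS H => x /andP[].
by apply: aeS H => x /andP[].
Qed.

Lemma rlb_lt f f' a b : rlb f f' -> a < b -> f a < f b.
Proof.
move=> /rlb_bilip[c [C [c0 H]]] ab; have /andP[+ _] := H a b (ltW ab).
by rewrite -subr_gt0; apply: lt_le_trans; rewrite mulr_gt0// subr_gt0.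
Qed.

Lemma rlb_leE f f' a b : rlb f f' -> (f a <= f b) = (a <= b).
Proof.
move=> rf; have [|ba] := leP a b; last by rewrite leNgt (rlb_lt rf ba).
by rewrite le_eqVlt => /predU1P[->|/(rlb_lt rf)/ltW//]; rewrite lexx.
Qed.

Lemma rlb_ltE f f' a b : rlb f f' -> (f a < f b) = (a < b).
Proof. by move=> rf; rewrite !ltNge (rlb_leE _ _ rf). Qed.

Lemma rlb_cont f f' : rlb f f' -> continuous f.
Proof. by case=> /AC_cont. Qed.

Lemma rlb_inj f f' : rlb f f' -> injective f.
Proof.
move=> rf x y e; apply/eqP.
by rewrite eq_le -(rlb_leE x y rf) -(rlb_leE y x rf) e lexx.
Qed.

(** The values f n = f 0 + n and f (- n) = f 0 - n enclose any given z for n large, so the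
    intermediate value theorem gives a preimage. *)
Lemma rlb_inv_ex f f' : rlb f f' -> exists g, cancel f g /\ cancel g f.
Proof.
move=> rf; have [_ pf _] := rf.
have surj z : exists x, f x = z.
  have [n hn] : exists n : nat, `|z - f 0| <= n%:R.
    by exists (Num.bound `|z - f 0|); apply/ltW/archi_boundP.
  move: hn; rewrite ler_norml => /andP[h1 h2].
  have E1 : f n%:R = f 0 + n%:R by rewrite -[n%:R]add0r (qper_nat _ _ pf) mulr1 add0r.
  have E2 : f (- n%:R) = f 0 - n%:R.
    by have := qper_nat n (- n%:R) pf; rewrite addNr mulr1 => ->; rlra.
  have n0 : (0 : R) <= n%:R by [].
  have nn : - n%:R <= n%:R :> R by rlra.
  have mm : Num.min (f (- n%:R)) (f n%:R) <= z <= Num.max (f (- n%:R)) (f n%:R).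
    by rewrite E1 E2 ge_min le_max; apply/andP; split; apply/orP; [left|right]; rlra.
  have [x _ <-] := IVT nn (continuous_subspaceT (rlb_cont rf)) mm.
  by exists x.
have [g Hg] := choice surj.
by exists g; split=> // x; apply: (rlb_inj rf); rewrite Hg.
Qed.

Lemma rlb_weight f f' : rlb f f' -> exists w, [/\ aeeq f' w, L1loc w,
  exists2 c, 0 < c & forall x, c <= w x,
  forall psi : R -> R, measurable_fun setT psi -> (forall x, 0 <= psi x) ->
    (\int[mu]_x (psi x)%:E = \int[mu]_x (psi (f x) * w x)%:E)%E &
  forall A : set R, measurable A -> mu A = (\int[mu]_(x in f @^-1` A) (w x)%:E)%E].
Proof.
move=> rf; have [Hf _ [c [C [c0 H]]]] := rf.
(* A representative of f' that is bounded below at every point, as the density lemmas and the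
   inverse function require. *)
pose w x := Num.max c (f' x).
have lf := AC_L1 Hf.
have mw : measurable_fun setT w.
  by apply: measurable_maxr => //; exact: L1loc_meas.
have fw : aeeq f' w by apply: aeS H => x /andP[cf _]; rewrite /w max_r.
have lw : L1loc w := L1loc_ae mw lf fw.
have w0 x : 0 <= w x by rewrite le_max (ltW c0).
have [g [fg gf]] := rlb_inv_ex rf.
have fitv a b : a < b -> (\int[mu]_(x in f @^-1` `]a, b]) (w x)%:E = (b - a)%:E)%E.
  move=> ab; have -> : f @^-1` `]a, b] = [set` `]g a, g b]].
    by apply/seteqP; split=> x /=; rewrite !in_itv/= -(rlb_ltE (g a) x rf) -(rlb_leE x (g b) rf) !gf.
  rewrite integral_itv_obnd_cbnd; last by apply/measurable_EFinP/measurable_funTS.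
  have gab : g a <= g b by rewrite -(rlb_leE (g a) (g b) rf) !gf ltW.
  have -> : b - a = Int w (g a) (g b) by rewrite -(ACE _ _ (AC_ae Hf lw fw)) !gf.
  rewrite Int_itv// /Rintegral fineK//.
  by apply: integrable_fin_num => //; exact: L1loc_int.
have mf : measurable_fun setT f := cont_meas (rlb_cont rf).
exists w; split=> //.
- by exists c => // x; rewrite le_max lexx.
- by move=> psi mpsi psi0; exact: ge0_subst.
- by move=> A mA; exact: dens_preimage.
Qed.

Lemma rlb_int f f' phi : rlb f f' -> L1loc phi ->
  L1loc (fun x => phi (f x) * f' x) /\
  forall a b, Int phi (f a) (f b) = Int (fun x => phi (f x) * f' x) a b.
Proof.
move=> rf lphi; have [Hf _ _] := rf; have [w [fw lw [c c0 cw] subst _]] := rlb_weight rf.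
have mf : measurable_fun setT f := cont_meas (rlb_cont rf).
have w0 x : 0 <= w x by apply: le_trans (cw x); exact: ltW.
have ge0 (psi : R -> R) a b : L1loc psi -> (forall x, 0 <= psi x) ->
    (\int[mu]_(x in `[a, b]) (psi (f x) * w x)%:E =
     \int[mu]_(x in `[f a, f b]) (psi x)%:E)%E.
  move=> lpsi psi0; pose p := psi \_ `[f a, f b].
  have p0 x : 0 <= p x by rewrite /p patchE; case: ifP.
  rewrite [RHS]integral_mkcond [RHS](_ : _ = (\int[mu]_x (p x)%:E)%E); last first.
    by apply: eq_integral => x _; rewrite /p !patchE; case: ifP.
  rewrite subst//; last by apply: L1loc_meas; exact: L1loc_patch.
  rewrite [LHS]integral_mkcond; apply: eq_integral => x _.
  rewrite /p !patchE; have -> : (f x \in [set` `[f a, f b]]) = (x \in [set` `[a, b]]).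
    by apply/idP/idP; rewrite !inE/= !in_itv/= !(rlb_leE _ _ rf).
  by case: ifP => //; rewrite mul0r.
have L (psi : R -> R) : L1loc psi -> L1loc (fun x => psi (f x) * w x).
  move=> lpsi; apply/L1locP.
  have m : measurable_fun setT (fun x => psi (f x) * w x).
    apply: measurable_funM; last exact: L1loc_meas.
    by apply: measurableT_comp => //; exact: L1loc_meas.
  split=> // a b; apply/integrableP; split.
    by apply/measurable_EFinP/measurable_funTS.
  have /integrableP[_] := L1loc_int (f a) (f b) (L1loc_abs lpsi).
  rewrite (_ : (\int[mu]_(x in `[f a, f b]) _ = \int[mu]_(x in `[f a, f b]) (`|psi x|)%:E)%E); last first.
    by apply: eq_integral => x _ /=; rewrite normr_id.
  rewrite -(ge0 (fun x => `|psi x|))//; last exact: L1loc_abs.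
  congr (_ < _)%E; apply: eq_integral => x _ /=.
  by rewrite normrM [`|w x|]ger0_norm.
have G0 (psi : R -> R) a b : L1loc psi -> (forall x, 0 <= psi x) ->
    Int psi (f a) (f b) = Int (fun x => psi (f x) * w x) a b.
  move=> lpsi psi0; wlog ab : a b / a <= b.
    move=> h; have [/h//|/ltW/h ba] := leP a b.
    by rewrite Int_swap ba -Int_swap.
  rewrite !Int_itv//; [|exact: L|by rewrite (rlb_leE _ _ rf)].
  by rewrite /Rintegral ge0.
have lw' : L1loc (fun x => phi (f x) * f' x).
  apply: L1loc_ae (L _ lphi) _.
    apply: measurable_funM; last by apply: L1loc_meas; exact: AC_L1 Hf.
    by apply: measurableT_comp => //; exact: L1loc_meas.
  by apply: aeS fw => x ->.
split=> // a b.
rewrite (Int_ae _ _ lw' (L _ lphi)); last by apply: aeS fw => x ->.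
(* phi is the difference of two nonnegative locally integrable functions, for which substitution is
   already known. *)
pose pp x := `|phi x| + phi x; pose pm x := `|phi x|.
have lpm : L1loc pm by exact: L1loc_abs.
have lpp : L1loc pp by exact: L1locD.
have pp0 x : 0 <= pp x.
  by rewrite /pp; have := ler_norm (- phi x); rewrite normrN; rlra.
have E : Int phi (f a) (f b) = Int pp (f a) (f b) - Int pm (f a) (f b).
  by rewrite -IntB//; congr Int; apply/funext => x; rewrite /pp /pm; rlra.
rewrite E (G0 pp)// (G0 pm)// -?IntB; [|exact: L|exact: L|by move=> x; exact: normr_ge0].
by congr Int; apply/funext => x; rewrite /pp /pm; rlra.
Qed.

Lemma rlb_AC f f' u u' : rlb f f' -> abscont u u' ->
  abscont (fun x => u (f x)) (fun x => u' (f x) * f' x).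
Proof.
move=> rf [lu Hu]; have [l H] := rlb_int rf lu.
by split=> // a b; rewrite Hu H.
Qed.

(** The weight is at least c > 0, so c times the measure of the preimage of a null set N is at most
    the integral of the weight over it, which is the measure of N. *)
Lemma rlb_ae f f' (A : R -> Prop) : rlb f f' -> {ae mu, forall x, A x} ->
  {ae mu, forall x, A (f x)}.
Proof.
move=> rf [N [mN N0 HN]]; have [w [fw lw [c c0 cw] _ pre]] := rlb_weight rf.
have mf : measurable_fun setT f := cont_meas (rlb_cont rf).
have mfN : measurable (f @^-1` N) by rewrite -[X in measurable X]setTI; exact: mf.
exists (f @^-1` N); split=> //; last by move=> x /= h; apply: HN => /= a; apply: h.
have := pre N mN; rewrite N0 => e0.
have : (c%:E * mu (f @^-1` N) <= 0)%E.
  rewrite e0 -integral_cst//; apply: ge0_le_integral => //.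
  - by move=> x _; rewrite lee_fin ltW.
  - by apply/measurable_EFinP; apply: measurable_funTS; exact: L1loc_meas.
  - by move=> x _; rewrite lee_fin.
move=> h; apply/eqP; rewrite eq_le measure_ge0 andbT.
by move: h; rewrite pmule_rle0// lte_fin.
Qed.

Lemma rlb_meas f f' : rlb f f' -> measurable_fun setT f.
Proof. by move=> rf; apply: cont_meas; exact: rlb_cont rf. Qed.

(** The derivative of the inverse g is 1 / w(g). Substituting f in its integral leaves the integrand
    1, so the integral between f x and f x' is x' - x. *)
Lemma rlb_inv f f' : rlb f f' -> exists g g', [/\ rlb g g', cancel f g & cancel g f].
Proof.
move=> rf; have [g [fg gf]] := rlb_inv_ex rf.
have [c [C [c0 H]]] := rlb_bilip rf; have [_ pf _] := rf.
have [w [fw lw [d d0 dw] _ _]] := rlb_weight rf.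
have gle a b : a <= b -> g a <= g b by rewrite -(rlb_leE (g a) (g b) rf) !gf.
have cg : continuous g.
  apply/contP => x e e0; exists (c * e); first exact: mulr_gt0.
  move=> s sx; wlog : s x sx / x <= s.
    move=> h; have [xs|xs] := leP x s; first exact: h.
    by rewrite distrC; apply: h; [rewrite distrC|exact: ltW].
  move=> xs; rewrite ger0_norm ?subr_ge0 ?gle//.
  have /andP[h _] := H _ _ (gle _ _ xs); rewrite !gf in h.
  by rewrite -(ltr_pM2l c0) (le_lt_trans h)// (le_lt_trans (ler_norm _)).
have rfw : abscont f w by have [h _ _] := rf; exact: AC_ae h lw fw.
have wp x : 0 < w x by exact: lt_le_trans d0 (dw x).
have miw : measurable_fun setT (fun x => (w x)^-1).
  rewrite (_ : (fun x => _) = (fun x : R => (Num.max d x)^-1) \o w); last first.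
    by apply/funext => x; rewrite /= max_r.
  apply: measurableT_comp; last exact: L1loc_meas.
  apply: nonincreasing_measurable => // x y xy.
  by rewrite lef_pV2 ?posrE ?lt_max ?d0// ge_max le_max lexx/= le_max xy orbT.
have mg : measurable_fun setT (fun z => (w (g z))^-1).
  by apply: (measurableT_comp miw); exact: cont_meas.
have bd z : `|(w (g z))^-1| <= d^-1.
  have h : 0 <= (w (g z))^-1 by rewrite invr_ge0 ltW.
  by rewrite ger0_norm// lef_pV2 ?posrE.
have lg : L1loc (fun z => (w (g z))^-1).
  apply: (L1loc_le mg (L1loc_cst d^-1)) => x.
  apply: le_trans (bd x) _; exact: ler_norm.
have [_ I] := rlb_int rf lg.
exists g, (fun z => (w (g z))^-1); split=> //; split.
- split=> // a b; rewrite -{2}(gf a) -{2}(gf b) I.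
  rewrite (Int_ae _ _ (rlb_int rf lg).1 (L1loc_cst 1)) ?Int_cst ?mul1r//.
  by apply: aeS fw => x ->; rewrite fg mulVf// gt_eqF.
- by move=> x; apply: (rlb_inj rf); rewrite pf !gf.
- have [_ _ [c' [C' [c'0 H']]]] := rf.
  have wC : {ae mu, forall x, w x <= Num.max C' 1}.
    by apply: aeS2 fw H' => x <- /andP[_ h]; rewrite le_max h.
  exists (Num.max C' 1)^-1, d^-1; split.
    by rewrite invr_gt0 lt_max ltr01 orbT.
  (* transfer of the a.e. bound through g needs null sets of f-images; use the derivative of g *)
  have bil a b : a <= b -> (Num.max C' 1)^-1 * (b - a) <= g b - g a.
    move=> ab; rewrite mulrC ler_pdivrMr ?lt_max ?ltr01 ?orbT//.
    rewrite -{1}(gf b) -{1}(gf a) (ACE _ _ rfw) mulrC -Int_cst.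
    by apply: Int_le => //; [exact: L1loc_cst|exact: gle].
  have : {ae mu, forall x, 0 <= (w (g x))^-1 - (Num.max C' 1)^-1 * 1}.
    apply: (AC_nondecr_ge0 (f := fun x => g x - (Num.max C' 1)^-1 * x)).
      apply: ACB; last exact/ACZ/AC_id.
      split=> // a b; rewrite -{2}(gf a) -{2}(gf b) I.
      rewrite (Int_ae _ _ (rlb_int rf lg).1 (L1loc_cst 1)) ?Int_cst ?mul1r//.
      by apply: aeS fw => x ->; rewrite fg mulVf// gt_eqF.
    by move=> a b ab _; have := bil _ _ ab; rlra.
  apply: aeS => x; rewrite mulr1 subr_ge0 => ->/=.
  exact: le_trans (ler_norm _) (bd x).
Qed.

Lemma rlb_comp f f' k k' : rlb f f' -> rlb k k' ->
  rlb (fun x => f (k x)) (fun x => f' (k x) * k' x).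
Proof.
move=> rf rk; have [Hf pf [c [C [c0 H]]]] := rf.
have [Hk pk [d [D [d0 K]]]] := rk.
split; first exact: rlb_AC.
  by move=> x; rewrite pk pf.
exists (c * d), (C * D); split; first exact: mulr_gt0.
apply: aeS2 (rlb_ae rk H) K => x /andP[h1 h2] /andP[h3 h4]; apply/andP; split.
  by apply: ler_pM => //; exact: ltW.
by apply: ler_pM => //; [exact: le_trans (ltW c0) h1|exact: le_trans (ltW d0) h3].
Qed.

Lemma rlb_shift a : rlb (fun x => x + a) (fun=> 1).
Proof.
split.
- split=> [|c d]; first exact: L1loc_cst.
  by rewrite Int_cst; rlra.
- by move=> x; rewrite addrAC.
- by exists 1, 1; split=> //; apply: aeT => x; rewrite lexx.
Qed.

Lemma inverseE f g : cancel f g -> cancel g f -> inverse f = g.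
Proof.
move=> fg gf; apply/funext => x; apply: (can_inj fg); rewrite gf.
by apply: pinvK; rewrite inE/=; exists (g x).
Qed.

Lemma rlb_W1infper f f' : rlb f f' -> W1infper (fun x => f x - x).
Proof.
move=> [Hf pf [c [C [c0 H]]]]; split; last by move=> x; rewrite pf; rlra.
apply: (AC_W1infloc (ACB Hf (@AC_id R)) (K := C + 1)).
apply: aeS H => x /andP[h1 h2]; rewrite ler_norml; apply/andP; split; rlra.
Qed.

Lemma rlb_G f f' : rlb f f' -> G f.
Proof.
move=> rf; have [g [g' [rg fg gf]]] := rlb_inv rf.
have [Hf pf [c [C [c0 H]]]] := rf.
split=> //.
- by exists g.
- apply: (AC_W1infloc Hf (K := C)).
  by apply: aeS H => x /andP[h1 h2]; rewrite ger0_norm//; rlra.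
- exact: rlb_W1infper rf.
- by rewrite (inverseE fg gf); exact: rlb_W1infper rg.
Qed.

Lemma W1infloc_W11 f : W1infloc f -> W11loc f.
Proof. by move=> /W1infloc_AC[g Hg _]; apply/W11locP; exists g. Qed.

(** The lower bound on f' is the inverse of a Lipschitz constant of f^-1, enlarged to be positive.
    Continuity and injectivity make f monotone, and f 1 = f 0 + 1 excludes the decreasing case. *)
Lemma G_rlb f : G f -> rlb f (wderiv f).
Proof.
move=> [bf Wf pf Pf Pg].
have [g fg gf] := bf.
rewrite (inverseE fg gf) in Pg.
have Hf := AC_wderiv (W1infloc_W11 Wf).
have [K HK] := qper_Linf pf Wf Hf.
have [Wg0 pg0] := Pg.
have [L HL] := qper_Linf (al := 0) (fun x => etrans (pg0 x) (esym (addr0 _))) Wg0 (AC_wderiv (W1infloc_W11 Wg0)).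
have gl a b : a <= b -> `|g b - g a| <= (Num.max L 0 + 1) * (b - a).
  move=> ab; have := AC_lip (AC_wderiv (W1infloc_W11 Wg0)) HL ab.
  have e : Num.max L 0 >= L by rewrite le_max lexx.
  have : L * (b - a) <= Num.max L 0 * (b - a) by rewrite ler_wpM2r// subr_ge0.
  rewrite !ler_norml => h /andP[h1 h2]; apply/andP; split; rlra.
have L1p : 0 < Num.max L 0 + 1 by rewrite ltr_pwDr// le_max lexx orbT.
have cf := AC_cont Hf.
have fmono : forall a b, a <= b -> f a <= f b.
  have xI (z : R) : z \in `]-oo, +oo[ by rewrite in_itv.
  have fi : {in `]-oo, +oo[ &, injective f} by move=> x y _ _; exact: (can_inj fg).
  have [m|m] := itv_continuous_inj_mono (continuous_subspaceT cf) fi => a b; last first.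
    by have := m _ _ (xI _) (xI _) ltr01; rewrite -[in f 1](add0r 1) pf; rlra.
  by rewrite le_eqVlt => /predU1P[->//|/(m a b (xI _) (xI _))/ltW].
split=> //; exists (Num.max L 0 + 1)^-1, K; split; first by rewrite invr_gt0.
have : {ae mu, forall x, 0 <= wderiv f x - (Num.max L 0 + 1)^-1 * 1}.
  apply: (AC_nondecr_ge0 (f := fun x => f x - (Num.max L 0 + 1)^-1 * x)).
    by apply: ACB => //; exact/ACZ/AC_id.
  move=> a b ab _; have := gl _ _ (fmono _ _ ab); rewrite !fg ger0_norm ?subr_ge0// => h.
  have : (Num.max L 0 + 1)^-1 * (b - a) <= f b - f a by rewrite mulrC ler_pdivrMr// mulrC.
  rlra.
apply: aeS2 HK => x h1 h2; apply/andP; split; first rlra.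
exact: le_trans (ler_norm _) h1.
Qed.

End rlb.

(** * The nonlocal terms P and Q *)

Section kernels.
Context {R : realType}.
Implicit Types (f g k y : R -> R) (a b c x : R).
Local Notation mu := (@lebesgue_measure R).

Definition aeper g := aeeq (fun x => g (x + 1)) g.

Lemma Int_shift g c a b : L1loc g -> Int (fun x => g (x + c)) a b = Int g (a + c) (b + c).
Proof.
move=> lg; have [_ ->] := rlb_int (rlb_shift c) lg.
by congr Int; apply/funext => x; rewrite mulr1.
Qed.

Lemma L1loc_shift g c : L1loc g -> L1loc (fun x => g (x + c)).
Proof.
move=> lg; have [+ _] := rlb_int (rlb_shift c) lg.
by under eq_fun do rewrite mulr1.
Qed.

Lemma aeper_Int1 g a b : L1loc g -> aeper g -> Int g (a + 1) (b + 1) = Int g a b.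
Proof. by move=> lg pg; rewrite -Int_shift//; apply: Int_ae => //; exact: L1loc_shift. Qed.

Lemma aeper_Int g x : L1loc g -> aeper g -> Int g x (x + 1) = Int g 0 1.
Proof.
move=> lg pg; have h := aeper_Int1 0 x lg pg; rewrite add0r in h.
by apply: (addrI (Int g 0 x)); rewrite Int_chasles -(Int_chasles g 0 1) h addrC.
Qed.

Lemma aeper_abs g : aeper g -> aeper (fun x => `|g x|).
Proof. by apply: aeS => x ->. Qed.

Lemma aeperD f g : aeper f -> aeper g -> aeper (fun x => f x + g x).
Proof. by apply: aeS2 => x -> ->. Qed.

Lemma aeperM f g : aeper f -> aeper g -> aeper (fun x => f x * g x).
Proof. by apply: aeS2 => x -> ->. Qed.

Lemma aeperB f g : aeper f -> aeper g -> aeper (fun x => f x - g x).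
Proof. by apply: aeS2 => x -> ->. Qed.

Lemma aeper_cst c : aeper (fun=> c). Proof. exact: aeT. Qed.

Lemma AC_aeper al f f' : abscont f f' -> qper al f -> aeper f'.
Proof.
move=> Hf pf.
have H1 : abscont (fun x => f (x + 1)) (fun x => f' (x + 1)).
  have := rlb_AC (rlb_shift 1) Hf.
  by under [X in abscont _ X]eq_fun do rewrite mulr1.
apply: AC_uniq H1 _; have := ACD Hf (@AC_cst R al).
under [X in abscont X]eq_fun do rewrite -pf.
by under [X in abscont _ X]eq_fun do rewrite addr0.
Qed.

Lemma Int_abs_sub g x e : L1loc g -> aeper g -> x <= e -> e <= x + 1 ->
  Int (fun z => `|g z|) x e <= Int (fun z => `|g z|) 0 1.
Proof.
move=> lg pg xe ex1.
rewrite -(aeper_Int x (L1loc_abs lg) (aeper_abs pg)).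
exact: (Int_sub (L1loc_abs lg)).
Qed.

Lemma AC_osc al y q x e : abscont y q -> qper al y -> x <= e -> e <= x + 1 ->
  `|y x - y e| <= Int (fun z => `|q z|) 0 1.
Proof.
move=> Hy py xe ex; rewrite distrC; apply: le_trans (AC_cvg Hy xe) _.
by apply: Int_abs_sub => //; [exact: AC_L1 Hy|exact: AC_aeper Hy py].
Qed.

(** The sum of the geometric series of ratio 1/e: since y gains 1 over a period, the kernel loses
    the factor 1/e. *)
Definition kap : R := (1 - expR (-1))^-1.

Lemma expRN1_lt1 : expR (-1) < 1 :> R.
Proof. by rewrite expR_lt1 ltrN10. Qed.

Lemma kap_gt0 : 0 < kap.
Proof. by rewrite invr_gt0 subr_gt0 expRN1_lt1. Qed.

Lemma kapK : kap * (1 - expR (-1)) = 1.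
Proof. by rewrite mulVf// gt_eqF// subr_gt0 expRN1_lt1. Qed.

(* Ak and Bk are, up to the factor kap, the integrals of
   e^{-|y(x) - y(eta)|} g(eta) over eta > x and eta < x, folded onto one period. *)
Definition Ak y g x := expR (y x) * Int (fun e => expR (- y e) * g e) x (x + 1).
Definition Bk y g x := expR (- y x) * Int (fun e => expR (y e - 1) * g e) x (x + 1).
Definition Pk y g x := kap / 4 * (Ak y g x + Bk y g x).
Definition Qk y g x := kap / 4 * (Ak y g x - Bk y g x).

Lemma AC_Int1 F : L1loc F -> abscont (fun x => Int F x (x + 1)) (fun x => F (x + 1) - F x).
Proof.
move=> lF; apply: ACB; last exact: AC_prim.
have := rlb_AC (rlb_shift 1) (AC_prim lF).
by under [X in abscont _ X]eq_fun do rewrite mulr1.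
Qed.

Lemma contexp y : continuous y -> continuous (fun x => expR (y x)).
Proof. by move=> cy x; apply: (@continuous_comp _ _ _ y expR); [exact: cy|exact: continuous_expR]. Qed.

Lemma contN y : continuous y -> continuous (fun x => - y x).
Proof. by move=> cy x; apply: cvgN; exact: cy. Qed.

Lemma contB1 y c : continuous y -> continuous (fun x => y x - c).
Proof. by move=> cy x; apply: cvgB; [exact: cy|exact: cvg_cst]. Qed.

Section ker.
Variables (y q g : R -> R).
Hypotheses (Hy : abscont y q) (py : qper 1 y) (lg : L1loc g) (pg : aeper g).

Let cy : continuous y := AC_cont Hy.
Let lq : L1loc q := AC_L1 Hy.

Let lA : L1loc (fun e => expR (- y e) * g e).
Proof. by apply: L1locM_cont => //; exact/contexp/contN. Qed.

Let lB : L1loc (fun e => expR (y e - 1) * g e).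
Proof. by apply: L1locM_cont => //; exact/contexp/contB1. Qed.

Lemma Ak_AC : abscont (Ak y g) (fun x => q x * Ak y g x - (1 - expR (-1)) * g x).
Proof.
apply: AC_ae (ACM (AC_expR Hy) (AC_Int1 lA)) _ _.
  apply: L1locB; last exact: L1locZ.
  under eq_fun do rewrite mulrC.
  apply: L1locM_cont => //.
  move=> x; apply: cvgM; first exact: contexp.
  exact: (AC_cont (AC_Int1 lA)).
apply: aeS pg => x gx; rewrite gx py /Ak.
have E : expR (- (y x + 1)) = expR (- y x) * expR (-1) by rewrite -expRD; congr expR; lra.
have E1 : expR (y x) * expR (- y x) = 1 by rewrite -expRD subrr expR0.
rewrite E.
have -> : expR (y x) * (expR (- y x) * expR (-1) * g x - expR (- y x) * g x) =
  (expR (y x) * expR (- y x)) * (expR (-1) * g x - g x) by lra.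
rewrite E1; lra.
Qed.

Lemma Bk_AC : abscont (Bk y g) (fun x => - q x * Bk y g x + (1 - expR (-1)) * g x).
Proof.
apply: AC_ae (ACM (AC_expR (ACN Hy)) (AC_Int1 lB)) _ _.
  apply: L1locD; last exact: L1locZ.
  under eq_fun do rewrite mulrC.
  apply: L1locM_cont; last exact: L1locN.
  move=> x; apply: cvgM; first exact: (contexp (contN cy)).
  exact: (AC_cont (AC_Int1 lB)).
apply: aeS pg => x gx; rewrite gx py /Bk.
have -> : expR (y x + 1 - 1) = expR (y x) by congr expR; lra.
have -> : expR (y x - 1) = expR (y x) * expR (-1) by rewrite -expRD.
have E1 : expR (- y x) * expR (y x) = 1 by rewrite -expRD addNr expR0.
have -> : expR (- y x) * (expR (y x) * g x - expR (y x) * expR (-1) * g x) =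
  (expR (- y x) * expR (y x)) * (g x - expR (-1) * g x) by lra.
rewrite E1; lra.
Qed.

Lemma Pk_AC : abscont (Pk y g) (fun x => q x * Qk y g x).
Proof.
have H := ACZ (kap / 4) (ACD Ak_AC Bk_AC).
rewrite (_ : (fun x => q x * Qk y g x) = (fun x => kap / 4 *
  (q x * Ak y g x - (1 - expR (-1)) * g x + (- q x * Bk y g x + (1 - expR (-1)) * g x)))) //.
by apply/funext => x; rewrite /Qk; lra.
Qed.

(** Differentiating A and B yields q A - (1 - 1/e) g and - q B + (1 - 1/e) g. The local terms cancel
    in the sum, that is in P; in the difference they double, and kap / 4 normalizes them to g /
    2. *)
Lemma Qk_AC : abscont (Qk y g) (fun x => q x * Pk y g x - g x / 2).
Proof.
have H := ACZ (kap / 4) (ACB Ak_AC Bk_AC).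
rewrite (_ : (fun x => q x * Pk y g x - g x / 2) = (fun x => kap / 4 *
  (q x * Ak y g x - (1 - expR (-1)) * g x - (- q x * Bk y g x + (1 - expR (-1)) * g x)))) //.
apply/funext => x; rewrite /Pk.
have : kap * (1 - expR (-1)) * g x = g x by rewrite kapK mul1r.
lra.
Qed.

Lemma Ak_per x : Ak y g (x + 1) = Ak y g x.
Proof.
rewrite /Ak py expRD -mulrA -Int_shift//; congr (_ * _).
rewrite -IntZ; last exact: (L1loc_shift 1 lA).
apply: Int_ae => //; first by apply: L1locZ; exact: (L1loc_shift 1 lA).
apply: aeS pg => z gz; rewrite gz py.
have -> : expR (- (y z + 1)) = expR (- y z) * expR (-1) by rewrite -expRD; congr expR; lra.
have : expR 1 * expR (-1) = 1 :> R by rewrite -expRD subrr expR0.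
move=> E; have : expR 1 * expR (-1) * (expR (- y z) * g z) = expR (- y z) * g z.
  by rewrite E mul1r.
lra.
Qed.

Lemma Bk_per x : Bk y g (x + 1) = Bk y g x.
Proof.
rewrite /Bk py opprD expRD -mulrA -Int_shift//; congr (_ * _).
rewrite -IntZ; last exact: (L1loc_shift 1 lB).
apply: Int_ae => //; first by apply: L1locZ; exact: (L1loc_shift 1 lB).
apply: aeS pg => z gz; rewrite gz py mulrA -expRD; congr (expR _ * _); lra.
Qed.

Lemma Pk_per : qper 0 (Pk y g).
Proof. by move=> x; rewrite /Pk Ak_per Bk_per addr0. Qed.

Lemma Qk_per : qper 0 (Qk y g).
Proof. by move=> x; rewrite /Qk Ak_per Bk_per addr0. Qed.

Lemma AkE x : Ak y g x = Int (fun e => expR (y x - y e) * g e) x (x + 1).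
Proof. by rewrite /Ak -IntZ//; congr Int; apply/funext => e; rewrite expRD mulrA. Qed.

Lemma BkE x : Bk y g x = Int (fun e => expR (y e - 1 - y x) * g e) x (x + 1).
Proof. by rewrite /Bk -IntZ//; congr Int; apply/funext => e; rewrite mulrA -expRD addrC. Qed.

End ker.

Lemma expR_lip (M u v : R) : u <= M -> v <= M -> `|expR u - expR v| <= expR M * `|u - v|.
Proof.
wlog uv : u v / v <= u.
  by move=> H uM vM; have [h|/ltW h] := leP v u; [exact: H|rewrite distrC [`|u - v|]distrC; exact: H].
move=> uM _; rewrite !ger0_norm ?subr_ge0 ?ler_expR//.
have : expR u * (1 + (v - u)) <= expR u * expR (v - u).
  by rewrite ler_wpM2l ?expR_ge0// expR_ge1Dx.
rewrite -expRD (_ : u + (v - u) = v); last lra.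
move=> h.
have : expR u * (u - v) <= expR M * (u - v) by rewrite ler_wpM2r ?subr_ge0 ?ler_expR.
lra.
Qed.

Lemma norm_comb4 (k K a a' b b' : R) : 0 <= k ->
  `|a - a'| <= K -> `|b - b'| <= K ->
  `|k / 4 * (a + b) - k / 4 * (a' + b')| <= k * K /\
  `|k / 4 * (a - b) - k / 4 * (a' - b')| <= k * K.
Proof.
move=> k0 h1 h2.
have kK : 0 <= k * K by rewrite mulr_ge0// (le_trans (normr_ge0 _) h1).
have H u v : `|u| <= K -> `|v| <= K -> `|k / 4 * (u + v)| <= k * K.
  move=> hu hv; rewrite normrM ger0_norm; last by rewrite divr_ge0.
  apply: (@le_trans _ _ (k / 4 * (2 * K))); last lra.
  rewrite ler_wpM2l//; first by rewrite divr_ge0.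
  by apply: le_trans (ler_normD _ _) _; lra.
rewrite -!mulrBr; split.
  by rewrite (_ : _ - _ = (a - a') + (b - b')); [exact: H|lra].
rewrite (_ : _ - _ - _ = (a - a') + - (b - b')); last lra.
by apply: H => //; rewrite normrN.
Qed.

Section kerlip.
Variables (y q g y' q' g' : R -> R) (Y Gb d dg : R).
Hypotheses (Hy : abscont y q) (py : qper 1 y) (lg : L1loc g) (pg : aeper g).
Hypotheses (Hy' : abscont y' q') (py' : qper 1 y') (lg' : L1loc g') (pg' : aeper g').
Hypotheses (qY : Int (fun z => `|q z|) 0 1 <= Y) (qY' : Int (fun z => `|q' z|) 0 1 <= Y).
Hypotheses (gG' : Int (fun z => `|g' z|) 0 1 <= Gb).
Hypotheses (yd : forall x, `|y x - y' x| <= d) (gd : Int (fun z => `|g z - g' z|) 0 1 <= dg).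

Lemma ker_lip_aux (k k' : R -> R) x : continuous k -> continuous k' ->
  (forall e, x <= e <= x + 1 -> k e <= Y) -> (forall e, x <= e <= x + 1 -> k' e <= Y) ->
  (forall e, `|k e - k' e| <= 2 * d) ->
  `|Int (fun e => expR (k e) * g e) x (x + 1) - Int (fun e => expR (k' e) * g' e) x (x + 1)|
  <= expR Y * (dg + 2 * d * Gb).
Proof.
move=> ck ck' kY kY' kk.
have x1 : x <= x + 1 by lra.
have l1 : L1loc (fun e => expR (k e) * g e) by apply: L1locM_cont => //; exact: contexp.
have l2 : L1loc (fun e => expR (k' e) * g' e) by apply: L1locM_cont => //; exact: contexp.
have lgd := L1loc_abs (L1locB lg lg').
have lga' := L1loc_abs lg'.
have d0 : 0 <= d by exact: le_trans (normr_ge0 _) (yd 0).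
rewrite -IntB//.
apply: (@le_trans _ _ (Int (fun e => expR Y * `|g e - g' e| + expR Y * (2 * d) * `|g' e|) x (x + 1))).
  apply: Int_bd_in => //; first exact: L1locB.
    by apply: L1locD; exact: L1locZ.
  move=> e he.
  have -> : expR (k e) * g e - expR (k' e) * g' e =
    expR (k e) * (g e - g' e) + (expR (k e) - expR (k' e)) * g' e by lra.
  apply: le_trans (ler_normD _ _) _; rewrite !normrM; apply: lerD.
    by rewrite ler_wpM2r// ger0_norm ?expR_ge0// ler_expR kY.
  rewrite ler_wpM2r//; apply: le_trans (expR_lip (kY _ he) (kY' _ he)) _.
  by rewrite ler_wpM2l ?expR_ge0.
rewrite IntD; [|exact: L1locZ|exact: L1locZ].
rewrite !IntZ// (aeper_Int x lgd) ?(aeper_Int x lga'); [|exact: aeper_abs|exact/aeper_abs/aeperB].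
have h1 : expR Y * Int (fun z => `|g z - g' z|) 0 1 <= expR Y * dg.
  by rewrite ler_wpM2l ?expR_ge0.
have h2 : expR Y * (2 * d) * Int (fun z => `|g' z|) 0 1 <= expR Y * (2 * d) * Gb.
  by rewrite ler_wpM2l// mulr_ge0 ?expR_ge0// mulr_ge0.
lra.
Qed.

(** On one period y varies by at most the L^1 norm of its derivative, so both exponents are at most
    Y and they differ by at most 2 d. The densities enter through L^1 norms alone. *)
Lemma ker_lip x :
  `|Ak y g x - Ak y' g' x| <= expR Y * (dg + 2 * d * Gb) /\
  `|Bk y g x - Bk y' g' x| <= expR Y * (dg + 2 * d * Gb).
Proof.
have cy := AC_cont Hy; have cy' := AC_cont Hy'.
have dd e : `|y x - y e - (y' x - y' e)| <= 2 * d.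
  have := yd x; have := yd e; rewrite !ler_norml => /andP[? ?] /andP[? ?].
  by apply/andP; split; lra.
split.
  rewrite (AkE Hy)// (AkE Hy')//; apply: ker_lip_aux.
  - by move=> e; apply: cvgB; [exact: cvg_cst|exact: cy].
  - by move=> e; apply: cvgB; [exact: cvg_cst|exact: cy'].
  - move=> e /andP[xe ex]; apply: le_trans (ler_norm _) _.
    by apply: le_trans (AC_osc Hy py xe ex) _.
  - move=> e /andP[xe ex]; apply: le_trans (ler_norm _) _.
    by apply: le_trans (AC_osc Hy' py' xe ex) _.
  - exact: dd.
rewrite (BkE Hy)// (BkE Hy')//; apply: ker_lip_aux.
- by move=> e; apply: cvgB; [apply: contB1|exact: cvg_cst].
- by move=> e; apply: cvgB; [apply: contB1|exact: cvg_cst].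
- move=> e /andP[xe ex]; have := le_trans (AC_osc Hy py xe ex) qY.
  by rewrite ler_norml => /andP[]; lra.
- move=> e /andP[xe ex]; have := le_trans (AC_osc Hy' py' xe ex) qY'.
  by rewrite ler_norml => /andP[]; lra.
- by move=> e; have := dd e; rewrite !ler_norml => /andP[? ?]; apply/andP; split; lra.
Qed.

Lemma PQk_lip x :
  `|Pk y g x - Pk y' g' x| <= kap * expR Y * (dg + 2 * d * Gb) /\
  `|Qk y g x - Qk y' g' x| <= kap * expR Y * (dg + 2 * d * Gb).
Proof.
have [] := ker_lip x; set K := expR Y * _ => h1 h2.
by rewrite -mulrA -/K; exact: norm_comb4 (ltW kap_gt0) h1 h2.
Qed.

End kerlip.

(** The Lipschitz estimate against the same y with density 0, for which both kernels vanish. *)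
Lemma PQk_bd y q g Y Gb x : abscont y q -> qper 1 y -> L1loc g -> aeper g ->
  Int (fun z => `|q z|) 0 1 <= Y -> Int (fun z => `|g z|) 0 1 <= Gb ->
  `|Pk y g x| <= kap * expR Y * Gb /\ `|Qk y g x| <= kap * expR Y * Gb.
Proof.
move=> Hy py lg pg qY gG.
have A0 : Ak y (fun=> 0) x = 0.
  by rewrite /Ak (_ : (fun e => _) = fun=> 0) ?Int_cst ?mul0r ?mulr0//; apply/funext => e; rewrite mulr0.
have B0 : Bk y (fun=> 0) x = 0.
  by rewrite /Bk (_ : (fun e => _) = fun=> 0) ?Int_cst ?mul0r ?mulr0//; apply/funext => e; rewrite mulr0.
have g00 : Int (fun z => `|(fun=> 0 : R) z|) 0 1 <= 0 :> R.
  by rewrite (_ : (fun z => _) = fun=> 0) ?Int_cst ?mul0r//; apply/funext => e; rewrite normr0.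
have gG0 : Int (fun z => `|g z - 0|) 0 1 <= Gb by under [X in Int X]eq_fun do rewrite subr0.
have yd z : `|y z - y z| <= 0 by rewrite subrr normr0.
have [] := PQk_lip Hy py lg pg Hy py (L1loc_cst 0) (aeper_cst 0) qY qY g00 yd gG0 x.
by rewrite /Pk /Qk A0 B0 !(addr0, subr0, mulr0).
Qed.

End kernels.

(** * Integrals over half-lines by geometric series *)

Section exhaust.
Context {R : realType}.
Implicit Types (f g k y F : R -> R) (a b c x : R).
Local Notation mu := (@lebesgue_measure R).

Lemma exhaust_ge0 F (a b : nat -> R) (S : set R) (L : R) : L1loc F -> (forall x, 0 <= F x) ->
  {homo a : m n / (m <= n)%N >-> n <= m} -> {homo b : m n / (m <= n)%N >-> m <= n} ->
  (forall n, a n <= b n) -> S = \bigcup_n [set` `[a n, b n]] ->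
  (fun n => Int F (a n) (b n)) @ \oo --> L ->
  (\int[mu]_(x in S) (F x)%:E = L%:E)%E.
Proof.
move=> lF F0 ha hb ab -> cvL.
have nd : nondecreasing_seq (fun n => [set` `[a n, b n]] : set R).
  move=> m n mn; rewrite subsetEset; apply: subset_itv; rewrite bnd_simp.
    exact: ha.
  exact: hb.
have mF n : measurable_fun ([set` `[a n, b n]] : set R) (EFin \o F).
  by apply/measurable_EFinP; apply: measurable_funTS; exact: L1loc_meas.
have F0' (n : nat) x : [set` `[a n, b n]] x -> (0 <= (EFin \o F) x)%E.
  by move=> _; rewrite lee_fin; exact: F0.
have H := @ge0_nondecreasing_set_cvg_integral _ _ _ _ _ mu nd (fun=> measurable_itv _) mF F0'.
have E : (fun n => (\int[mu]_(x in [set` `[a n, b n]]) (F x)%:E)%E) = (fun n => (Int F (a n) (b n))%:E).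
  apply/funext => n; rewrite Int_itv// /Rintegral fineK//.
  by apply: integrable_fin_num => //; exact: L1loc_int.
have H2 : (fun n => (Int F (a n) (b n))%:E) @ \oo --> L%:E by apply: cvg_EFin; [exact: nearW|exact: cvL].
move: H; rewrite /= E => H.
exact: cvg_unique H H2.
Qed.

(** The limit for |F| gives integrability. The value of the integral follows from the nonnegative
    case applied to F + |F| and to |F|. *)
Lemma exhaust F (a b : nat -> R) (S : set R) (L L' : R) : L1loc F -> measurable S ->
  {homo a : m n / (m <= n)%N >-> n <= m} -> {homo b : m n / (m <= n)%N >-> m <= n} ->
  (forall n, a n <= b n) -> S = \bigcup_n [set` `[a n, b n]] ->
  (fun n => Int F (a n) (b n)) @ \oo --> L ->
  (fun n => Int (fun x => `|F x|) (a n) (b n)) @ \oo --> L' ->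
  mu.-integrable S (EFin \o F) /\ \int[mu]_(x in S) F x = L.
Proof.
move=> lF mS ha hb ab ES cvL cvL'.
have lA := L1loc_abs lF.
have IA := exhaust_ge0 lA (fun x => normr_ge0 _) ha hb ab ES cvL'.
have mF : measurable_fun S (EFin \o F).
  by apply/measurable_EFinP; apply: measurable_funTS; exact: L1loc_meas.
have iF : mu.-integrable S (EFin \o F).
  by apply/integrableP; split=> //; rewrite [ltLHS]IA ltry.
split=> //.
have iA : mu.-integrable S (EFin \o (fun x => `|F x|)) by exact: integrable_norm.
pose F1 x := F x + `|F x|.
have l1 : L1loc F1 by exact: L1locD.
have F10 x : 0 <= F1 x.
  by rewrite /F1; have := ler_norm (- F x); rewrite normrN; lra.
have cv1 : (fun n => Int F1 (a n) (b n)) @ \oo --> L + L'.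
  rewrite (_ : (fun n => _) = (fun n => Int F (a n) (b n) + Int (fun x => `|F x|) (a n) (b n))).
    exact: cvgD.
  by apply/funext => n; rewrite IntD.
have I1 := exhaust_ge0 l1 F10 ha hb ab ES cv1.
have D : \int[mu]_(x in S) F1 x =
  \int[mu]_(x in S) F x + \int[mu]_(x in S) `|F x| by apply: RintegralD.
have E1 : \int[mu]_(x in S) F1 x = L + L' by rewrite /Rintegral I1.
have E2 : \int[mu]_(x in S) `|F x| = L' by rewrite /Rintegral IA.
by move: D; rewrite E1 E2 => /addIr <-.
Qed.

Lemma cvg_geom (r c : R) : 0 < r -> r < 1 ->
  (fun n => (1 - r ^+ n) / (1 - r) * c) @ \oo --> c / (1 - r).
Proof.
move=> r0 r1.
have h : (fun n => r ^+ n) @ \oo --> 0 by apply: cvg_expr; rewrite gtr0_norm.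
rewrite (_ : c / (1 - r) = (1 - 0) / (1 - r) * c); last by rewrite subr0 mul1r mulrC.
apply: cvgM; last exact: cvg_cst.
apply: cvgM; last exact: cvg_cst.
by apply: cvgB => //; exact: cvg_cst.
Qed.

Lemma geom_step (r : R) n : r < 1 -> (1 - r ^+ n.+1) / (1 - r) = (1 - r ^+ n) / (1 - r) + r ^+ n.
Proof.
move=> r1; have h : 1 - r != 0 by rewrite gt_eqF// subr_gt0.
rewrite (_ : 1 - r ^+ n.+1 = (1 - r ^+ n) + r ^+ n * (1 - r)); last by rewrite exprS; lra.
by rewrite [LHS]mulrDl mulfK.
Qed.

Lemma Int_geom_r F r x n : L1loc F -> r < 1 -> aeeq (fun e => F (e + 1)) (fun e => r * F e) ->
  Int F x (x + n%:R) = (1 - r ^+ n) / (1 - r) * Int F x (x + 1).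
Proof.
move=> lF r1 HF.
have S a b : Int F (a + 1) (b + 1) = r * Int F a b.
  rewrite -Int_shift// -IntZ//; apply: Int_ae => //; [exact: L1loc_shift|exact: L1locZ].
have St m : Int F (x + m%:R) (x + m%:R + 1) = r ^+ m * Int F x (x + 1).
  elim: m => [|m IH]; first by rewrite addr0 expr0 mul1r.
  by rewrite -natr1 addrA S IH exprS mulrA.
elim: n => [|n IHn]; first by rewrite addr0 Intxx expr0 subrr !mul0r.
by rewrite -natr1 addrA -(Int_chasles _ _ (x + n%:R)) IHn St geom_step// [RHS]mulrDl.
Qed.

(** The period just left of x weighs r times the period just right of it, in which the result is
    expressed; hence the extra factor r compared with [Int_geom_r]. *)
Lemma Int_geom_l F r x n : L1loc F -> r < 1 -> aeeq (fun e => r * F (e + 1)) F ->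
  Int F (x - n%:R) x = (1 - r ^+ n) / (1 - r) * (r * Int F x (x + 1)).
Proof.
move=> lF r1 HF.
have S a b : r * Int F (a + 1) (b + 1) = Int F a b.
  rewrite -Int_shift// -IntZ; last exact: L1loc_shift.
  by apply: Int_ae => //; apply: L1locZ; exact: L1loc_shift.
have St m : Int F (x - m%:R - 1) (x - m%:R) = r ^+ m * (r * Int F x (x + 1)).
  elim: m => [|m IH].
    by rewrite subr0 -S subrK expr0 mul1r; congr (_ * Int _ _ _); lra.
  rewrite exprS -mulrA -IH -S.
  have -> : x - m.+1%:R = x - m%:R - 1 by rewrite -natr1; lra.
  by rewrite !subrK.
elim: n => [|n IHn]; first by rewrite subr0 Intxx expr0 subrr !mul0r.
rewrite -(Int_chasles _ _ (x - n%:R)) IHn geom_step// [RHS]mulrDl addrC -St.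
by have -> : x - n.+1%:R = x - n%:R - 1 by rewrite -natr1; lra.
Qed.

Lemma ray_r F r x : L1loc F -> 0 < r -> r < 1 ->
  aeeq (fun e => F (e + 1)) (fun e => r * F e) ->
  mu.-integrable `[x, +oo[ (EFin \o F) /\
  \int[mu]_(e in `[x, +oo[) F e = Int F x (x + 1) / (1 - r).
Proof.
move=> lF r0 r1 HF.
have HFa : aeeq (fun e => `|F (e + 1)|) (fun e => r * `|F e|).
  by apply: aeS HF => e ->; rewrite normrM gtr0_norm.
apply: (@exhaust F (fun=> x) (fun n => x + n%:R) _ _ (Int (fun e => `|F e|) x (x + 1) / (1 - r))) => //.
- by move=> m n mn /=; rewrite lerD2l ler_nat.
- by move=> n; rewrite lerDl.
- apply/seteqP; split=> e /=; rewrite in_itv/= ?andbT.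
    move=> xe; exists (Num.bound (e - x)) => //=; rewrite in_itv/= xe/=.
    have ex : 0 <= e - x by lra.
    have := archi_boundP ex; lra.
  by move=> [n _ /=]; rewrite in_itv/= => /andP[].
- by under eq_fun do rewrite (Int_geom_r _ _ lF r1 HF); exact: cvg_geom.
- by under eq_fun do rewrite (Int_geom_r _ _ (L1loc_abs lF) r1 HFa); exact: cvg_geom.
Qed.

Lemma ray_l F r x : L1loc F -> 0 < r -> r < 1 ->
  aeeq (fun e => r * F (e + 1)) F ->
  mu.-integrable `]-oo, x] (EFin \o F) /\
  \int[mu]_(e in `]-oo, x]) F e = r * Int F x (x + 1) / (1 - r).
Proof.
move=> lF r0 r1 HF.
have HFa : aeeq (fun e => r * `|F (e + 1)|) (fun e => `|F e|).
  by apply: aeS HF => e <-; rewrite normrM [`|r|]gtr0_norm.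
apply: (@exhaust F (fun n => x - n%:R) (fun=> x) _ _ (r * Int (fun e => `|F e|) x (x + 1) / (1 - r))) => //.
- by move=> m n mn /=; rewrite lerD2l lerN2 ler_nat.
- by move=> n; rewrite gerDl oppr_le0.
- apply/seteqP; split=> e /=; rewrite in_itv/=.
    move=> xe; exists (Num.bound (x - e)) => //=; rewrite in_itv/= xe/= andbT.
    have ex : 0 <= x - e by lra.
    have := archi_boundP ex; lra.
  by move=> [n _ /=]; rewrite in_itv/= => /andP[].
- by under eq_fun do rewrite (Int_geom_l _ _ lF r1 HF); exact: cvg_geom.
- by under eq_fun do rewrite (Int_geom_l _ _ (L1loc_abs lF) r1 HFa); exact: cvg_geom.
Qed.

(** The value of Phi at x is free, because at eta = xi the sign in the kernel is 0; this point is
    carried as a separate integral over a null set. *)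
Lemma Rint_split (Phi fl fr : R -> R) x :
  mu.-integrable `]-oo, x] (EFin \o fl) -> mu.-integrable `[x, +oo[ (EFin \o fr) ->
  (forall e, e < x -> Phi e = fl e) -> (forall e, x < e -> Phi e = fr e) ->
  \int[mu]_e Phi e = \int[mu]_(e in `]-oo, x]) fl e + \int[mu]_(e in `[x, +oo[) fr e.
Proof.
move=> il ir Hl Hr.
have il' : mu.-integrable `]-oo, x[ (EFin \o fl).
  by apply: integrableS il => //; apply: subset_itvl; rewrite bnd_simp.
have ir' : mu.-integrable `]x, +oo[ (EFin \o fr).
  by apply: integrableS ir => //; apply: subset_itvr; rewrite bnd_simp.
rewrite -Rintegral_itv_bndo_bndc// -Rintegral_itv_obnd_cbnd//.
rewrite [X in _ = X + _]Rintegral_mkcond [X in _ = _ + X]Rintegral_mkcond.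
have P (f : R -> R) (A : set R) : measurable A -> mu.-integrable A (EFin \o f) ->
    mu.-integrable setT (EFin \o (f \_ A)).
    by move=> mA H; rewrite -restrict_EFin; apply/integrable_restrict => //=; rewrite setTI.
have i1 := P _ _ (measurable_itv _) il'.
have i2 := P _ _ (measurable_itv _) ir'.
have i0 : mu.-integrable [set x] (EFin \o (fun=> Phi x)).
  apply: null_set_integrable; [exact: measurable_set1|exact: measurable_cst|].
  exact: lebesgue_measure_set1.
have i3 := P _ _ (measurable_set1 x) i0.
have E3 : \int[mu]_e ((fun=> Phi x) \_ [set x]) e = 0.
  by rewrite -Rintegral_mkcond Rintegral_set1.
have D1 : \int[mu]_e ((fl \_ `]-oo, x[) e + (fr \_ `]x, +oo[) e) =
   \int[mu]_e (fl \_ `]-oo, x[) e + \int[mu]_e (fr \_ `]x, +oo[) e by apply: RintegralD.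
have i12 : mu.-integrable setT (EFin \o (fun e => (fl \_ `]-oo, x[) e + (fr \_ `]x, +oo[) e)).
  exact: (integrableD measurableT i1 i2).
have D2 : \int[mu]_e ((fl \_ `]-oo, x[) e + (fr \_ `]x, +oo[) e + ((fun=> Phi x) \_ [set x]) e) =
   \int[mu]_e ((fl \_ `]-oo, x[) e + (fr \_ `]x, +oo[) e) + \int[mu]_e ((fun=> Phi x) \_ [set x]) e.
  by apply: RintegralD.
apply: (etrans _ D1); rewrite -[RHS]addr0 -E3 -D2.
congr (Rintegral _ _ _); apply/funext => e.
rewrite !patchE.
have -> : (e \in [set` `]-oo, x[]) = (e < x) by apply/idP/idP; rewrite inE/= in_itv/=.
have -> : (e \in [set` `]x, +oo[]) = (x < e).
  by apply/idP/idP; rewrite inE/= in_itv/= andbT.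
have -> : (e \in [set x]) = (e == x) by apply/idP/eqP; rewrite inE.
case: ltgtP => [ex|xe|->]; rewrite ?addr0 ?add0r//.
- by rewrite Hl.
- by rewrite Hr.
Qed.

End exhaust.

(** * Identification of the integrals over the line with the folded kernels *)

Section PQ.
Context {R : realType}.
Local Notation mu := (@lebesgue_measure R).
Variables (y q g : R -> R) (x : R).
Hypotheses (Hy : abscont y q) (py : qper 1 y) (lg : L1loc g) (pg : aeper g).

Let cy : continuous y := AC_cont Hy.
Let r : R := expR (-1).
Let r0 : 0 < r := expR_gt0 _.
Let r1 : r < 1 := expRN1_lt1.

Let Fr e := expR (y x - y e) * g e.
Let Fl e := expR (y e - y x) * g e.

Let lr : L1loc Fr.
Proof. by apply: L1locM_cont => //; apply: contexp => e; apply: cvgB; [exact: cvg_cst|exact: cy]. Qed.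

Let ll : L1loc Fl.
Proof. by apply: L1locM_cont => //; apply: contexp; exact: contB1. Qed.

Let intr := @ray_r R Fr r x lr r0 r1.
Let intl := @ray_l R Fl r x ll r0 r1.

Let Hr : aeeq (fun e => Fr (e + 1)) (fun e => r * Fr e).
Proof.
apply: aeS pg => e ge; rewrite /Fr ge py mulrA -expRD; congr (expR _ * _); lra.
Qed.

Let Hl : aeeq (fun e => r * Fl (e + 1)) Fl.
Proof.
apply: aeS pg => e ge; rewrite /Fl ge py mulrA -expRD; congr (expR _ * _); lra.
Qed.

Let Er : \int[mu]_(e in `[x, +oo[) Fr e = kap * Ak y g x.
Proof. by have [_ ->] := intr Hr; rewrite (AkE Hy)// mulrC. Qed.

Let El : \int[mu]_(e in `]-oo, x]) Fl e = kap * Bk y g x.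
Proof.
have [_ ->] := intl Hl; rewrite (BkE Hy)// mulrC; congr (_ * _).
rewrite -IntZ//; congr Int; apply/funext => e; rewrite /Fl mulrA -expRD; congr (expR _ * _); lra.
Qed.

Lemma P_kernel : 4^-1 * \int[mu]_e (expR (- Num.sg (x - e) * (y x - y e)) * g e) = Pk y g x.
Proof.
have [i1 _] := intr Hr; have [i2 _] := intl Hl.
rewrite (Rint_split i2 i1) ?Er ?El.
- rewrite /Pk; lra.
- by move=> e ex; rewrite gtr0_sg ?subr_gt0// mulN1r opprB.
- by move=> e ex; rewrite ltr0_sg ?subr_lt0// opprK mul1r.
Qed.

Lemma Q_kernel : - 4^-1 * \int[mu]_e
  (Num.sg (x - e) * expR (- Num.sg (x - e) * (y x - y e)) * g e) = Qk y g x.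
Proof.
have [i1 e1] := intr Hr; have [i2 _] := intl Hl.
have i3 : mu.-integrable `[x, +oo[ (EFin \o (fun e => - Fr e)).
  by have := integrableN i1; rewrite /comp.
rewrite (Rint_split i2 i3).
- have -> : \int[mu]_(e in `[x, +oo[) (- Fr e) = - (kap * Ak y g x).
    rewrite -Er -mulN1r -RintegralZl//.
    by apply: eq_Rintegral => e _; rewrite mulN1r.
  rewrite El /Qk; lra.
- by move=> e ex; rewrite gtr0_sg ?subr_gt0// mul1r mulN1r opprB.
- by move=> e ex; rewrite ltr0_sg ?subr_lt0// opprK mul1r mulN1r mulNr.
Qed.

End PQ.

(** * Lagrangian states *)

(* (y, U, y_xi, U_xi, nu), the derivatives being separate components so that the
   system becomes an ordinary differential equation at each xi. *)
Record data (R : realType) := Data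
  { yd : R -> R; Ud : R -> R; qd : R -> R; wd : R -> R; nd : R -> R }.

Section data.
Context {R : realType}.
Local Notation mu := (@lebesgue_measure R).
Implicit Types (d e : data R) (B D x : R).

(** al is 1 for states and 0 for values of the field or differences of states, whose first component
    is periodic. The a.e. periodicity of [qd] and [wd] follows from uniqueness of derivatives. *)
Definition okd al d := [/\ abscont (yd d) (qd d), abscont (Ud d) (wd d), qper al (yd d),
  qper 0 (Ud d) & L1loc (nd d) /\ aeper (nd d)].

Definition nm1 (f : R -> R) : R := Int (fun x => `|f x|) 0 1.

Definition gd d x := Ud d x ^+ 2 * qd d x + nd d x.
Definition Pd d := Pk (yd d) (gd d).
Definition Qd d := Qk (yd d) (gd d).

(* The third and fourth components are the derivatives of the first two, since
   Q_xi = y_xi P - (U^2 y_xi + nu) / 2. *)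
Definition vf d := Data (Ud d) (fun x => - Qd d x) (wd d)
  (fun x => nd d x / 2 + (Ud d x ^+ 2 / 2 - Pd d x) * qd d x)
  (fun x => - 2 * Qd d x * Ud d x * qd d x + (3 * Ud d x ^+ 2 - 2 * Pd d x) * wd d x).

Definition addd d e := Data (fun x => yd d x + yd e x) (fun x => Ud d x + Ud e x)
  (fun x => qd d x + qd e x) (fun x => wd d x + wd e x) (fun x => nd d x + nd e x).

Definition scd (c : R) d := Data (fun x => c * yd d x) (fun x => c * Ud d x)
  (fun x => c * qd d x) (fun x => c * wd d x) (fun x => c * nd d x).

Definition subd d e := Data (fun x => yd d x - yd e x) (fun x => Ud d x - Ud e x)
  (fun x => qd d x - qd e x) (fun x => wd d x - wd e x) (fun x => nd d x - nd e x).

(** Exactly the quantities that relabeling preserves: L^1 norms over a period and the sup norm of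
    U. *)
Definition bdd B d := [/\ nm1 (qd d) <= B, nm1 (wd d) <= B, nm1 (nd d) <= B &
  forall x, `|Ud d x| <= B].

Definition closed_by D d e := [/\ forall x, `|yd d x - yd e x| <= D,
  forall x, `|Ud d x - Ud e x| <= D, nm1 (fun x => qd d x - qd e x) <= D,
  nm1 (fun x => wd d x - wd e x) <= D & nm1 (fun x => nd d x - nd e x) <= D].

Lemma okd_q al d : okd al d -> L1loc (qd d) /\ aeper (qd d).
Proof. by case=> Hy _ py _ _; split; [exact: AC_L1 Hy|exact: AC_aeper Hy py]. Qed.

Lemma okd_w al d : okd al d -> L1loc (wd d) /\ aeper (wd d).
Proof. by case=> _ HU _ pU _; split; [exact: AC_L1 HU|exact: AC_aeper HU pU]. Qed.

Lemma okd_g al d : okd al d -> L1loc (gd d) /\ aeper (gd d).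
Proof.
move=> ok; have [lq pq] := okd_q ok; have [_ HU _ pU [ln pn]] := ok.
have cU := AC_cont HU; split.
  apply: L1locD => //; apply: L1locM_cont => //.
  by move=> x; apply: cvgM; exact: cU.
by apply: aeperD => //; apply: aeperM => //; apply: aeT => x; rewrite pU addr0.
Qed.

Lemma okd_PQ d : okd 1 d -> [/\ abscont (Pd d) (fun x => qd d x * Qd d x),
  abscont (Qd d) (fun x => qd d x * Pd d x - gd d x / 2), qper 0 (Pd d) & qper 0 (Qd d)].
Proof.
move=> ok; have [lg pg] := okd_g ok; have [Hy _ py _ _] := ok.
by split; [exact: Pk_AC|exact: Qk_AC|exact: Pk_per Hy py lg pg|exact: Qk_per Hy py lg pg].
Qed.

Lemma contX2 (f : R -> R) : continuous f -> continuous (fun x => f x ^+ 2).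
Proof. by move=> cf x; apply: cvgM; exact: cf. Qed.

Lemma contZ (f : R -> R) c : continuous f -> continuous (fun x => c * f x).
Proof. by move=> cf x; apply: cvgM; [exact: cvg_cst|exact: cf]. Qed.

Lemma contMM (f g : R -> R) : continuous f -> continuous g -> continuous (fun x => f x * g x).
Proof. by move=> cf cg x; apply: cvgM; [exact: cf|exact: cg]. Qed.

Lemma contBB (f g : R -> R) : continuous f -> continuous g -> continuous (fun x => f x - g x).
Proof. by move=> cf cg x; apply: cvgB; [exact: cf|exact: cg]. Qed.

Lemma okd_vf d : okd 1 d -> okd 0 (vf d).
Proof.
move=> ok; have [HP HQ pP pQ] := okd_PQ ok; have [lq pq] := okd_q ok.
have [lw pw] := okd_w ok; have [Hy HU py pU [ln pn]] := ok.
have cU := AC_cont HU; have cP := AC_cont HP; have cQ := AC_cont HQ.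
split=> //=.
- rewrite (_ : (fun x => _ + _) = (fun x => - (qd d x * Pd d x - gd d x / 2))); first exact: ACN.
  by apply/funext => x; rewrite /gd; rlra.
- by move=> x; rewrite pQ !addr0.
split.
  apply: L1locD.
    apply: L1locM_cont => //; apply: contMM => //; exact: contZ.
  by apply: L1locM_cont => //; apply: contBB; [exact/contZ/contX2|exact: contZ].
apply: aeS2 pq pw => x qx wx.
by rewrite qx wx pU pP pQ !addr0.
Qed.

Lemma nm1_ge0 (f : R -> R) : L1loc f -> 0 <= nm1 f.
Proof. by move=> lf; apply: Int_ge0W => //; exact: L1loc_abs. Qed.

Lemma nm1D (f g : R -> R) : L1loc f -> L1loc g -> nm1 (fun x => f x + g x) <= nm1 f + nm1 g.
Proof.
move=> lf lg; have la := L1loc_abs lf; have lb := L1loc_abs lg.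
rewrite /nm1 -IntD//; apply: Int_leW => //; [exact/L1loc_abs/L1locD|exact: L1locD|].
by move=> x; exact: ler_normD.
Qed.

Lemma nm1Z c (f : R -> R) : L1loc f -> nm1 (fun x => c * f x) = `|c| * nm1 f.
Proof.
move=> lf; rewrite /nm1 -IntZ; last exact: L1loc_abs.
by congr Int; apply/funext => x; rewrite normrM.
Qed.

Lemma nm1_le (f g : R -> R) : L1loc f -> L1loc g -> {ae mu, forall x, `|f x| <= g x} ->
  nm1 f <= Int g 0 1.
Proof. by move=> lf lg fg; apply: Int_le => //; exact: L1loc_abs. Qed.

Lemma nm1_sup (f : R -> R) c : L1loc f -> (forall x, `|f x| <= c) -> nm1 f <= c.
Proof.
move=> lf fc; have -> : c = Int (fun=> c) 0 1 by rewrite Int_cst subr0 mulr1.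
by apply: nm1_le => //; [exact: L1loc_cst|exact: aeT].
Qed.

Lemma nm1_ae (f g : R -> R) : L1loc f -> L1loc g -> aeeq f g -> nm1 f = nm1 g.
Proof.
by move=> lf lg fg; apply: Int_ae; [exact: L1loc_abs|exact: L1loc_abs|apply: aeS fg => x ->].
Qed.

Lemma nm1_bddM (f g : R -> R) B : continuous f -> L1loc g -> (forall x, `|f x| <= B) ->
  nm1 (fun x => f x * g x) <= B * nm1 g.
Proof.
move=> cf lg fB; rewrite -IntZ; last exact: L1loc_abs.
apply: nm1_le; [exact: L1locM_cont|exact/L1locZ/L1loc_abs|].
by apply: aeT => x; rewrite normrM ler_wpM2r.
Qed.

Lemma gd_bd B d : okd 1 d -> 1 <= B -> bdd B d -> nm1 (gd d) <= 2 * B ^+ 3.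
Proof.
move=> ok B1 [bq bw bn bU]; have [lq _] := okd_q ok; have [_ HU _ _ [ln _]] := ok.
have cU := contX2 (AC_cont HU).
apply: le_trans (nm1D (L1locM_cont cU lq) ln) _.
have U2 x : `|Ud d x ^+ 2| <= B ^+ 2.
  by rewrite normrX; apply: lerXn2r => //; rewrite ?nnegrE// (le_trans ler01).
have h := nm1_bddM cU lq U2.
have B2 : 0 <= B ^+ 2 by exact: sqr_ge0.
have h2 : B ^+ 2 * nm1 (qd d) <= B ^+ 2 * B by rewrite ler_wpM2l.
have h3 : B <= B ^+ 3 by rewrite ler_eXnr.
have : B ^+ 3 = B ^+ 2 * B by rlra.
rlra.
Qed.

Lemma gd_lip B D d e : okd 1 d -> okd 1 e -> 1 <= B -> bdd B d -> bdd B e ->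
  closed_by D d e -> nm1 (fun x => gd d x - gd e x) <= 4 * B ^+ 2 * D.
Proof.
move=> okd_ oke B1 [bq bw bn bU] [bq' bw' bn' bU'] [cy cU cq cw cn].
have [lq _] := okd_q okd_; have [_ HU _ _ [ln _]] := okd_.
have [lq' _] := okd_q oke; have [_ HU' _ _ [ln' _]] := oke.
have D0 : 0 <= D := le_trans (normr_ge0 _) (cU 0).
have B0 : 0 <= B := le_trans ler01 B1.
have kU := AC_cont HU; have kU' := AC_cont HU'.
rewrite (_ : (fun x => _) = (fun x => ((Ud d x - Ud e x) * (Ud d x + Ud e x)) * qd d x
  + Ud e x ^+ 2 * (qd d x - qd e x) + (nd d x - nd e x))); last first.
  by apply/funext => x; rewrite /gd; rlra.
have c1 : continuous (fun x => (Ud d x - Ud e x) * (Ud d x + Ud e x)).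
  move=> x; apply: cvgM; [apply: cvgB|apply: cvgD]; by [exact: kU|exact: kU'].
have c2 := contX2 kU'.
have b1 x : `|(Ud d x - Ud e x) * (Ud d x + Ud e x)| <= D * (2 * B).
  rewrite normrM; apply: ler_pM => //; apply: le_trans (ler_normD _ _) _.
  by have := bU x; have := bU' x; rlra.
have b2 x : `|Ud e x ^+ 2| <= B ^+ 2.
  by rewrite normrX; apply: lerXn2r => //; rewrite ?nnegrE.
have lqq := L1locB lq lq'.
have l1 := L1locM_cont c1 lq; have l2 := L1locM_cont c2 lqq.
apply: le_trans (nm1D (L1locD l1 l2) (L1locB ln ln')) _.
have h := nm1D l1 l2.
have h1 := nm1_bddM c1 lq b1; have h2 := nm1_bddM c2 lqq b2.
have e1 : D * (2 * B) * nm1 (qd d) <= D * (2 * B) * B by rewrite ler_wpM2l// !mulr_ge0.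
have e2 : B ^+ 2 * nm1 (fun x => qd d x - qd e x) <= B ^+ 2 * D by rewrite ler_wpM2l// sqr_ge0.
have e3 : 1 * D <= B ^+ 2 * D by rewrite ler_wpM2r// expr_ge1.
clear -h h1 h2 e1 e2 e3 cn; rlra.
Qed.

Lemma PQ_unif B : 1 <= B -> exists2 K, 1 <= K & forall d e D, okd 1 d -> okd 1 e ->
  bdd B d -> bdd B e -> closed_by D d e -> forall x,
  [/\ `|Pd d x| <= K, `|Qd d x| <= K,
      `|Pd d x - Pd e x| <= K * D & `|Qd d x - Qd e x| <= K * D].
Proof.
move=> B1; have B0 : 0 <= B := le_trans ler01 B1.
(* By [gd_bd] the density has L^1 norm at most 2 B^3, and by [gd_lip] two densities differ by at
   most 4 B^2 D. K0 and K1 are what [PQk_bd] and [PQk_lip] make of these. *)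
pose K0 := kap * expR B * (2 * B ^+ 3).
pose K1 := kap * expR B * (4 * B ^+ 2 + 2 * (2 * B ^+ 3)).
have kp : 0 <= kap * expR B by rewrite mulr_ge0 ?expR_ge0// ltW// kap_gt0.
have K00 : 0 <= K0 by rewrite mulr_ge0// mulr_ge0// exprn_ge0.
have K10 : 0 <= K1 by rewrite mulr_ge0// addr_ge0// ?mulr_ge0// exprn_ge0.
exists (1 + K0 + K1); first rlra.
move=> d e D od oe bd be cl x.
have [lg pg] := okd_g od; have [lg' pg'] := okd_g oe.
have [Hy _ py _ _] := od; have [Hy' _ py' _ _] := oe.
have [bq _ _ _] := bd; have [bq' _ _ _] := be.
have [cy cU _ _ _] := cl.
have D0 : 0 <= D := le_trans (normr_ge0 _) (cU 0).
have [h1 h2] := PQk_bd x Hy py lg pg bq (gd_bd od B1 bd).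
have [h3 h4] := PQk_lip Hy py lg pg Hy' py' lg' pg' bq bq' (gd_bd oe B1 be) cy
  (gd_lip od oe B1 bd be cl) x.
have E : kap * expR B * (4 * B ^+ 2 * D + 2 * D * (2 * B ^+ 3)) = K1 * D by rewrite /K1; rlra.
have KD : K1 * D <= (1 + K0 + K1) * D by rewrite ler_wpM2r//; rlra.
rewrite -/K0 in h1 h2.
by split; rewrite /Pd /Qd; [rlra|rlra|rewrite E in h3; rlra|rewrite E in h4; rlra].
Qed.

Lemma normM_le (a b A C : R) : `|a| <= A -> `|b| <= C -> `|a * b| <= A * C.
Proof. by move=> ? ?; rewrite normrM ler_pM. Qed.

(** The weights |q| and |w| are kept instead of being bounded. Integrated, they give the Lipschitz
    estimate in E with a constant depending on B only; bounded by r, they give the sup norm estimate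
    for Euler's scheme. *)
Lemma vf_pt B : 1 <= B -> exists2 K, 1 <= K & forall d e D, okd 1 d -> okd 1 e ->
  bdd B d -> bdd B e -> closed_by D d e -> forall x,
  [/\ `|Qd d x - Qd e x| <= K * D,
      `|wd (vf d) x - wd (vf e) x| <=
        K * (D * `|qd d x| + `|qd d x - qd e x| + `|nd d x - nd e x|) &
      `|nd (vf d) x - nd (vf e) x| <= K * (D * `|qd d x| + D * `|wd d x|
        + `|qd d x - qd e x| + `|wd d x - wd e x|)].
Proof.
move=> B1; have [K0 K01 HK] := PQ_unif B1.
pose K := Num.max K0 B.
have K1 : 1 <= K by rewrite le_max K01.
have KK0 : K0 <= K by rewrite le_max lexx.
have KB : B <= K by rewrite le_max lexx orbT.
have K2 : K <= K ^+ 2 by rewrite ler_eXnr.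
exists (8 * K ^+ 2); first rlra.
move=> d e D od oe bd be cl x.
have [p1 p2 p3 p4] := HK d e D od oe bd be cl x.
have cl0 : closed_by D e e.
  have D0 : 0 <= D by have [_ cU _ _ _] := cl; exact: le_trans (normr_ge0 _) (cU 0).
  have z (f : R -> R) : nm1 (fun x => f x - f x) <= D.
    by rewrite /nm1 (_ : (fun x => _) = fun=> 0) ?Int_cst ?mul0r//; apply/funext => z; rewrite subrr normr0.
  by split=> // z'; rewrite subrr normr0.
have [p1' p2' _ _] := HK e e D oe oe be be cl0 x.
have [_ _ _ bU] := bd; have [_ _ _ bU'] := be.
have [_ /(_ x) cU _ _ _] := cl.
have D0 : 0 <= D := le_trans (normr_ge0 _) cU.
have {bU} bU := le_trans (bU x) KB; have {bU'} bU' := le_trans (bU' x) KB.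
have {p1} p1 := le_trans p1 KK0; have {p2} p2 := le_trans p2 KK0.
have {p1'} p1' := le_trans p1' KK0; have {p2'} p2' := le_trans p2' KK0.
have KD : K0 * D <= K * D by rewrite ler_wpM2r.
have {p3} p3 := le_trans p3 KD; have {p4} p4 := le_trans p4 KD.
have KD2 : K * D <= K ^+ 2 * D by rewrite ler_wpM2r.
have K2D0 : 0 <= K ^+ 2 * D by rewrite mulr_ge0// sqr_ge0.
rewrite /=; move: (Pd d x) (Pd e x) (Qd d x) (Qd e x) (Ud d x) (Ud e x) (qd d x) (qd e x)
  (wd d x) (wd e x) (nd d x) (nd e x) p1 p2 p1' p2' p3 p4 bU bU' cU.
move=> p p' c c' u u' q q' w w' n n' p1 p2 p1' p2' p3 p4 bU bU' cU.
clear -p1 p2 p1' p2' p3 p4 bU bU' cU K1 K2 D0 KD2 K2D0.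
have K20 : 0 <= K ^+ 2 := sqr_ge0 K.
have U2 : `|u ^+ 2 - u' ^+ 2| <= 2 * K * D.
  rewrite (_ : _ - _ = (u - u') * (u + u')); last rlra.
  rewrite mulrC; apply: normM_le => //; apply: le_trans (ler_normD _ _) _; rlra.
have U2' : `|u' ^+ 2| <= K ^+ 2 by rewrite expr2; exact: normM_le.
split; first rlra.
- rewrite (_ : _ - _ = ((u ^+ 2 - u' ^+ 2) / 2 - (p - p')) * q + (u' ^+ 2 / 2 - p') * (q - q')
     + (n - n') / 2); last rlra.
  have h1 : `|((u ^+ 2 - u' ^+ 2) / 2 - (p - p')) * q| <= (8 * K ^+ 2 * D) * `|q|.
    apply: normM_le => //; apply: le_trans (ler_normB _ _) _.
    by rewrite normrM [`|2^-1|]ger0_norm//; rlra.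
  have h2 : `|(u' ^+ 2 / 2 - p') * (q - q')| <= (8 * K ^+ 2) * `|q - q'|.
    apply: normM_le => //; apply: le_trans (ler_normB _ _) _.
    by rewrite normrM [`|2^-1|]ger0_norm//; rlra.
  have h3 : `|(n - n') / 2| <= (8 * K ^+ 2) * `|n - n'|.
    rewrite mulrC; apply: normM_le => //; rewrite ger0_norm//; rlra.
  apply: le_trans (ler_normD _ _) _; have := ler_normD (((u ^+ 2 - u' ^+ 2) / 2 - (p - p')) * q)
    ((u' ^+ 2 / 2 - p') * (q - q')); rlra.
- rewrite (_ : _ - _ = (- 2 * (c * (u - u') + (c - c') * u')) * q
    + (- 2 * (c' * u')) * (q - q') + (3 * (u ^+ 2 - u' ^+ 2) - 2 * (p - p')) * w
    + (3 * u' ^+ 2 - 2 * p') * (w - w')); last rlra.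
  have t2 : `|2| = 2 :> R by rewrite ger0_norm.
  have t3 : `|3| = 3 :> R by rewrite ger0_norm.
  have h1 : `|(- 2 * (c * (u - u') + (c - c') * u')) * q| <= (8 * K ^+ 2 * D) * `|q|.
    apply: normM_le => //; rewrite normrM normrN t2.
    have a1 := normM_le p2 cU; have a2 := normM_le p4 bU'.
    have := ler_normD (c * (u - u')) ((c - c') * u'); rlra.
  have h2 : `|(- 2 * (c' * u')) * (q - q')| <= (8 * K ^+ 2) * `|q - q'|.
    apply: normM_le => //; rewrite normrM normrN t2.
    have a1 := normM_le p2' bU'; rlra.
  have h3 : `|(3 * (u ^+ 2 - u' ^+ 2) - 2 * (p - p')) * w| <= (8 * K ^+ 2 * D) * `|w|.
    apply: normM_le => //; apply: le_trans (ler_normB _ _) _; rewrite !normrM t2 t3; rlra.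
  have h4 : `|(3 * u' ^+ 2 - 2 * p') * (w - w')| <= (8 * K ^+ 2) * `|w - w'|.
    apply: normM_le => //; apply: le_trans (ler_normB _ _) _; rewrite !normrM t2 t3.
    by rewrite normrX in U2' *; rlra.
  apply: le_trans (ler_normD _ _) _.
  apply: le_trans (lerD (le_trans (ler_normD _ _)
    (lerD (le_trans (ler_normD _ _) (lerD h1 h2)) h3)) h4) _; rlra.
Qed.

End data.

(** * Euler's scheme on bounded functions over an index set *)

Section euler.
Context {R : realType} (I : Type).
Implicit Types (z u v : I -> R) (r D : R).
Variables (A : set (I -> R)) (Phi : (I -> R) -> I -> R).

Definition sle z r := forall i, `|z i| <= r.

Definition dyad n : R := 2^-1 ^+ n.

Lemma dyad_gt0 n : 0 < dyad n. Proof. by rewrite exprn_gt0. Qed.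

Lemma dyad_ge0 n : 0 <= dyad n. Proof. exact/ltW/dyad_gt0. Qed.

Lemma dyadS n : dyad n.+1 = dyad n / 2. Proof. by rewrite /dyad exprS mulrC. Qed.

Lemma dyad_le1 n : dyad n <= 1.
Proof. by rewrite exprn_ile1// ?invr_ge0// invf_le1//; lra. Qed.

Lemma dyad_small (a b c : R) : (forall n, a <= b + c * dyad n) -> a <= b.
Proof.
move=> H; rewrite leNgt; apply/negP => ba.
have ab0 : 0 < a - b by lra.
pose c' := Num.max c 1.
have c'0 : 0 < c' by rewrite lt_max ltr01 orbT.
have [n hn] : exists n, dyad n < (a - b) / c'.
  have /cvgrPdist_lt/(_ _ (divr_gt0 ab0 c'0))[N _ HN] :
      (fun n => 2^-1 ^+ n : R) @ \oo --> 0.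
    by apply: cvg_expr; rewrite ger0_norm ?invr_ge0// invf_lt1// ltr1n.
  exists N; have := HN N (leqnn _); rewrite sub0r normrN.
  by rewrite (ger0_norm (dyad_ge0 N)).
have := H n; have : c * dyad n <= c' * dyad n.
  by rewrite ler_wpM2r ?dyad_ge0// le_max lexx.
move: hn; rewrite ltr_pdivlMr//; lra.
Qed.

(** 2 M [dyad n] is the tail of the geometric series of the increments, so the intervals of this
    radius around f n are nested. *)
Lemma geo_lim (f : nat -> R) (M : R) : (forall n, `|f n.+1 - f n| <= M * dyad n) ->
  exists l, forall n, `|l - f n| <= 2 * M * dyad n.
Proof.
move=> H.
have M0 : 0 <= M by have := le_trans (normr_ge0 _) (H 0%N); rewrite /dyad expr0 mulr1.
pose a n := f n - 2 * M * dyad n; pose b n := f n + 2 * M * dyad n.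
have Sa m n : (m <= n)%N -> a m <= a n.
  elim: n => [|n IH]; first by rewrite leqn0 => /eqP ->.
  rewrite leq_eqVlt ltnS => /orP[/eqP->//|/IH h].
  apply: le_trans h _; rewrite /a dyadS.
  by have := H n; rewrite ler_norml => /andP[]; lra.
have Sb m n : (m <= n)%N -> b n <= b m.
  elim: n => [|n IH]; first by rewrite leqn0 => /eqP ->.
  rewrite leq_eqVlt ltnS => /orP[/eqP->//|/IH h].
  apply: le_trans h; rewrite /b dyadS.
  by have := H n; rewrite ler_norml => /andP[]; lra.
have ab m n : a m <= b n.
  apply: le_trans (Sa _ _ (leq_maxl m n)) _; apply: le_trans (Sb _ _ (leq_maxr m n)).
  rewrite /a /b; have : 0 <= 2 * M * dyad (maxn m n) by rewrite !mulr_ge0// dyad_ge0.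
  lra.
exists (sup (range a)) => n.
have ne : range a !=set0 by exists (a 0%N), 0%N.
have h1 : sup (range a) <= b n by apply: ge_sup => // _ [m _ <-].
have h2 : a n <= sup (range a).
  by apply: ub_le_sup; [exists (b 0%N) => _ [m _ <-]|exists n].
by rewrite ler_norml; apply/andP; rewrite /a /b in h1 h2; split; lra.
Qed.

Hypothesis A_step : forall z d, A z -> 0 <= d -> A (fun i => z i + d * Phi z i).
(** This closedness stands in for completeness of a function space: the limit is built index by
    index, then put back into A. *)
Hypothesis A_lim : forall (f : nat -> I -> R) z M, (forall n, A (f n)) ->
  (forall n i, `|z i - f n i| <= M * dyad n) -> A z.
Variable C : R.
Hypothesis C_ge0 : 0 <= C.
Hypothesis growth : forall z r, A z -> sle z r -> sle (Phi z) (C * (1 + r)).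
Hypothesis lip : forall r, exists2 L, 0 <= L & forall z u D, A z -> A u -> sle z r -> sle u r ->
  (forall i, `|z i - u i| <= D) -> forall i, `|Phi z i - Phi u i| <= L * D.
Variables (z0 : I -> R) (r0 : R).
Hypotheses (Az0 : A z0) (z0r : sle z0 r0) (r00 : 0 <= r0).

Fixpoint eul (n k : nat) : I -> R :=
  if k is k'.+1 then (fun i => eul n k' i + dyad n * Phi (eul n k') i) else z0.

Lemma eul_A n k : A (eul n k).
Proof. by elim: k => //= k IH; apply: A_step => //; exact: dyad_ge0. Qed.

(** By linear growth, a bound on 1 + |z| is multiplied by 1 + C [dyad n] at each step. *)
Lemma eul_bd n k : sle (eul n k) ((1 + C * dyad n) ^+ k * (1 + r0) - 1).
Proof.
elim: k => [|k IH] i /=; first by rewrite expr0 mul1r addrC addKr.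
apply: le_trans (ler_normD _ _) _.
rewrite normrM [`|dyad n|]ger0_norm ?dyad_ge0//.
have := growth (eul_A n k) IH i; rewrite addrC subrK => h.
have := ler_wpM2l (dyad_ge0 n) h; have := IH i; rewrite exprS; lra.
Qed.

Lemma expR_pow (a : R) k : 0 <= a -> (1 + a) ^+ k <= expR (a * k%:R).
Proof.
move=> a0; rewrite mulrC expRM_natl; apply: lerXn2r; rewrite ?nnegrE ?expR_ge0//.
  by rewrite addr_ge0.
exact: expR_ge1Dx.
Qed.

Definition rho T := expR (C * T) * (1 + r0).

Lemma eul_rho T n k : dyad n * k%:R <= T -> sle (eul n k) (rho T).
Proof.
move=> kT i; apply: le_trans (eul_bd n k i) _.
have h : (1 + C * dyad n) ^+ k <= expR (C * T).
  apply: le_trans (expR_pow _ _) _; first by rewrite mulr_ge0// dyad_ge0.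
  by rewrite ler_expR -mulrA ler_wpM2l.
have : (1 + C * dyad n) ^+ k * (1 + r0) <= rho T.
  by rewrite /rho ler_wpM2r// addr_ge0.
lra.
Qed.

Definition Bd T := C * (1 + rho T).

Lemma Bd_ge0 T : 0 <= Bd T.
Proof. by rewrite mulr_ge0// addr_ge0// mulr_ge0 ?expR_ge0// addr_ge0. Qed.

Lemma eul_lipt T n k j : (k <= j)%N -> dyad n * j%:R <= T ->
  forall i, `|eul n j i - eul n k i| <= dyad n * (j - k)%:R * Bd T.
Proof.
move=> kj; elim: j kj => [|j IH] kj jT i.
  by move: kj; rewrite leqn0 => /eqP ->; rewrite subrr normr0 subnn mulr0 mul0r.
move: kj; rewrite leq_eqVlt ltnS => /orP[/eqP->|kj].
  by rewrite subrr normr0 subnn mulr0 mul0r.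
have jT' : dyad n * j%:R <= T by apply: le_trans jT; rewrite ler_wpM2l ?dyad_ge0// ler_nat.
have := IH kj jT' i; have := growth (eul_A n j) (eul_rho jT') i.
rewrite -/(Bd T) => /(ler_wpM2l (dyad_ge0 n)) h h'.
rewrite subSn// -natr1 /=.
have := ler_normD (dyad n * Phi (eul n j) i) (eul n j i - eul n k i).
rewrite addrA [dyad n * _ + eul _ _ _]addrC normrM [`|dyad n|]ger0_norm ?dyad_ge0//.
lra.
Qed.

Section fixT.
Variables (T L : R).
Hypothesis T0 : 0 <= T.
Hypothesis L0 : 0 <= L.
Hypothesis LT : forall z u D, A z -> A u -> sle z (rho T) -> sle u (rho T) ->
  (forall i, `|z i - u i| <= D) -> forall i, `|Phi z i - Phi u i| <= L * D.

(** Over an elapsed time tau the iterates move by at most tau [Bd T], hence the field along them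
    departs from its first value by at most L [Bd T] tau; summing over the steps gives a quadratic
    error. *)
Lemma eul_quad n k j : (k <= j)%N -> dyad n * j%:R <= T -> forall i,
  `|eul n j i - eul n k i - dyad n * (j - k)%:R * Phi (eul n k) i|
    <= L * Bd T * (dyad n * (j - k)%:R) ^+ 2.
Proof.
move=> kj; elim: j kj => [|j IH] kj jT i.
  by move: kj; rewrite leqn0 => /eqP ->; rewrite subrr subnn mulr0 mul0r subr0 normr0 expr0n/= mulr0.
move: kj; rewrite leq_eqVlt ltnS => /orP[/eqP->|kj].
  by rewrite subrr subnn mulr0 mul0r subr0 normr0 expr0n/= mulr0.
have jT' : dyad n * j%:R <= T by apply: le_trans jT; rewrite ler_wpM2l ?dyad_ge0// ler_nat.
have kT : dyad n * k%:R <= T by apply: le_trans jT'; rewrite ler_wpM2l ?dyad_ge0// ler_nat.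
have h1 := IH kj jT' i.
have h2 := LT (eul_A n j) (eul_A n k) (eul_rho jT') (eul_rho kT) (eul_lipt kj jT') i.
have h3 := ler_wpM2l (dyad_ge0 n) h2.
rewrite subSn//= -natr1; move: h1 h3.
set m := (j - k)%:R; have m0 : 0 <= m :> R by [].
set hh := dyad n; have hh0 : 0 <= hh := dyad_ge0 n.
set a := eul n j i; set b := eul n k i; set fa := Phi (eul n j) i; set fb := Phi (eul n k) i.
move=> h1 h3.
rewrite (_ : a + _ - b - _ = (a - b - hh * m * fb) + hh * (fa - fb)); last lra.
apply: le_trans (ler_normD _ _) _; rewrite normrM [`|hh|]ger0_norm//.
have : 0 <= L * Bd T * (hh ^+ 2 * m + hh ^+ 2).
  apply: mulr_ge0; first exact: mulr_ge0 L0 (Bd_ge0 T).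
  by apply: addr_ge0; [apply: mulr_ge0 => //|]; exact: sqr_ge0.
lra.
Qed.

(** Two half steps differ from a full one by at most L [Bd T] [dyad n]^2. These local errors add up,
    and each further step amplifies what is already there by 1 + L [dyad n]. *)
Lemma eul_refine n k : dyad n * k%:R <= T -> forall i,
  `|eul n.+1 (2 * k) i - eul n k i| <= L * Bd T * dyad n * (dyad n * k%:R) * (1 + dyad n * L) ^+ k.
Proof.
elim: k => [|k IH] kT i; first by rewrite muln0 /= subrr normr0 !mulr0 mul0r.
have kT' : dyad n * k%:R <= T by apply: le_trans kT; rewrite ler_wpM2l ?dyad_ge0// ler_nat.
have E m : dyad n.+1 * (2 * m)%:R = dyad n * m%:R.
  by rewrite dyadS natrM; lra.
have h1 := IH kT' i.
have k2 : (2 * k <= 2 * k.+1)%N by rewrite leq_mul2l/= leqnSn.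
have kT2 : dyad n.+1 * (2 * k.+1)%:R <= T by rewrite E.
have kT2' : dyad n.+1 * (2 * k)%:R <= T by rewrite E.
have h2 := eul_quad k2 kT2 i.
have E2 : dyad n.+1 * (2 * k.+1 - 2 * k)%:R = dyad n.
  by rewrite -mulnBr subSnn muln1 dyadS; lra.
rewrite E2 in h2.
have h3 := LT (eul_A n.+1 (2 * k)) (eul_A n k) (eul_rho kT2') (eul_rho kT') (IH kT') i.
have h4 := ler_wpM2l (dyad_ge0 n) h3.
have Ek : eul n k.+1 i = eul n k i + dyad n * Phi (eul n k) i by [].
move: h1 h2 h4; rewrite Ek -(natr1 k).
set x := eul n.+1 (2 * k.+1) i; set x' := eul n.+1 (2 * k) i; set f' := Phi (eul n.+1 (2 * k)) i.
set y := eul n k i; set f := Phi (eul n k) i; set hh := dyad n.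
have hh0 : 0 <= hh := dyad_ge0 n.
set W := _ ^+ k; set W1 := _ ^+ k.+1.
have W1E : W1 = W * (1 + hh * L) by rewrite /W1 exprSr.
have W1ge : 1 <= W1 by rewrite exprn_ege1// lerDl mulr_ge0.
have LB : 0 <= L * Bd T * hh ^+ 2.
  by apply: mulr_ge0; [exact: mulr_ge0 L0 (Bd_ge0 T)|exact: exprn_ge0].
have e1 : L * Bd T * hh ^+ 2 * 1 <= L * Bd T * hh ^+ 2 * W1 by rewrite ler_wpM2l.
move=> h1 h2 h4.
rewrite (_ : x - (y + hh * f) = (x - x' - hh * f') + (x' - y) + hh * (f' - f)); last lra.
apply: le_trans (ler_normD _ _) _; rewrite [X in _ + X <= _]normrM [`|hh|]ger0_norm//.
apply: le_trans (lerD (ler_normD _ _) (lexx _)) _.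
rewrite W1E in e1 *; lra.
Qed.

Definition M1 := L * Bd T * T * expR (L * T).

Lemma M1_ge0 : 0 <= M1.
Proof. exact: mulr_ge0 (mulr_ge0 (mulr_ge0 L0 (Bd_ge0 T)) T0) (expR_ge0 _). Qed.

Lemma eul_refine' n k : dyad n * k%:R <= T -> forall i,
  `|eul n.+1 (2 * k) i - eul n k i| <= M1 * dyad n.
Proof.
move=> kT i; apply: le_trans (eul_refine kT i) _.
have h0 := dyad_ge0 n.
have hk0 : 0 <= dyad n * k%:R by rewrite mulr_ge0.
have e1 : (1 + dyad n * L) ^+ k <= expR (L * T).
  apply: le_trans (expR_pow _ _) _; first by rewrite mulr_ge0.
  rewrite ler_expR; have := ler_wpM2l L0 kT; lra.
have e0 : 0 <= (1 + dyad n * L) ^+ k by rewrite exprn_ge0// addr_ge0// mulr_ge0.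
have LB : 0 <= L * Bd T * dyad n by apply: mulr_ge0 => //; exact: mulr_ge0 L0 (Bd_ge0 T).
have := ler_pM hk0 e0 kT e1 => /(ler_wpM2l LB); rewrite /M1; lra.
Qed.

Definition eult n (t : R) := eul n (Num.truncn (t / dyad n)).

Lemma truncn_dyad n t : 0 <= t -> dyad n * (Num.truncn (t / dyad n))%:R <= t /\
  t < dyad n * (Num.truncn (t / dyad n))%:R + dyad n.
Proof.
move=> t0; have h0 := dyad_gt0 n.
have /andP[h1 h2] := truncn_itv (divr_ge0 t0 (ltW h0)).
rewrite ler_pdivlMr// in h1; rewrite ltr_pdivrMr// -natr1 in h2; split; lra.
Qed.

(** Truncation makes the fine index 2 k or 2 k + 1, so [eul_refine'] is off by at most one fine
    step. *)
Lemma eult_step n t : 0 <= t -> t <= T -> forall i,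
  `|eult n.+1 t i - eult n t i| <= (M1 + Bd T) * dyad n.
Proof.
move=> t0 tT i; rewrite /eult.
set k := Num.truncn (t / dyad n); set j := Num.truncn (t / dyad n.+1).
have [k1 k2] := truncn_dyad n t0; have [j1 j2] := truncn_dyad n.+1 t0.
rewrite -/k -/j in k1 k2 j1 j2.
have h0 := dyad_gt0 n; rewrite dyadS in j1 j2.
have jk : (2 * k <= j < 2 * k + 2)%N.
  rewrite -ltnS -2!(ltr_nat R) -!natr1 natrD natrM; apply/andP; split.
    by rewrite -(ltr_pM2l h0); lra.
  by rewrite -(ltr_pM2l h0); lra.
move/andP: jk => [jk1 jk2].
have jT : dyad n.+1 * j%:R <= T by rewrite dyadS; lra.
have h1 := eul_lipt jk1 jT i.
have h2 : dyad n * k%:R <= T by lra.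
have h3 := eul_refine' h2 i.
have h4 : dyad n.+1 * (j - 2 * k)%:R * Bd T <= dyad n * Bd T.
  rewrite ler_wpM2r ?Bd_ge0// dyadS.
  have : (j - 2 * k <= 1)%N by rewrite leq_subLR addn1 -ltnS -addn2.
  by rewrite -(ler_nat R) => h; have := ler_wpM2l (ltW h0) h; lra.
have := ler_distD (eul n.+1 (2 * k) i) (eul n.+1 j i) (eul n k i); lra.
Qed.

End fixT.

Lemma eult_lim t : 0 <= t -> forall i, exists l, exists M, forall n, `|l - eult n t i| <= M * dyad n.
Proof.
move=> t0 i; have [L L0 HL] := lip (rho t).
have [l Hl] := geo_lim (fun n => eult_step L0 HL n t0 (lexx t) i).
by exists l, (2 * (M1 t L + Bd t)).
Qed.

(* The limit of the Euler approximations; they converge at a geometric rate. *)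
Definition flow t i := xget 0 [set l | exists M, forall n, `|l - eult n t i| <= M * dyad n].

(** [flow] is picked with a constant that may depend on t and i. As limits are unique, it inherits
    the rate of [geo_lim], the same for all indices and all times up to T. *)
Lemma flowP T t n i : 0 <= t -> t <= T -> forall L, 0 <= L -> (forall z u D, A z -> A u ->
  sle z (rho T) -> sle u (rho T) -> (forall i, `|z i - u i| <= D) ->
  forall i, `|Phi z i - Phi u i| <= L * D) ->
  `|flow t i - eult n t i| <= 2 * (M1 T L + Bd T) * dyad n.
Proof.
move=> t0 tT L L0 HL.
have [M HM] : exists M, forall n, `|flow t i - eult n t i| <= M * dyad n.
  by have [l Hl] := eult_lim t0 i; 
  exact: (@xgetI _ 0 [set l | exists M, forall n, `|l - eult n t i| <= M * dyad n] l Hl).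
have [l Hl] := geo_lim (fun n => eult_step L0 HL n t0 tT i).
suff -> : flow t i = l by exact: Hl.
apply/eqP; rewrite -subr_eq0 -normr_le0.
apply: (@dyad_small _ _ (M + 2 * (M1 T L + Bd T))) => m; rewrite add0r.
have := ler_distD (eult m t i) (flow t i) l; rewrite [`|eult m t i - l|]distrC.
by have := HM m; have := Hl m; lra.
Qed.

Lemma flow0 : flow 0 = z0.
Proof.
apply/funext => i; have [L L0 HL] := lip (rho 0).
apply/eqP; rewrite -subr_eq0 -normr_le0.
apply: (@dyad_small _ _ (2 * (M1 0 L + Bd 0))) => n; rewrite add0r.
have := flowP n i (lexx 0) (lexx 0) L0 HL.
by rewrite /eult mul0r truncn0.
Qed.

Lemma flow_A t : 0 <= t -> A (flow t).
Proof.
move=> t0; have [L L0 HL] := lip (rho t).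
apply: (@A_lim (fun n => eult n t) (flow t) (2 * (M1 t L + Bd t))) => [n|n i].
  exact: eul_A.
exact: (flowP n i t0 (lexx t) L0 HL).
Qed.

Lemma eult_rho T t n : 0 <= t -> t <= T -> sle (eult n t) (rho T).
Proof. by move=> t0 tT; apply: eul_rho; have [h _] := truncn_dyad n t0; lra. Qed.

Lemma flow_rho T t : 0 <= t -> t <= T -> sle (flow t) (rho T).
Proof.
move=> t0 tT i; have [L L0 HL] := lip (rho T).
apply: (@dyad_small _ _ (2 * (M1 T L + Bd T))) => n.
have := flowP n i t0 tT L0 HL; have := eult_rho n t0 tT i.
by have := ler_normD (flow t i - eult n t i) (eult n t i); rewrite subrK; lra.
Qed.

Lemma flow_lipt T s t i : 0 <= t -> t <= s -> s <= T ->
  `|flow s i - flow t i| <= (s - t) * Bd T.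
Proof.
move=> t0 ts sT; have [L L0 HL] := lip (rho T).
have s0 := le_trans t0 ts; have tT := le_trans ts sT.
pose M := 2 * (M1 T L + Bd T).
apply: (@dyad_small _ _ (2 * M + Bd T)) => n.
have h1 := flowP n i t0 tT L0 HL; have h2 := flowP n i s0 sT L0 HL.
rewrite -/M in h1 h2.
have hn := dyad_gt0 n.
have [k1 k2] := truncn_dyad n t0; have [j1 j2] := truncn_dyad n s0.
set k := Num.truncn (t / dyad n) in k1 k2; set j := Num.truncn (s / dyad n) in j1 j2.
have kj : (k <= j)%N by apply: le_truncn; rewrite ler_pM2r// invr_gt0.
have jT : dyad n * j%:R <= T by lra.
have h3 := eul_lipt kj jT i; rewrite natrB// in h3.
have h4 : dyad n * (j%:R - k%:R) * Bd T <= (s - t + dyad n) * Bd T.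
  by rewrite ler_wpM2r ?Bd_ge0//; lra.
have := ler_distD (eult n s i) (flow s i) (flow t i).
have := ler_distD (eult n t i) (eult n s i) (flow t i).
rewrite [`|eult n t i - flow t i|]distrC.
have -> : `|eult n s i - eult n t i| = `|eul n j i - eul n k i| by [].
lra.
Qed.

Lemma flow_quad_fwd T s t i : 0 <= t -> t <= s -> s <= T -> forall L, 0 <= L ->
  (forall z u D, A z -> A u -> sle z (rho T) -> sle u (rho T) ->
    (forall i, `|z i - u i| <= D) -> forall i, `|Phi z i - Phi u i| <= L * D) ->
  `|flow s i - flow t i - (s - t) * Phi (flow t) i| <= L * Bd T * (s - t) ^+ 2.
Proof.
move=> t0 ts sT L L0 HL.
have s0 := le_trans t0 ts; have tT := le_trans ts sT.
pose M := 2 * (M1 T L + Bd T).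
have M0 : 0 <= M.
  apply: mulr_ge0 => //; apply: addr_ge0; last exact: Bd_ge0.
  by apply: M1_ge0 => //; exact: le_trans t0 tT.
apply: (@dyad_small _ _ (2 * M + Bd T + T * L * M + L * Bd T * (2 * T + 1))) => n.
have h1 := flowP n i t0 tT L0 HL; have h2 := flowP n i s0 sT L0 HL.
rewrite -/M in h1 h2.
have hn := dyad_gt0 n.
have [k1 k2] := truncn_dyad n t0; have [j1 j2] := truncn_dyad n s0.
set k := Num.truncn (t / dyad n) in k1 k2; set j := Num.truncn (s / dyad n) in j1 j2.
have kj : (k <= j)%N by apply: le_truncn; rewrite ler_pM2r// invr_gt0.
have jT : dyad n * j%:R <= T by lra.
have kT : dyad n * k%:R <= T by lra.
have h3 := eul_quad L0 HL kj jT i; rewrite natrB// in h3.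
have h5 := HL _ _ _ (flow_A t0) (eul_A n k) (flow_rho t0 tT) (eul_rho kT)
   (fun i => flowP n i t0 tT L0 HL) i; rewrite -/M in h5.
have h6 := growth (eul_A n k) (eul_rho kT) i; rewrite -/(Bd T) in h6.
rewrite (_ : eult n t = eul n k)// in h1; rewrite (_ : eult n s = eul n j)// in h2.
move: h1 h2 h3 h5 h6; set ft := flow t i; set fs := flow s i; set pt := Phi (flow t) i.
set ek := eul n k i; set ej := eul n j i; set pk := Phi (eul n k) i.
set hh := dyad n in hn k1 k2 j1 j2 *; move=> h1 h2 h3 h5 h6.
clearbody ft fs pt ek ej pk.
set dl := hh * (j%:R - k%:R) in h3.
have dl1 : `|dl - (s - t)| <= hh by rewrite /dl ler_norml; apply/andP; split; lra.
have dl0 : 0 <= dl by apply: mulr_ge0; [exact: ltW|rewrite subr_ge0 ler_nat].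
have dl2 : dl ^+ 2 <= (s - t) ^+ 2 + (2 * T + 1) * hh.
  have h : dl <= s - t + hh by move: dl1; rewrite ler_norml => /andP[]; lra.
  have st0 : 0 <= s - t by lra.
  have hle1 : hh <= 1 by exact: dyad_le1.
  have : dl ^+ 2 <= (s - t + hh) ^+ 2 by rewrite lerXn2r// ?nnegrE; lra.
  have e1 : hh * hh <= 1 * hh by rewrite ler_wpM2r// ltW.
  have e2 : (s - t) * hh <= T * hh by apply: ler_wpM2r; [exact: ltW|lra].
  lra.
have LB : 0 <= L * Bd T := mulr_ge0 L0 (Bd_ge0 T).
have e3 := ler_wpM2l LB dl2.
rewrite (_ : fs - ft - _ = (fs - ej) + - (ft - ek) + (ej - ek - dl * pk)
   + (dl - (s - t)) * pk + - ((s - t) * (pt - pk))); last lra.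
apply: le_trans (ler_normD _ _) _; rewrite normrN normrM [`|s - t|]ger0_norm ?subr_ge0//.
have e4 : (s - t) * `|pt - pk| <= T * (L * (M * hh)) by apply: ler_pM => //; lra.
have e5 : `|(dl - (s - t)) * pk| <= hh * Bd T by rewrite normrM ler_pM.
have := ler_normD (fs - ej + - (ft - ek) + (ej - ek - dl * pk)) ((dl - (s - t)) * pk).
have := ler_normD (fs - ej + - (ft - ek)) (ej - ek - dl * pk).
have := ler_normD (fs - ej) (- (ft - ek)); rewrite normrN.
lra.
Qed.

(** For s < t the expansion is made at s and the field is then moved to t, at the price of another L
    [Bd T] (t - s)^2; hence the factor 2 in the last term of K. *)
Lemma flow_quad T : 0 <= T -> exists2 K, 0 <= K & forall s t i, 0 <= t -> t <= T -> 0 <= s -> s <= T ->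
  [/\ `|flow t i| <= K, `|Phi (flow t) i| <= K, `|flow s i - flow t i| <= K * `|s - t|,
   `|Phi (flow s) i - Phi (flow t) i| <= K * `|s - t| &
   `|flow s i - flow t i - (s - t) * Phi (flow t) i| <= K * (s - t) ^+ 2].
Proof.
move=> T0; have [L L0 HL] := lip (rho T).
have B0 := Bd_ge0 T; have LB : 0 <= L * Bd T := mulr_ge0 L0 (Bd_ge0 T).
have r1 : 0 <= rho T by rewrite mulr_ge0 ?expR_ge0// addr_ge0.
have abs s t i : 0 <= t -> t <= T -> 0 <= s -> s <= T -> `|flow s i - flow t i| <= Bd T * `|s - t|.
  move=> t0 tT s0 sT; have [ts|st] := leP t s.
    by rewrite [`|s - t|]ger0_norm ?subr_ge0// mulrC; exact: flow_lipt.
  rewrite distrC [`|s - t|]distrC [`|t - s|]ger0_norm; last by rewrite subr_ge0 ltW.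
  by rewrite mulrC; apply: flow_lipt => //; exact: ltW.
exists (rho T + Bd T + L * Bd T + 2 * (L * Bd T)); first lra.
move=> s t i t0 tT s0 sT; split.
- by have := flow_rho t0 tT i; lra.
- by have := growth (flow_A t0) (flow_rho t0 tT) i; rewrite -/(Bd T); lra.
- apply: le_trans (abs _ _ i t0 tT s0 sT) _; rewrite ler_wpM2r//; lra.
- apply: le_trans (HL _ _ _ (flow_A s0) (flow_A t0) (flow_rho s0 sT) (flow_rho t0 tT)
    (fun i => abs _ _ i t0 tT s0 sT) i) _.
  rewrite [leLHS]mulrA ler_wpM2r//; lra.
- apply: (@le_trans _ _ (2 * (L * Bd T) * (s - t) ^+ 2)); last first.
    by rewrite ler_wpM2r ?sqr_ge0//; lra.
  have [ts|st] := leP t s.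
    apply: le_trans (flow_quad_fwd i t0 ts sT L0 HL) _.
    by rewrite ler_wpM2r ?sqr_ge0//; lra.
  have h := flow_quad_fwd i s0 (ltW st) tT L0 HL.
  have h' := HL _ _ _ (flow_A s0) (flow_A t0) (flow_rho s0 sT) (flow_rho t0 tT)
    (fun i => abs _ _ i t0 tT s0 sT) i.
  rewrite (_ : `|s - t| = t - s) in h'; last by rewrite ltr0_norm ?subr_lt0// opprB.
  have ts0 : 0 <= t - s by lra.
  have h'' := ler_wpM2l ts0 h'.
  rewrite (_ : flow s i - flow t i - _ = - (flow t i - flow s i - (t - s) * Phi (flow s) i)
    + - ((t - s) * (Phi (flow s) i - Phi (flow t) i))); last lra.
  apply: le_trans (ler_normD _ _) _; rewrite !normrN normrM [`|t - s|]ger0_norm//.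
  lra.
Qed.

End euler.

(** * The truncated flow *)

Inductive cmp := CY | CU | CQ | CW | CN.

Section theta.
Context {R : realType}.
Local Notation mu := (@lebesgue_measure R).
Implicit Types (d e : data R) (B D x r : R) (z : cmp * R -> R).

Definition cmpd (c : cmp) d : R -> R :=
  match c with CY => yd d | CU => Ud d | CQ => qd d | CW => wd d | CN => nd d end.

Definition perd d := forall x, [/\ qd d (x + 1) = qd d x, wd d (x + 1) = wd d x &
  nd d (x + 1) = nd d x].

(** U enters through its value at 0 only: its oscillation is at most the L^1 norm of [wd], so [Nn]
    controls all of [bdd]. *)
Definition Nn d : R := `|Ud d 0| + nm1 (qd d) + nm1 (wd d) + nm1 (nd d).

(* 1 on states of size at most N0, 0 on states of size at least 2 N0. *)
Definition theta (N0 : R) d : R := Num.max 0 (Num.min 1 (2 - Nn d / N0)).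

(* y is encoded by the periodic function y - id. *)
Definition dof z := Data (fun x => z (CY, x) + x) (fun x => z (CU, x))
  (fun x => z (CQ, x)) (fun x => z (CW, x)) (fun x => z (CN, x)).

Definition zof d : cmp * R -> R := fun i => cmpd i.1 d i.2 - (if i.1 is CY then i.2 else 0).

Lemma zofK d : dof (zof d) = d.
Proof.
case: d => y U q w n; rewrite /dof /zof /=; congr Data; apply/funext => x; rlra.
Qed.

Lemma perd_vf d : okd 1 d -> perd d -> perd (vf d).
Proof.
move=> ok pd x; have [_ _ pP pQ] := okd_PQ ok; have [_ _ _ pU _] := ok.
have [q1 w1 n1] := pd x; split => //=; first by rewrite q1 n1 pU pP !addr0.
by rewrite q1 w1 pU pP pQ !addr0.
Qed.

Lemma okd_add al d e : okd al d -> okd 0 e -> okd al (addd d e).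
Proof.
move=> [H1 H2 p1 p2 [l1 a1]] [K1 K2 r1 r2 [m1 b1]]; split=> /=; try exact: ACD.
- by move=> x; rewrite p1 r1; rlra.
- by move=> x; rewrite p2 r2; rlra.
- by split; [exact: L1locD|exact: aeperD].
Qed.

Lemma okd_scale al c d : okd al d -> okd (c * al) (scd c d).
Proof.
move=> [H1 H2 p1 p2 [l1 a1]]; split=> /=; try exact: ACZ.
- by move=> x; rewrite p1; rlra.
- by move=> x; rewrite p2; rlra.
- by split; [exact: L1locZ|apply: aeperM => //; exact: aeper_cst].
Qed.

Lemma okd_sub al be d e : okd al d -> okd be e -> okd (al - be) (subd d e).
Proof.
move=> [H1 H2 p1 p2 [l1 a1]] [K1 K2 r1 r2 [m1 b1]]; split=> /=; try exact: ACB.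
- by move=> x; rewrite p1 r1; rlra.
- by move=> x; rewrite p2 r2; rlra.
- by split; [exact: L1locB|exact: aeperB].
Qed.

Lemma per_red (f : R -> R) : qper 0 f -> forall x, exists x', f x = f x' /\ 0 <= x' <= 1.
Proof.
move=> pf x; have [n /andP[h1 h2]] := floor_itvR x.
exists (x - n%:~R); split; last by apply/andP; split; rlra.
by have := qper_int n (x - n%:~R) pf; rewrite subrK => ->; rewrite mulr0 addr0.
Qed.

Lemma Ud_bd al d : okd al d -> forall x x', `|Ud d x - Ud d x'| <= nm1 (wd d).
Proof.
move=> ok x x'; have [_ HU _ pU _] := ok; have [lw pw] := okd_w ok.
have [u [-> /andP[u0 u1]]] := per_red pU x; have [v [-> /andP[v0 v1]]] := per_red pU x'.
wlog uv : u v u0 u1 v0 v1 / v <= u.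
  by move=> h; have [/h|/ltW/h] := leP v u; [apply|rewrite distrC; apply].
by apply: le_trans (AC_cvg HU uv) _; exact: (Int_sub (L1loc_abs lw)).
Qed.

Lemma Nn_bdd d B : okd 1 d -> Nn d <= B -> bdd B d.
Proof.
move=> ok size_bound; have [lq _] := okd_q ok; have [lw _] := okd_w ok; have [_ _ _ _ [ln _]] := ok.
have := nm1_ge0 lq; have := nm1_ge0 lw; have := nm1_ge0 ln; have := normr_ge0 (Ud d 0).
rewrite /Nn in size_bound => h1 h2 h3 h4; split; try rlra.
move=> x; have := Ud_bd ok x 0; have := ler_normD (Ud d x - Ud d 0) (Ud d 0).
by rewrite subrK; rlra.
Qed.

Lemma theta_itv N0 d : 0 <= theta N0 d <= 1.
Proof. by rewrite /theta le_max lexx/= ge_max ler01 ge_min lexx. Qed.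

Lemma theta0 N0 d : 0 < N0 -> 2 * N0 <= Nn d -> theta N0 d = 0.
Proof.
move=> N00 h; rewrite /theta max_l// ge_min; apply/orP; right.
by rewrite subr_le0 ler_pdivlMr.
Qed.

Lemma theta1 N0 d : 0 < N0 -> Nn d <= N0 -> theta N0 d = 1.
Proof.
move=> N00 h; have h1 : Nn d / N0 <= 1 by rewrite ler_pdivrMr ?mul1r.
by rewrite /theta min_l ?max_r//; rlra.
Qed.

Lemma clamp_lip (a b : R) : `|Num.max 0 (Num.min 1 a) - Num.max 0 (Num.min 1 b)| <= `|a - b|.
Proof.
rewrite ler_norml /Num.max /Num.min; have := ler_norm (a - b); have := ler_norm (b - a).
rewrite [`|b - a|]distrC.
by do ![case: ifP => /=]; move=> *; apply/andP; split; rlra.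
Qed.

Lemma nm1_dist (f g : R -> R) : L1loc f -> L1loc g -> `|nm1 f - nm1 g| <= nm1 (fun x => f x - g x).
Proof.
move=> lf lg; have h1 := nm1D (L1locB lf lg) lg; have h2 := nm1D (L1locB lg lf) lf.
have e1 : nm1 (fun x => f x - g x + g x) = nm1 f by congr nm1; apply/funext => x; rewrite subrK.
have e2 : nm1 (fun x => g x - f x + f x) = nm1 g by congr nm1; apply/funext => x; rewrite subrK.
have e3 : nm1 (fun x => g x - f x) = nm1 (fun x => f x - g x).
  by rewrite /nm1; congr Int; apply/funext => x; rewrite distrC.
rewrite e1 in h1; rewrite e2 e3 in h2; rewrite ler_norml; apply/andP; split; rlra.
Qed.

Lemma Nn_dist al d e D : okd al d -> okd al e -> closed_by D d e -> `|Nn d - Nn e| <= 4 * D.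
Proof.
move=> od oe [_ cU cq cw cn]; have [lq _] := okd_q od; have [lw _] := okd_w od.
have [_ _ _ _ [ln _]] := od; have [lq' _] := okd_q oe; have [lw' _] := okd_w oe.
have [_ _ _ _ [ln' _]] := oe.
have G (a a' b b' c c' f f' : R) : `|a - a'| <= D -> `|b - b'| <= D -> `|c - c'| <= D ->
    `|f - f'| <= D -> `|a + b + c + f - (a' + b' + c' + f')| <= 4 * D.
  clear; rewrite !ler_norml => /andP[? ?] /andP[? ?] /andP[? ?] /andP[? ?].
  by apply/andP; split; rlra.
apply: G; first exact: le_trans (ler_dist_dist _ _) (cU 0).
- exact: le_trans (nm1_dist lq lq') cq.
- exact: le_trans (nm1_dist lw lw') cw.
- exact: le_trans (nm1_dist ln ln') cn.
Qed.

(** Once P, Q and U are bounded in terms of B, the field is affine in the values of (q, w, n) at x.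
    No bound on y is asked for, since only its increments enter the kernels. *)
Lemma vf_bd B : 1 <= B -> exists2 K, 1 <= K & forall d, okd 1 d -> bdd B d -> forall x r,
  (forall c, c <> CY -> `|cmpd c d x| <= r) -> forall c, `|cmpd c (vf d) x| <= K * (1 + r).
Proof.
move=> B1; have [K K1 HK] := PQ_unif B1.
have B0 : 0 <= B ^+ 2 := sqr_ge0 B.
exists (1 + B ^+ 2 / 2 + K + 2 * K * B + 3 * B ^+ 2 + 2 * K); first by nra.
move=> d od bd x r hr.
have cl0 : closed_by 0 d d.
  have z (f : R -> R) : nm1 (fun x => f x - f x) <= 0.
    by rewrite /nm1 (_ : (fun x => _) = fun=> 0) ?Int_cst ?mul0r//; apply/funext => z; rewrite subrr normr0.
  by split=> // z'; rewrite subrr normr0.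
have [p1 p2 _ _] := HK d d 0 od od bd bd cl0 x.
have [_ _ _ /(_ x) bU] := bd.
have hU := hr CU (fun h => match h with end).
have hq : `|qd d x| <= r by exact: (hr CQ).
have hw : `|wd d x| <= r by exact: (hr CW).
have hn : `|nd d x| <= r by exact: (hr CN).
have r0 : 0 <= r := le_trans (normr_ge0 _) hq.
have B0' : 0 <= B := le_trans ler01 B1.
have K0 : 0 <= K := le_trans ler01 K1.
have U2 : `|Ud d x ^+ 2| <= B ^+ 2 by rewrite normrX; apply: lerXn2r; rewrite ?nnegrE.
have t2 : `|2| = 2 :> R by rewrite ger0_norm.
have t3 : `|3| = 3 :> R by rewrite ger0_norm.
have h2' : `|2^-1| = 2^-1 :> R by rewrite ger0_norm.
have KB : 0 <= K * B by rewrite mulr_ge0.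
have pos1 : 0 <= B ^+ 2 * r by rewrite mulr_ge0.
have pos2 : 0 <= K * r by rewrite mulr_ge0.
have pos3 : 0 <= K * B * r by rewrite mulr_ge0.
case=> /=.
- apply: le_trans hU _; nra.
- rewrite normrN; nra.
- nra.
- have e1 : `|nd d x / 2| <= r * 2^-1 by apply: normM_le => //; rewrite h2'.
  have e2 : `|(Ud d x ^+ 2 / 2 - Pd d x) * qd d x| <= (B ^+ 2 * 2^-1 + K) * r.
    apply: normM_le => //; apply: le_trans (ler_normB _ _) _; apply: lerD => //.
    by apply: normM_le => //; rewrite h2'.
  apply: le_trans (ler_normD _ _) _; nra.
- have e1 : `|- 2 * Qd d x * Ud d x * qd d x| <= 2 * K * B * r.
    by apply: normM_le => //; apply: normM_le => //; apply: normM_le => //; rewrite normrN t2.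
  have e2 : `|(3 * Ud d x ^+ 2 - 2 * Pd d x) * wd d x| <= (3 * B ^+ 2 + 2 * K) * r.
    apply: normM_le => //; apply: le_trans (ler_normB _ _) _.
    by apply: lerD; apply: normM_le => //; rewrite ?t2 ?t3.
  apply: le_trans (ler_normD _ _) _; nra.
Qed.

End theta.

(** * The cut-off field as an instance of Euler's scheme *)

Section thetaflow.
Context {R : realType}.
Local Notation mu := (@lebesgue_measure R).
Implicit Types (d e : data R) (B D x r : R) (z : cmp * R -> R).

Definition state_space : set (cmp * R -> R) := [set z | okd 1 (dof z) /\ perd (dof z)].

Definition cutoff_field (N0 : R) z : cmp * R -> R := fun i =>
  theta N0 (dof z) * cmpd i.1 (vf (dof z)) i.2.

Lemma dof_step N0 z a : dof (fun i => z i + a * cutoff_field N0 z i) =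
  addd (dof z) (scd (a * theta N0 (dof z)) (vf (dof z))).
Proof. by rewrite /dof /addd /scd /cutoff_field /=; congr Data; apply/funext => x; rlra. Qed.

Lemma state_space_step N0 z a : state_space z -> 0 <= a -> state_space (fun i => z i + a * cutoff_field N0 z i).
Proof.
move=> [ok pd] a0; rewrite /state_space/= dof_step; split.
  apply: okd_add => //; have := okd_scale (a * theta N0 (dof z)) (okd_vf ok).
  by rewrite mulr0.
by move=> x; have [h1 h2 h3] := pd x; have [k1 k2 k3] := perd_vf ok pd x;
  split; rewrite /= ?h1 ?h2 ?h3; congr (_ + _ * _).
Qed.

Lemma meas_lim (f : nat -> R -> R) (g : R -> R) M : (forall n, measurable_fun setT (f n)) ->
  (forall n x, `|g x - f n x| <= M * dyad n) -> measurable_fun setT g.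
Proof.
move=> mf H; apply: (measurable_fun_cvg mf) => x _.
apply/cvgrPdist_le => e e0.
have M0 : 0 <= M by have := le_trans (normr_ge0 _) (H 0%N 0); rewrite /dyad expr0 mulr1.
have /cvgrPdist_lt/(_ _ (divr_gt0 e0 (ltr_wpDl M0 ltr01)))[N _ HN] :
      (fun n => 2^-1 ^+ n : R) @ \oo --> 0.
  by apply: cvg_expr; rewrite ger0_norm ?invr_ge0// invf_lt1// ltr1n.
exists N => // n /= Nn; apply: le_trans (H n x) _.
have := HN n Nn; rewrite sub0r normrN (ger0_norm (dyad_ge0 n)) -/(dyad n) ltr_pdivlMr ?ltr_wpDl// => h.
by have : 0 <= dyad n :> R := dyad_ge0 n; nra.
Qed.

Lemma L1loc_lim (f : nat -> R -> R) (g : R -> R) M : (forall n, L1loc (f n)) ->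
  (forall n x, `|g x - f n x| <= M * dyad n) -> L1loc g.
Proof.
move=> lf H; have mg := meas_lim (fun n => L1loc_meas (lf n)) H.
have M0 : 0 <= M by have := le_trans (normr_ge0 _) (H 0%N 0); rewrite /dyad expr0 mulr1.
apply: (L1loc_le mg (L1locD (L1loc_abs (lf 0%N)) (L1loc_cst M))) => x.
rewrite [leRHS]ger0_norm ?addr_ge0//.
have := H 0%N x; rewrite /dyad expr0 mulr1.
by have := ler_normD (g x - f 0%N x) (f 0%N x); rewrite subrK; rlra.
Qed.

(** The functions and their derivatives converge uniformly at the same rate, so the formula f b - f
    a = [Int] f' a b passes to the limit on each bounded interval. *)
Lemma AC_lim (f f' : nat -> R -> R) (g g' : R -> R) M : (forall n, abscont (f n) (f' n)) ->
  (forall n x, `|g x - f n x| <= M * dyad n) ->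
  (forall n x, `|g' x - f' n x| <= M * dyad n) -> abscont g g'.
Proof.
move=> Hf H H'; have lg' : L1loc g' := L1loc_lim (fun n => AC_L1 (Hf n)) H'.
split=> // a b; wlog ab : a b / a <= b.
  move=> h; have [/h//|/ltW/h e] := leP a b.
  by rewrite Int_swap -e opprB.
apply/eqP; rewrite -subr_eq0 -normr_le0.
apply: (@dyad_small _ _ _ (2 * M + M * (b - a))) => n; rewrite add0r.
have h1 := H n a; have h2 := H n b.
have h3 : `|Int (fun x => g' x - f' n x) a b| <= M * dyad n * (b - a).
  rewrite -Int_cst; apply: Int_bdW => //; last exact: L1loc_cst.
  exact: L1locB lg' (AC_L1 (Hf n)).
rewrite IntB// in h3; last exact: AC_L1 (Hf n).
rewrite -(ACE _ _ (Hf n)) in h3.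
move: h1 h2 h3; rewrite !ler_norml => /andP[? ?] /andP[? ?] /andP[? ?].
by apply/andP; split; rlra.
Qed.

Lemma eq_lim (a b : R) (f g : nat -> R) M : (forall n, `|a - f n| <= M * dyad n) ->
  (forall n, `|b - g n| <= M * dyad n) -> (forall n, f n = g n) -> a = b.
Proof.
move=> ha hb e; apply/eqP; rewrite -subr_eq0 -normr_le0.
apply: (@dyad_small _ _ _ (2 * M)) => n; rewrite add0r.
have := ha n; have := hb n; rewrite e !ler_norml => /andP[? ?] /andP[? ?].
by apply/andP; split; rlra.
Qed.

Lemma state_space_lim (f : nat -> cmp * R -> R) z M : (forall n, state_space (f n)) ->
  (forall n i, `|z i - f n i| <= M * dyad n) -> state_space z.
Proof.
move=> Af H.
have Hy n x : `|yd (dof z) x - yd (dof (f n)) x| <= M * dyad n.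
  by rewrite /= (_ : _ - _ = z (CY, x) - f n (CY, x)); [exact: H|rlra].
have pe c : (forall n x, f n (c, x + 1) = f n (c, x)) -> forall x, z (c, x + 1) = z (c, x).
  move=> p x; apply: (eq_lim (fun n => H n (c, x + 1)) (fun n => H n (c, x))) => n.
  exact: p.
have pq := pe CQ (fun n x => let: And3 h _ _ := (Af n).2 x in h).
have pw := pe CW (fun n x => let: And3 _ h _ := (Af n).2 x in h).
have pn := pe CN (fun n x => let: And3 _ _ h := (Af n).2 x in h).
split; last by move=> x; split; [exact: pq|exact: pw|exact: pn].
split.
- apply: (AC_lim (f := fun n => yd (dof (f n))) (f' := fun n => qd (dof (f n)))) => [n|n x|n x].
  + by have [[]] := Af n.
  + exact: Hy.
  + exact: H.
- apply: (AC_lim (f := fun n => Ud (dof (f n))) (f' := fun n => wd (dof (f n)))) => [n|n x|n x].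
  + by have [[]] := Af n.
  + exact: H.
  + exact: H.
- move=> x; have : z (CY, x + 1) = z (CY, x).
    apply: pe => n {}x; have [[_ _ p _ _] _] := Af n.
    by have := p x; rewrite /=; rlra.
  by rewrite /= => ->; rlra.
- move=> x; rewrite addr0; apply: (pe CU) => n {}x; have [[_ _ _ p _] _] := Af n.
  by have := p x; rewrite /= addr0.
- split; last by apply: aeT => x; exact: pn.
  apply: (L1loc_lim (f := fun n => nd (dof (f n)))) => [n|n x]; last exact: H.
  by have [[_ _ _ _ []]] := Af n.
Qed.

Lemma state_space_closed z u D : (forall i, `|z i - u i| <= D) -> state_space z -> state_space u -> closed_by D (dof z) (dof u).
Proof.
move=> H [oz _] [ou _].
have [lq _] := okd_q oz; have [lw _] := okd_w oz; have [_ _ _ _ [ln _]] := oz.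
have [lq' _] := okd_q ou; have [lw' _] := okd_w ou; have [_ _ _ _ [ln' _]] := ou.
split.
- by move=> x; rewrite /= (_ : _ - _ = z (CY, x) - u (CY, x)); [exact: H|rlra].
- by move=> x; exact: H.
- by apply: nm1_sup => [|x]; [exact: L1locB|exact: H].
- by apply: nm1_sup => [|x]; [exact: L1locB|exact: H].
- by apply: nm1_sup => [|x]; [exact: L1locB|exact: H].
Qed.

Lemma state_space_bdd z r : state_space z -> sle z r -> bdd (Num.max 1 r) (dof z).
Proof.
move=> [oz _] H.
have [lq _] := okd_q oz; have [lw _] := okd_w oz; have [_ _ _ _ [ln _]] := oz.
have H' i : `|z i| <= Num.max 1 r by rewrite le_max H orbT.
by split=> [||| x]; try (by apply: nm1_sup => // x; exact: H'); exact: H'.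
Qed.

(** Beyond size 2 [N0] the field vanishes. Below, all states satisfy one and the same [bdd], so that
    [vf_bd] gives growth linear in the sup norm, which excludes blow-up in finite time. *)
Lemma cutoff_field_growth N0 : 0 < N0 -> exists2 C, 0 <= C & forall z r, state_space z -> sle z r ->
  sle (cutoff_field N0 z) (C * (1 + r)).
Proof.
move=> N00; have m1 : 1 <= Num.max 1 (2 * N0) by rewrite le_max lexx.
have [K K1 HK] := vf_bd m1; exists K; first rlra.
move=> z r [oz pz] hz [c x].
have r0 : 0 <= r := le_trans (normr_ge0 _) (hz (CU, x)).
have Kr : 0 <= K * (1 + r) by rewrite mulr_ge0//; rlra.
rewrite /cutoff_field; have [h|h] := leP (2 * N0) (Nn (dof z)).
  by rewrite theta0// mul0r normr0.
have /andP[t0 t1] := theta_itv N0 (dof z).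
rewrite normrM ger0_norm// -[leRHS]mul1r; apply: ler_pM => //.
apply: HK => //; first by apply: Nn_bdd => //; rewrite le_max (ltW h) orbT.
by case=> // _; exact: hz.
Qed.

Lemma cutoff_field_lip N0 : 1 <= N0 -> forall r, exists2 L, 0 <= L &
  forall z u D, state_space z -> state_space u -> sle z r -> sle u r ->
  (forall i, `|z i - u i| <= D) -> forall i, `|cutoff_field N0 z i - cutoff_field N0 u i| <= L * D.
Proof.
move=> N01 r; have m1 : 1 <= Num.max 1 r by rewrite le_max lexx.
have [K K1 HK] := vf_pt m1; have [K' K'1 HK'] := vf_bd m1.
exists (K * (2 * `|r| + 2) + 1 + 4 * (K' * (1 + `|r|))); first by have := normr_ge0 r; nra.
move=> z u D Az Au zr ur H [c x].
have D0 : 0 <= D := le_trans (normr_ge0 _) (H (CU, x)).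
have cl := state_space_closed H Az Au; have bz := state_space_bdd Az zr; have bu := state_space_bdd Au ur.
have [oz _] := Az; have [ou _] := Au.
have r0 : 0 <= r := le_trans (normr_ge0 _) (zr (CU, x)).
rewrite (ger0_norm r0).
have [h1 h2 h3] := HK _ _ _ oz ou bz bu cl x.
have h4 : `|cmpd c (vf (dof u)) x| <= K' * (1 + r).
  by apply: HK' => //; case=> // _; exact: ur.
have v : `|cmpd c (vf (dof z)) x - cmpd c (vf (dof u)) x| <= (K * (2 * r + 2) + 1) * D.
  have Kr : 0 <= K * r * D by rewrite !mulr_ge0//; rlra.
  have KD : 0 <= K * D by rewrite mulr_ge0//; rlra.
  have hq := zr (CQ, x); have hw := zr (CW, x).
  have dq := H (CQ, x); have dw := H (CW, x); have dn := H (CN, x).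
  have e1 : K * (D * `|qd (dof z) x| + `|qd (dof z) x - qd (dof u) x| + `|nd (dof z) x - nd (dof u) x|)
     <= K * (D * r + D + D).
    rewrite ler_wpM2l//; first exact: le_trans ler01 K1.
    by apply: lerD => //; apply: lerD => //; rewrite ler_wpM2l.
  have e2 : K * (D * `|qd (dof z) x| + D * `|wd (dof z) x| + `|qd (dof z) x - qd (dof u) x|
      + `|wd (dof z) x - wd (dof u) x|) <= K * (D * r + D * r + D + D).
    rewrite ler_wpM2l//; first exact: le_trans ler01 K1.
    by do 2 (apply: lerD => //); apply: lerD; rewrite ler_wpM2l.
  case: c h4 => _ /=.
  - have := H (CU, x); rewrite /=; rlra.
  - by rewrite -opprD normrN; move: h1; rewrite /=; rlra.
  - by move: dw; rewrite /=; rlra.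
  - by apply: le_trans h2 _; apply: le_trans e1 _; rlra.
  - by apply: le_trans h3 _; apply: le_trans e2 _; rlra.
have /andP[t0 t1] := theta_itv N0 (dof z).
have N00 : 0 < N0 by rlra.
(* [Nn] is a sum of four terms, each moving by at most D, and dividing by [N0] >= 1 does not
   increase the result. *)
have th : `|theta N0 (dof z) - theta N0 (dof u)| <= 4 * D.
  apply: le_trans (clamp_lip _ _) _.
  rewrite (_ : _ - _ = - ((Nn (dof z) - Nn (dof u)) / N0)); last rlra.
  rewrite normrN normrM [`|N0^-1|]gtr0_norm ?invr_gt0// ler_pdivrMr//.
  apply: le_trans (Nn_dist oz ou cl) _.
  by rewrite ler_peMr// mulr_ge0.
rewrite /cutoff_field /=; set vz := cmpd c (vf (dof z)) x in v *; set vu := cmpd c (vf (dof u)) x in v h4 *.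
rewrite (_ : _ - _ = theta N0 (dof z) * (vz - vu) + (theta N0 (dof z) - theta N0 (dof u)) * vu); last rlra.
apply: le_trans (ler_normD _ _) _.
have e3 : `|theta N0 (dof z) * (vz - vu)| <= 1 * ((K * (2 * r + 2) + 1) * D).
  by apply: normM_le => //; rewrite ger0_norm.
have e4 := normM_le th h4.
rlra.
Qed.

End thetaflow.

(** * Differential inequalities with an explicit error *)

Section qder.
Context {R : realType}.
Implicit Types (f g : R -> R) (T K : R).

(* A derivative with an explicit error, uniform in s and t, as delivered by
   Euler's scheme; it is stable under the algebraic operations. *)
Definition qder T K f f' := forall s t, 0 <= t -> t <= T -> 0 <= s -> s <= T ->
  [/\ `|f t| <= K, `|f' t| <= K, `|f s - f t| <= K * `|s - t| &
      `|f s - f t - (s - t) * f' t| <= K * (s - t) ^+ 2].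

Lemma qder_mul T K f f' g g' : 0 <= K -> qder T K f f' -> qder T K g g' ->
  qder T (3 * K ^+ 2) (fun t => f t * g t) (fun t => f' t * g t + f t * g' t).
Proof.
move=> K0 Hf Hg s t t0 tT s0 sT.
have [f1 f2 f3 f4] := Hf s t t0 tT s0 sT; have [g1 g2 g3 g4] := Hg s t t0 tT s0 sT.
have [_ _ _ _] := Hf t s s0 sT t0 tT; have [g1' _ _ _] := Hg t s s0 sT t0 tT.
have [f1' _ _ _] := Hf t s s0 sT t0 tT.
have K2 : 0 <= K ^+ 2 by rewrite sqr_ge0.
have st : `|s - t| * `|s - t| = (s - t) ^+ 2 by rewrite -normrM -expr2 ger0_norm// sqr_ge0.
have h0 := normr_ge0 (s - t); have sq0 := sqr_ge0 (s - t).
split.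
- by have := normM_le f1 g1; nra.
- apply: le_trans (ler_normD _ _) _.
  by have := normM_le f2 g1; have := normM_le f1 g2; nra.
- rewrite (_ : _ - _ = (f s - f t) * g s + f t * (g s - g t)); last rlra.
  apply: le_trans (ler_normD _ _) _.
  have := normM_le f3 g1'; have := normM_le f1 g3.
  have : 0 <= K ^+ 2 * `|s - t| by rewrite mulr_ge0.
  rlra.
- rewrite (_ : _ - _ - _ = (f s - f t - (s - t) * f' t) * g s
    + f t * (g s - g t - (s - t) * g' t) + (s - t) * (f' t * (g s - g t))); last rlra.
  apply: le_trans (ler_normD _ _) _; apply: le_trans (lerD (ler_normD _ _) (lexx _)) _.
  have e1 := normM_le f4 g1'; have e2 := normM_le f1 g4; have e3 := normM_le f2 g3.
  have e4 := normM_le (lexx `|s - t|) e3.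
  have e5 : `|s - t| * (K * (K * `|s - t|)) = K ^+ 2 * (s - t) ^+ 2 by rewrite -st; rlra.
  rlra.
Qed.

Lemma qder_add T K K' f f' g g' : qder T K f f' -> qder T K' g g' ->
  qder T (K + K') (fun t => f t + g t) (fun t => f' t + g' t).
Proof.
move=> Hf Hg s t t0 tT s0 sT.
have [f1 f2 f3 f4] := Hf s t t0 tT s0 sT; have [g1 g2 g3 g4] := Hg s t t0 tT s0 sT.
split.
- by apply: le_trans (ler_normD _ _) _; apply: lerD.
- by apply: le_trans (ler_normD _ _) _; apply: lerD.
- rewrite (_ : _ - _ = (f s - f t) + (g s - g t)); last rlra.
  by apply: le_trans (ler_normD _ _) _; rewrite [leRHS]mulrDl; apply: lerD.
- rewrite (_ : _ - _ - _ = (f s - f t - (s - t) * f' t) + (g s - g t - (s - t) * g' t)); last rlra.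
  by apply: le_trans (ler_normD _ _) _; rewrite [leRHS]mulrDl; apply: lerD.
Qed.

Lemma qder_opp T K f f' : qder T K f f' -> qder T K (fun t => - f t) (fun t => - f' t).
Proof.
move=> Hf s t t0 tT s0 sT; have [f1 f2 f3 f4] := Hf s t t0 tT s0 sT; split; rewrite ?normrN//.
  by rewrite -opprD normrN.
by rewrite (_ : _ - _ - _ = - (f s - f t - (s - t) * f' t)) ?normrN//; rlra.
Qed.

(** Over a time step dl, f drops at most to (1 - C dl) f minus K dl^2; iterating 2^n times, the
    errors sum to K T dl and vanish in the limit. The steps are taken with x = C dl <= 1/2, where (1
    + 2 x)(1 - x) >= 1 gives 1 - x >= e^(-2 x); this is the factor 2 in the exponent. *)
Lemma qder_lb T K C f f' : 0 <= T -> 0 <= C -> qder T K f f' -> 0 <= f 0 ->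
  (forall t, 0 <= t -> t <= T -> - C * f t <= f' t) -> expR (- (2 * C * T)) * f 0 <= f T.
Proof.
move=> T0 C0 Hf f0 HC.
have K0 : 0 <= K by have [h _ _ _] := Hf 0 0 (lexx _) T0 (lexx _) T0; exact: le_trans h.
have [N HN] : exists N, forall n, (N <= n)%N -> C * (T * dyad n) <= 2^-1.
  have CT : 0 < 2 * (C * T + 1) by rewrite mulr_gt0// ltr_wpDl// mulr_ge0.
  have /cvgrPdist_lt/(_ _ (divr_gt0 ltr01 CT))[N _ HN] :
      (fun n => 2^-1 ^+ n : R) @ \oo --> 0.
    by apply: cvg_expr; rewrite ger0_norm ?invr_ge0// invf_lt1// ltr1n.
  exists N => n Nn; have := HN n Nn; rewrite sub0r normrN (ger0_norm (dyad_ge0 n)) -/(dyad n).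
  have d0 : 0 <= dyad n :> R := dyad_ge0 n.
  rewrite ltr_pdivlMr// => h; have := mulr_ge0 C0 T0; nra.
apply: (@dyad_small _ _ _ (K * T ^+ 2 * 2 ^+ N)) => m.
pose n := (m + N)%N; pose dl := T * dyad n.
have dn0 : 0 < dyad n :> R := dyad_gt0 n.
have dl0 : 0 <= dl by rewrite mulr_ge0// ltW.
have Cdl : C * dl <= 2^-1 by apply: HN; rewrite leq_addl.
have C1 : 0 <= 1 - C * dl by have := mulr_ge0 C0 dl0; rlra.
have pw k : dyad k * 2 ^+ k = 1 :> R by rewrite /dyad -exprMn mulVf// expr1n.
have step k : (k <= 2 ^ n)%N ->
    (1 - C * dl) ^+ k * f 0 - K * dl ^+ 2 * k%:R <= f (k%:R * dl).
  elim: k => [|k IH] kn; first by rewrite expr0 mul1r mulr0 subr0 mul0r.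
  have kT : k.+1%:R * dl <= T.
    have ET : 2 ^+ n * dl = T by have := pw n; rewrite /dl; nra.
    by rewrite -[leRHS]ET; apply: ler_wpM2r => //; rewrite -natrX ler_nat.
  have kT' : k%:R * dl <= T by apply: le_trans kT; rewrite ler_wpM2r// ler_nat.
  have k0 : 0 <= k%:R * dl by rewrite mulr_ge0.
  have k0' : 0 <= k.+1%:R * dl by rewrite mulr_ge0.
  have [_ _ _ h] := Hf _ _ k0 kT' k0' kT.
  have E : k.+1%:R * dl - k%:R * dl = dl by rewrite -natr1; rlra.
  rewrite E in h; have h2 := HC _ k0 kT'; have h3 := IH (ltnW kn).
  move: h; rewrite ler_norml => /andP[h _].
  have h4 := ler_wpM2l C1 h3; have h5 := ler_wpM2l dl0 h2.
  have h6 : 0 <= K * dl ^+ 2 * k%:R by apply: mulr_ge0 => //; apply: mulr_ge0 => //; exact: sqr_ge0.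
  have h7 : 0 <= C * dl * (K * dl ^+ 2 * k%:R) by rewrite mulr_ge0// mulr_ge0.
  have E2 : K * dl ^+ 2 * k.+1%:R = K * dl ^+ 2 * k%:R + K * dl ^+ 2 by rewrite -natr1; rlra.
  rewrite exprS E2; move: h4; set W := _ ^+ k => h4; rlra.
have := step (2 ^ n)%N (leqnn _).
have E : (2 ^ n)%N%:R * dl = T.
  by rewrite natrX /dl mulrCA [_ * dyad n]mulrC pw mulr1.
rewrite E.
have -> : K * dl ^+ 2 * (2 ^ n)%N%:R = K * T * dl.
  by have /= := congr1 (fun z => K * dl * z) E; rlra.
have e1 : K * T * dl <= K * T ^+ 2 * 2 ^+ N * dyad m.
  rewrite /dl /n /dyad exprD -/(dyad m) -/(dyad N).
  have dN : dyad N <= 2 ^+ N :> R.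
    by apply: le_trans (dyad_le1 N) _; rewrite exprn_ege1// ler1n.
  have KT : 0 <= K * T ^+ 2 * dyad m.
    apply: mulr_ge0; last exact: dyad_ge0.
    by apply: mulr_ge0 => //; exact: sqr_ge0.
  have := ler_wpM2l KT dN; rlra.
have e2 : expR (- (2 * C * T)) <= (1 - C * dl) ^+ (2 ^ n).
  have -> : - (2 * C * T) = (2 ^ n)%N%:R * (- (2 * (C * dl))).
    by have /= := congr1 (fun z => C * z) E; rlra.
  rewrite expRM_natl; apply: lerXn2r; rewrite ?nnegrE ?expR_ge0//.
  set x := C * dl in C1 Cdl *; have x0 : 0 <= x := mulr_ge0 C0 dl0.
  have h1 : 1 <= expR (2 * x) * (1 - x).
    apply: (@le_trans _ _ ((1 + 2 * x) * (1 - x))); first by nra.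
    by rewrite ler_wpM2r// expR_ge1Dx.
  have := ler_wpM2l (expR_ge0 (- (2 * x))) h1.
  have e0 : expR (- (2 * x)) * expR (2 * x) = 1 by rewrite -expRD addNr expR0.
  rewrite mulr1 [leRHS]mulrA e0 mul1r => h2; apply: le_trans h2.
  by rewrite ler_expR; rlra.
have := ler_wpM2r f0 e2; rlra.
Qed.

End qder.

(** * Conservation laws, positivity and removal of the cut-off *)

Section curve.
Context {R : realType}.
Local Notation mu := (@lebesgue_measure R).
Implicit Types (d e : data R) (B D x r T K : R).

Lemma qder_cst T c : qder T `|c| (fun=> c) (fun=> 0 : R).
Proof.
move=> s t _ _ _ _; split=> //; first by rewrite normr0.
  by rewrite subrr normr0 mulr_ge0.
rewrite subrr mulr0 subr0 normr0; apply: mulr_ge0 => //; exact: sqr_ge0.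
Qed.

(** [qder_lb] with rate 0 keeps both f - f 0 and its opposite nonnegative. *)
Lemma qder_const T K (f f' : R -> R) : 0 <= T -> qder T K f f' ->
  (forall t, 0 <= t -> t <= T -> f' t = 0) -> f T = f 0.
Proof.
move=> T0 Hf f0.
have H1 := qder_add Hf (@qder_cst T (- f 0)).
have H2 := qder_add (qder_opp Hf) (@qder_cst T (f 0)).
have p1 : 0 <= f 0 - f 0 by rewrite subrr.
have p2 : 0 <= - f 0 + f 0 by rewrite addNr.
have h1 := qder_lb T0 (lexx 0) H1 p1; have h2 := qder_lb T0 (lexx 0) H2 p2.
rewrite subrr mulr0 in h1; rewrite addNr mulr0 in h2.
have {}h1 : 0 <= f T - f 0 by apply: h1 => t t0 tT; rewrite f0// addr0 oppr0 mul0r.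
have {}h2 : 0 <= - f T + f 0 by apply: h2 => t t0 tT; rewrite f0// !oppr0 addr0 mul0r.
by apply/eqP; rewrite eq_le; apply/andP; split; rlra.
Qed.

Definition bddr r d := forall c x, c <> CY -> `|cmpd c d x| <= r.

Lemma theta_curve N0 d0 r : 1 <= N0 -> okd 1 d0 -> perd d0 -> bddr r d0 ->
  (forall x, `|yd d0 x - x| <= r) ->
  exists d : R -> data R, [/\ d 0 = d0, forall t, 0 <= t -> okd 1 (d t) /\ perd (d t) &
   forall T, 0 <= T -> exists2 K, 0 <= K & forall s t c x, 0 <= t -> t <= T -> 0 <= s -> s <= T ->
   [/\ c <> CY -> `|cmpd c (d t) x| <= K, `|theta N0 (d t) * cmpd c (vf (d t)) x| <= K,
     `|cmpd c (d s) x - cmpd c (d t) x| <= K * `|s - t|,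
     `|theta N0 (d s) * cmpd c (vf (d s)) x - theta N0 (d t) * cmpd c (vf (d t)) x| <= K * `|s - t| &
     `|cmpd c (d s) x - cmpd c (d t) x - (s - t) * (theta N0 (d t) * cmpd c (vf (d t)) x)| <= K * (s - t) ^+ 2]].
Proof.
move=> N01 ok0 pd0 bd0 by0; have N00 : 0 < N0 by rlra.
have r0 : 0 <= r := le_trans (normr_ge0 _) (by0 0).
have [C C0 HC] := cutoff_field_growth N00.
have Az : state_space (zof d0) by rewrite /state_space/= zofK.
have zr : sle (zof d0) r.
  move=> [c x]; rewrite /zof/=; case: c; rewrite ?subr0//=.
  - exact: (bd0 CU).
  - exact: (bd0 CQ).
  - exact: (bd0 CW).
  - exact: (bd0 CN).
have fA := flow_A (@state_space_step R N0) (@state_space_lim R) C0 HC (cutoff_field_lip N01) Az zr r0.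
have f0 := flow0 (@state_space_step R N0) C0 HC (cutoff_field_lip N01) Az zr r0.
have fq := flow_quad (@state_space_step R N0) (@state_space_lim R) C0 HC (cutoff_field_lip N01) Az zr r0.
set fl := flow _ _ in fA f0 fq.
exists (fun t => dof (fl t)); split.
- by rewrite f0 zofK.
- by move=> t t0; have := fA t t0.
move=> T T0; have [K K0 HK] := fq T T0; exists K => // s t c x t0 tT s0 sT.
have [h1 h2 h3 h4 h5] := HK s t (c, x) t0 tT s0 sT.
have E s' t' : cmpd c (dof (fl s')) x - cmpd c (dof (fl t')) x = fl s' (c, x) - fl t' (c, x).
  by case: c {h1 h2 h3 h4 h5} => //=; rlra.
split=> //; rewrite ?E//.
by case: c h1 {h2 h3 h4 h5 E}.
Qed.

Definition ident d x := qd d x * nd d x = qd d x ^+ 2 * Ud d x ^+ 2 + wd d x ^+ 2.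

(* On F, int |U_xi| <= (1 + h) / 2 and U^2 y_xi <= nu, so that integrating
   U(0)^2 <= 2 U^2 + (1 + h)^2 / 2 against y_xi bounds U(0)^2 by
   2 h + (1 + h)^2 / 2. *)
Definition size_bound (h : R) : R := 4 + 3 * h + (1 + h) ^+ 2.

Lemma okd_q1 d : okd 1 d -> Int (qd d) 0 1 = 1.
Proof. by move=> [Hy _ py _ _]; rewrite -(ACE _ _ Hy) -{1}[1]add0r py; rlra. Qed.

Lemma Nn_NB d : okd 1 d -> {ae mu, forall x, ident d x} -> {ae mu, forall x, 0 <= qd d x} ->
  {ae mu, forall x, 0 <= nd d x} -> Nn d <= size_bound (nm1 (nd d)).
Proof.
move=> ok Hi Hq Hn; have [lq _] := okd_q ok; have [lw _] := okd_w ok.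
have [Hy HU py pU [ln _]] := ok.
set h := nm1 (nd d); have h0 : 0 <= h := nm1_ge0 ln.
have q1 : nm1 (qd d) = 1.
  rewrite -(okd_q1 ok); apply: Int_ae => //; first exact: L1loc_abs.
  by apply: aeS Hq => x q0; rewrite ger0_norm.
have w1 : nm1 (wd d) <= (1 + h) / 2.
  have -> : (1 + h) / 2 = Int (fun x => 2^-1 * `|qd d x| + 2^-1 * `|nd d x|) 0 1.
    rewrite IntD; [|exact/L1locZ/L1loc_abs|exact/L1locZ/L1loc_abs].
    by rewrite !IntZ; [|exact: L1loc_abs|exact: L1loc_abs]; rewrite -/(nm1 _) -/(nm1 _) q1 -/h; rlra.
  apply: nm1_le => //; first by apply: L1locD; exact/L1locZ/L1loc_abs.
  apply: aeS3 Hi Hq Hn => x i q0 n0; rewrite (ger0_norm q0) (ger0_norm n0).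
  have : `|wd d x| ^+ 2 <= (2^-1 * qd d x + 2^-1 * nd d x) ^+ 2.
    rewrite -normrX ger0_norm ?sqr_ge0//.
    have : 0 <= qd d x ^+ 2 * Ud d x ^+ 2 by rewrite mulr_ge0 ?sqr_ge0.
    have := sqr_ge0 (qd d x - nd d x); move: i; rewrite /ident => i; nra.
  by rewrite ler_pXn2r// nnegrE; rlra.
have U2 : Ud d 0 ^+ 2 <= 2 * h + (1 + h) ^+ 2 / 2.
  have cU := AC_cont HU.
  have l1 : L1loc (fun x => Ud d x ^+ 2 * qd d x) by apply: L1locM_cont => //; exact: contX2.
  have : Int (fun x => Ud d 0 ^+ 2 * qd d x) 0 1 <=
    Int (fun x => 2 * `|nd d x| + (1 + h) ^+ 2 / 2 * qd d x) 0 1.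
    apply: Int_le => //; first exact: L1locZ.
      by apply: L1locD; [exact/L1locZ/L1loc_abs|exact: L1locZ].
    apply: aeS3 Hi Hq Hn => x i q0 n0; rewrite (ger0_norm n0).
    have qU : qd d x * Ud d x ^+ 2 <= nd d x.
      move: q0; rewrite le_eqVlt => /predU1P[<-|q0]; first by rewrite mul0r.
      rewrite -(ler_pM2l q0) i; have := sqr_ge0 (wd d x); rlra.
    have U0 : Ud d 0 ^+ 2 <= 2 * Ud d x ^+ 2 + (1 + h) ^+ 2 / 2.
      have a : `|Ud d 0 - Ud d x| <= (1 + h) / 2 by exact: le_trans (Ud_bd ok 0 x) w1.
      have : `|Ud d 0 - Ud d x| ^+ 2 <= ((1 + h) / 2) ^+ 2.
        by rewrite ler_pXn2r// nnegrE; rlra.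
      rewrite -normrX ger0_norm ?sqr_ge0// => b.
      have := sqr_ge0 (Ud d x - (Ud d 0 - Ud d x)); nra.
    have := ler_wpM2r q0 U0; rlra.
  rewrite IntZ// (okd_q1 ok) mulr1 IntD; [|exact/L1locZ/L1loc_abs|exact: L1locZ].
  by rewrite !IntZ; [|exact: L1loc_abs|exact: lq]; rewrite (okd_q1 ok) -/(nm1 _) -/h; rlra.
have U1 : `|Ud d 0| <= 1 + (2 * h + (1 + h) ^+ 2 / 2).
  have : `|Ud d 0| ^+ 2 <= 2 * h + (1 + h) ^+ 2 / 2 by rewrite -normrX ger0_norm ?sqr_ge0.
  have := sqr_ge0 (`|Ud d 0| - 1); have := sqr_ge0 `|Ud d 0|.
  set a := `|Ud d 0|; set S := (1 + h) ^+ 2; rlra.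
rewrite /Nn /size_bound q1 -/h; have := sqr_ge0 h; rlra.
Qed.

(* the energy density flux: nu_t = (U^3 - 2 P U)_xi *)
Lemma energy_flux d : okd 1 d -> Int (nd (vf d)) 0 1 = 0.
Proof.
move=> ok; have [HP _ pP _] := okd_PQ ok; have [_ HU _ pU _] := ok.
have H2 := ACB (ACM HU (ACM HU HU)) (ACZ 2 (ACM HP HU)).
have E : (fun x => wd d x * (Ud d x * Ud d x) + Ud d x * (wd d x * Ud d x + Ud d x * wd d x) -
     2 * (qd d x * Qd d x * Ud d x + Pd d x * wd d x)) = nd (vf d).
  by apply/funext => x /=; rlra.
rewrite E in H2; rewrite -(ACE _ _ H2) -[1]add0r.
by rewrite (pU 0) (pP 0) !addr0 subrr.
Qed.

Lemma bddr_bdd K d : okd 1 d -> bddr K d -> bdd (Num.max 1 K) d.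
Proof.
move=> ok H; have [lq _] := okd_q ok; have [lw _] := okd_w ok; have [_ _ _ _ [ln _]] := ok.
have H' c x : c <> CY -> `|cmpd c d x| <= Num.max 1 K by move=> /H h; rewrite le_max h orbT.
split; first by apply: nm1_sup => // x; exact: (H' CQ).
- by apply: nm1_sup => // x; exact: (H' CW).
- by apply: nm1_sup => // x; exact: (H' CN).
- by move=> x; exact: (H' CU).
Qed.

(** The components q, w, n of the field are linear in (q, w, n) with coefficients made of U, P and
    Q. Unlike in [vf_bd] there is no constant term, which is what keeps q^2 + w^2 + n^2 away from
    0. *)
Lemma vf_hom B : 1 <= B -> exists2 K, 0 <= K & forall d, okd 1 d -> bdd B d -> forall x c,
  c <> CY -> c <> CU -> `|cmpd c (vf d) x| <= K * (`|qd d x| + `|wd d x| + `|nd d x|).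
Proof.
move=> B1; have [K K1 HK] := PQ_unif B1.
have B0 : 0 <= B by rlra. have K0 : 0 <= K by rlra.
have B2 : 0 <= B ^+ 2 := sqr_ge0 B.
have KB : 0 <= K * B by rewrite mulr_ge0.
exists (1 + B ^+ 2 / 2 + K + 2 * K * B + 3 * B ^+ 2 + 2 * K); first rlra.
move=> d ok bd x c nY nU.
have cl0 : closed_by 0 d d.
  have z (f : R -> R) : nm1 (fun x => f x - f x) <= 0.
    by rewrite /nm1 (_ : (fun x => _) = fun=> 0) ?Int_cst ?mul0r//; apply/funext => z; rewrite subrr normr0.
  by split=> // z'; rewrite subrr normr0.
have [p1 p2 _ _] := HK d d 0 ok ok bd bd cl0 x; have [_ _ _ /(_ x) bU] := bd.
have U2 : `|Ud d x ^+ 2| <= B ^+ 2 by rewrite normrX; apply: lerXn2r; rewrite ?nnegrE.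
have t2 : `|2| = 2 :> R by rewrite ger0_norm.
have t3 : `|3| = 3 :> R by rewrite ger0_norm.
have h2' : `|2^-1| = 2^-1 :> R by rewrite ger0_norm.
have q0 := normr_ge0 (qd d x); have w0 := normr_ge0 (wd d x); have n0 := normr_ge0 (nd d x).
have P1 a : 0 <= a -> [/\ 0 <= B ^+ 2 * a, 0 <= K * a & 0 <= K * B * a].
  by move=> a0; rewrite !mulr_ge0.
have [a1 a2 a3] := P1 _ q0; have [b1 b2 b3] := P1 _ w0; have [c1 c2 c3] := P1 _ n0.
case: c nY nU => // _ _ /=.
- rlra.
- have e1 : `|nd d x / 2| <= `|nd d x| * 2^-1 by apply: normM_le => //; rewrite h2'.
  have e2 : `|(Ud d x ^+ 2 / 2 - Pd d x) * qd d x| <= (B ^+ 2 * 2^-1 + K) * `|qd d x|.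
    apply: normM_le => //; apply: le_trans (ler_normB _ _) _; apply: lerD => //.
    by apply: normM_le => //; rewrite h2'.
  apply: le_trans (ler_normD _ _) _; rlra.
- have e1 : `|- 2 * Qd d x * Ud d x * qd d x| <= 2 * K * B * `|qd d x|.
    by apply: normM_le => //; apply: normM_le => //; apply: normM_le => //; rewrite normrN t2.
  have e2 : `|(3 * Ud d x ^+ 2 - 2 * Pd d x) * wd d x| <= (3 * B ^+ 2 + 2 * K) * `|wd d x|.
    apply: normM_le => //; apply: le_trans (ler_normB _ _) _.
    by apply: lerD; apply: normM_le => //; rewrite ?t2 ?t3.
  apply: le_trans (ler_normD _ _) _; rlra.
Qed.

(** The right-hand side is the time derivative of q^2 + w^2 + n^2 along the field slowed down by th.
    With m = |q| + |w| + |n| it is at least - 2 K m^2, and m^2 is at most 3 times the sum of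
    squares. *)
Lemma coercive_rate B : 1 <= B -> exists2 C, 0 <= C & forall d, okd 1 d -> bdd B d ->
  forall x th, 0 <= th <= 1 ->
  - C * (qd d x * qd d x + (wd d x * wd d x + nd d x * nd d x)) <=
  th * cmpd CQ (vf d) x * qd d x + qd d x * (th * cmpd CQ (vf d) x)
    + (th * cmpd CW (vf d) x * wd d x + wd d x * (th * cmpd CW (vf d) x)
    + (th * cmpd CN (vf d) x * nd d x + nd d x * (th * cmpd CN (vf d) x))).
Proof.
move=> B1; have [K K0 HK] := vf_hom B1; exists (2 * K * 3); first by rlra.
move=> d ok bd x th /andP[t0 t1].
have nU c : c <> CU -> c <> CY -> `|th * cmpd c (vf d) x| <= 1 * (K * (`|qd d x| + `|wd d x| + `|nd d x|)).
  by move=> cU cY; apply: normM_le; [rewrite ger0_norm|exact: HK].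
have h1 := nU CQ ltac:(by []) ltac:(by []).
have h2 := nU CW ltac:(by []) ltac:(by []).
have h3 := nU CN ltac:(by []) ltac:(by []).
move: h1 h2 h3; set m := `|qd d x| + _ + _; move=> h1 h2 h3.
have m1 := normM_le h1 (lexx `|qd d x|); have m2 := normM_le h2 (lexx `|wd d x|).
have m3 := normM_le h3 (lexx `|nd d x|).
have E (a : R) : `|a| * `|a| = a * a by rewrite -normrM ger0_norm// -expr2 sqr_ge0.
have mm : K * m * m <= K * (3 * (qd d x * qd d x + (wd d x * wd d x + nd d x * nd d x))).
  rewrite -mulrA ler_wpM2l// /m -(E (qd d x)) -(E (wd d x)) -(E (nd d x)).
  have := sqr_ge0 (`|qd d x| - `|wd d x|); have := sqr_ge0 (`|qd d x| - `|nd d x|).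
  have := sqr_ge0 (`|wd d x| - `|nd d x|); rlra.
have mE : K * m * m = K * m * `|qd d x| + K * m * `|wd d x| + K * m * `|nd d x| by rewrite /m; rlra.
move: m1 m2 m3; rewrite !ler_norml => /andP[? _] /andP[? _] /andP[? _].
rlra.
Qed.

Definition cocd c d := forall x, [/\ ident d x, 0 <= qd d x, 0 <= nd d x & c <= qd d x + nd d x].

Lemma global_curve d0 r c : okd 1 d0 -> perd d0 -> bddr r d0 ->
  (forall x, `|yd d0 x - x| <= r) -> 0 < c -> cocd c d0 ->
  exists d : R -> data R, [/\ d 0 = d0,
   forall t, 0 <= t -> [/\ okd 1 (d t), perd (d t), exists2 c', 0 < c' & cocd c' (d t) &
     nm1 (nd (d t)) = nm1 (nd d0)] &
   forall T, 0 <= T -> exists2 K, 0 <= K & forall s t c x, 0 <= t -> t <= T -> 0 <= s -> s <= T ->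
   [/\ c <> CY -> `|cmpd c (d t) x| <= K, `|cmpd c (vf (d t)) x| <= K,
     `|cmpd c (d s) x - cmpd c (d t) x| <= K * `|s - t|,
     `|cmpd c (vf (d s)) x - cmpd c (vf (d t)) x| <= K * `|s - t| &
     `|cmpd c (d s) x - cmpd c (d t) x - (s - t) * cmpd c (vf (d t)) x| <= K * (s - t) ^+ 2]].
Proof.
move=> ok0 pd0 bd0 by0 c0 co0.
have [_ _ _ _ [ln0 _]] := ok0.
set h := nm1 (nd d0); have h0 : 0 <= h := nm1_ge0 ln0.
have N01 : 1 <= size_bound h by rewrite /size_bound; have := sqr_ge0 (1 + h); rlra.
have [d [d0E okpd Hq]] := theta_curve N01 ok0 pd0 bd0 by0.
pose th t := theta (size_bound h) (d t).
have qd5 T : 0 <= T -> exists2 K, 0 <= K & forall x c, c <> CY ->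
    qder T K (fun t => cmpd c (d t) x) (fun t => th t * cmpd c (vf (d t)) x).
  move=> T0; have [K K0 HK] := Hq T T0; exists K => // x c' cn s t t0 tT s0 sT.
  by have [h1 h2 h3 _ h5] := HK s t c' x t0 tT s0 sT; split=> //; exact: h1.
(* The derivative of q n - q^2 U^2 - w^2 along the field cancels algebraically, whatever the values
   of P, Q and the cut-off. *)
have Hid t x : 0 <= t -> ident (d t) x.
  move=> t0; have [K K0 HK] := qd5 t t0.
  have nU : CU <> CY by []. have nQ : CQ <> CY by []. have nW : CW <> CY by []. have nN : CN <> CY by [].
  have HU := HK x CU nU; have HQ := HK x CQ nQ; have HW := HK x CW nW; have HN := HK x CN nN.
  pose K2 := 3 * K ^+ 2; have K20 : 0 <= K2 by rewrite mulr_ge0// sqr_ge0.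
  have QN := qder_mul K0 HQ HN; have QU := qder_mul K0 HQ HU; have WW := qder_mul K0 HW HW.
  have QUQU := qder_mul K20 QU QU.
  have := qder_const t0 (qder_add QN (qder_opp (qder_add QUQU WW))).
  have [I0 _ _ _] := co0 x; rewrite d0E /= => H.
  suff : qd (d t) x * nd (d t) x - (qd (d t) x * Ud (d t) x * (qd (d t) x * Ud (d t) x)
      + wd (d t) x * wd (d t) x) = 0 by rewrite /ident; rlra.
  rewrite H; first by move: I0; rewrite /ident; rlra.
  by move=> s _ _; rlra.
pose S t x := qd (d t) x * qd (d t) x + (wd (d t) x * wd (d t) x + nd (d t) x * nd (d t) x).
(* Initially q^2 + n^2 >= (q + n)^2 / 2 >= c^2 / 2, and [coercive_rate] limits the decay at a rate
   independent of x. *)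
have Hpos T : 0 <= T -> exists2 c', 0 < c' & forall t x, 0 <= t -> t <= T -> c' <= S t x.
  move=> T0; have [K K0 HK] := Hq T T0.
  have m1 : 1 <= Num.max 1 K by rewrite le_max lexx.
  have [C C0 HC] := coercive_rate m1.
  exists (expR (- (2 * C * T)) * (c ^+ 2 / 2)).
    by rewrite mulr_gt0 ?expR_gt0// divr_gt0// exprn_gt0.
  move=> t x t0 tT; have [K' K'0 HK'] := qd5 t t0.
  have nQ : CQ <> CY by []. have nW : CW <> CY by []. have nN : CN <> CY by [].
  have HQ := HK' x CQ nQ; have HW := HK' x CW nW; have HN := HK' x CN nN.
  have := qder_lb t0 C0 (qder_add (qder_mul K'0 HQ HQ) (qder_add (qder_mul K'0 HW HW) (qder_mul K'0 HN HN))).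
  have S0 : c ^+ 2 / 2 <= S 0 x.
    have [_ q0 n0 cqn] := co0 x; rewrite /S d0E.
    have := sqr_ge0 (wd d0 x); have := sqr_ge0 (qd d0 x - nd d0 x).
    have : c ^+ 2 <= (qd d0 x + nd d0 x) ^+ 2.
      by clear -c0 q0 n0 cqn; apply: lerXn2r; rewrite ?nnegrE; rlra.
    rlra.
  have S00 : 0 <= S 0 x by apply: le_trans S0; rewrite divr_ge0// sqr_ge0.
  move=> /(_ S00) H.
  apply: le_trans (_ : expR (- (2 * C * t)) * S 0 x <= _).
    apply: ler_pM; rewrite ?expR_ge0 ?divr_ge0 ?sqr_ge0//.
    by rewrite ler_expR lerN2 ler_wpM2l// mulr_ge0.
  apply: H => s s0 st; have sT := le_trans st tT.
  have [oks _] := okpd s s0.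
  apply: HC => //; last exact: theta_itv.
  by apply: bddr_bdd => // c' x' nc; have [h1 _ _ _ _] := HK s s c' x' s0 sT s0 sT; exact: h1.
have qn0 t x : 0 <= t -> 0 <= qd (d t) x * nd (d t) x.
  move=> t0; rewrite (Hid t x t0); apply: addr_ge0; last exact: sqr_ge0.
  by apply: mulr_ge0; exact: sqr_ge0.
(* The identity gives w^2 <= q n, which the cross term 2 q n of the square absorbs. *)
have vS t x : 0 <= t -> S t x <= (qd (d t) x + nd (d t) x) ^+ 2.
  move=> t0; have := qn0 t x t0; have := Hid t x t0; rewrite /ident /S => i.
  have : 0 <= qd (d t) x ^+ 2 * Ud (d t) x ^+ 2 by rewrite mulr_ge0 ?sqr_ge0.
  nra.
(* q + n is Lipschitz in time and its square stays above a positive constant, so it keeps its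
   initial sign. Together with q n >= 0 this makes q and n nonnegative. *)
have vpos t x : 0 <= t -> 0 < qd (d t) x + nd (d t) x.
  move=> t0; have [c' c'0 Hc'] := Hpos t t0; have [K K0 HK] := Hq t t0.
  pose v s := qd (d s) x + nd (d s) x.
  have vlip s s' : 0 <= s -> s <= t -> 0 <= s' -> s' <= t -> `|v s - v s'| <= 2 * K * `|s - s'|.
    move=> s0 st s0' st'.
    have [_ _ h1 _ _] := HK s s' CQ x s0' st' s0 st; have [_ _ h2 _ _] := HK s s' CN x s0' st' s0 st.
    rewrite (_ : v s - v s' = (qd (d s) x - qd (d s') x) + (nd (d s) x - nd (d s') x)); last by rewrite /v; rlra.
    apply: le_trans (ler_normD _ _) _; move: h1 h2; rewrite /=; rlra.
  apply: (@real_induction _ (fun s => 0 < v s) 0 t) => //.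
  - by have [_ q0 n0 cqn] := co0 x; rewrite /v d0E; rlra.
  - move=> s /andP[s0 st] vs; pose dl := v s / (2 * K + 1).
    have K1 : 0 < 2 * K + 1 by rlra.
    exists dl; first exact: divr_gt0.
    move=> s' ss' s'd s't.
    have := vlip s' s (le_trans s0 (ltW ss')) s't s0 (ltW st).
    rewrite [`|s' - s|]gtr0_norm ?subr_gt0// ler_norml => /andP[hh _].
    have e : dl * (2 * K + 1) = v s by rewrite divfK// gt_eqF.
    have : 2 * K * (s' - s) <= 2 * K * dl.
      by clear -s'd K0; apply: ler_wpM2l; rlra.
    have : 0 < dl by exact: divr_gt0.
    rlra.
  - move=> s /andP[s0 st] Hs.
    have vs2 := le_trans (Hc' s x (ltW s0) st) (vS s x (ltW s0)).
    rewrite -/(v s) in vs2 *; rewrite ltNge; apply/negP => vs.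
    have vs' : v s < 0.
      rewrite lt_neqAle vs andbT; apply/eqP => e; move: vs2; rewrite e expr0n/=; rlra.
    have K1 : 0 < 2 * K + 1 by rlra.
    pose dl := - v s / (2 * K + 1).
    have dl0 : 0 < dl by rewrite divr_gt0// oppr_gt0.
    pose s' := Num.max 0 (s - dl).
    have s'0 : 0 <= s' by rewrite le_max lexx.
    have s's : s' < s by rewrite gt_max s0/=; rlra.
    have s'd : s - dl <= s' by rewrite le_max lexx orbT.
    have := Hs s' (introT andP (conj s'0 s's)).
    have := vlip s s' (ltW s0) st s'0 (le_trans (ltW s's) st).
    rewrite [`|s - s'|]gtr0_norm ?subr_gt0// ler_norml => /andP[hh _].
    have e : dl * (2 * K + 1) = - v s by rewrite divfK// gt_eqF.
    have : 2 * K * (s - s') <= 2 * K * dl.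
      by clear -s'd K0; apply: ler_wpM2l; rlra.
    rlra.
have nn t x : 0 <= t -> 0 <= qd (d t) x /\ 0 <= nd (d t) x.
  by move=> t0; have := vpos t x t0; have := qn0 t x t0; move: (qd _ _) (nd _ _) => a b h1 h2; split; rewrite leNgt; apply/negP => h3; nra.
have coc t : 0 <= t -> exists2 c', 0 < c' & cocd c' (d t).
  move=> t0; have [c' c'0 Hc'] := Hpos t t0.
  exists (Num.min 1 c'); first by rewrite lt_min ltr01.
  move=> x; have [q0 n0] := nn t x t0; split=> //; first exact: Hid.
  have := le_trans (Hc' t x t0 (lexx _)) (vS t x t0); have := vpos t x t0.
  move: (_ + _) => v v0 hh; rewrite ge_min; have [v1|v1] := leP 1 v; first by [].
  by apply/orP; right; nra.
have nmI t : 0 <= t -> nm1 (nd (d t)) = Int (nd (d t)) 0 1.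
  by move=> t0; congr Int; apply/funext => x; have [_ n0] := nn t x t0; rewrite ger0_norm.
(* The cut-off does not depend on x, so it leaves the integral and [energy_flux] makes the
   derivative of the total energy vanish. *)
have energy t : 0 <= t -> nm1 (nd (d t)) = h.
  move=> t0; have -> : h = nm1 (nd (d 0)) by rewrite d0E.
  rewrite !nmI//; have [K K0 HK] := Hq t t0.
  apply: (@qder_const t K (fun t => Int (nd (d t)) 0 1) (fun=> 0)) => //.
  move=> s u u0 ut s0 st.
  have [oku _] := okpd u u0; have [oks _] := okpd s s0.
  have [_ _ _ _ [lu _]] := oku; have [_ _ _ _ [ls _]] := oks.
  have [_ _ _ _ [lv _]] := okd_vf oku.
  have nN : CN <> CY by [].
  have ib (f : R -> R) k : L1loc f -> (forall x, `|f x| <= k) -> `|Int f 0 1| <= k.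
    by move=> lf H; apply: le_trans (Int_abs lf ler01) _; exact: nm1_sup.
  split.
  - by apply: ib => // x; have [h1 _ _ _ _] := HK s u CN x u0 ut s0 st; exact: h1.
  - by rewrite normr0.
  - rewrite -IntB//; apply: ib; first exact: L1locB.
    by move=> x; have [_ _ h1 _ _] := HK s u CN x u0 ut s0 st.
  - have lz := L1locZ (s - u) (L1locZ (th u) lv).
    have z0 : Int (fun x => (s - u) * (th u * nd (vf (d u)) x)) 0 1 = 0.
      by rewrite IntZ ?IntZ ?energy_flux ?mulr0//; exact: L1locZ.
    rewrite mulr0 -[X in _ - X]z0 -!IntB//; last exact: L1locB.
    apply: ib; first by apply: L1locB => //; exact: L1locB.
    by move=> x; have [_ _ _ _ h1] := HK s u CN x u0 ut s0 st.
(* [size_bound h] was taken as cut-off level because the conserved identity, signs and energy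
   confine [Nn] below it by [Nn_NB]. *)
have th1 t : 0 <= t -> theta (size_bound h) (d t) = 1.
  move=> t0; apply: theta1; first rlra.
  have [okt _] := okpd t t0.
  rewrite -(energy t t0); apply: Nn_NB => //; apply: aeT => x.
  - exact: Hid.
  - by have [] := nn t x t0.
  - by have [] := nn t x t0.
exists d; split=> //.
  by move=> t t0; have [okt pt] := okpd t t0; split=> //; [exact: coc|exact: energy].
move=> T T0; have [K K0 HK] := Hq T T0; exists K => // s t c' x t0 tT s0 sT.
by have := HK s t c' x t0 tT s0 sT; rewrite !th1// !mul1r.
Qed.

End curve.

(** * The norm of E on representatives *)

Section norms.
Context {R : realType}.
Local Notation mu := (@lebesgue_measure R).
Implicit Types (d e : data R) (B D x r T K c : R) (X Y : triple R).

Lemma ae_itv_false (a b : R) : a < b -> ~ {ae mu, forall x, ~ (a <= x <= b)}.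
Proof.
move=> ab H.
have : Int (fun=> 1 : R) a b <= Int (fun=> 0 : R) a b.
  by apply: Int_le_aein; [exact: L1loc_cst|exact: L1loc_cst|exact: ltW|apply: aeS H].
by rewrite !Int_cst; rlra.
Qed.

(** A failure at one point would persist, by continuity, on an interval of positive length inside
    [0, 1], which is not a null set. *)
Lemma ae_le_cont (f : R -> R) c : continuous f -> qper 0 f ->
  {ae mu, forall x, 0 <= x <= 1 -> `|f x| <= c} -> forall x, `|f x| <= c.
Proof.
move=> cf pf H x; have [x0 [-> /andP[x00 x01]]] := per_red pf x.
rewrite leNgt; apply/negP => fc.
have e0 : 0 < `|f x0| - c by rlra.
have [dl dl0 Hd] := (contP f).1 cf x0 _ e0.
pose a := Num.max 0 (x0 - dl / 2); pose b := Num.min 1 (x0 + dl / 2).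
have dl0' : 0 < (dl : R) := dl0.
have ab : a < b by rewrite /a /b lt_min !gt_max; repeat (apply/andP; split); rlra.
apply: (ae_itv_false ab); apply: aeS H => z Hz /andP[az zb].
have : 0 <= z <= 1 /\ x0 - dl / 2 <= z <= x0 + dl / 2.
  by move: az zb; rewrite /a /b ge_max le_min => /andP[-> ->] /andP[-> ->].
move=> [/Hz h /andP[h1 h2]].
have : `|z - x0| < dl by rewrite ltr_norml; apply/andP; split; rlra.
move=> /Hd h3; have := ler_normD (f x0 - f z) (f z).
rewrite subrK (distrC (f x0)); rlra.
Qed.

Definition supn (f : R -> R) : R := fine (normLinf f).

Lemma normLinf_le (f : R -> R) c : continuous f -> qper 0 f -> 0 <= c ->
  (normLinf f <= c%:E)%E <-> forall x, `|f x| <= c.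
Proof.
move=> cf pf c0; rewrite /normLinf Lnorm_infP; split=> H.
  apply: ae_le_cont => //; apply: aeS H => x + x01.
  by rewrite patchE mem_set//= in_itv.
by apply: aeT => x; rewrite patchE; case: ifP => _; rewrite ?normr0.
Qed.

Lemma normLinf_fin (f : R -> R) : continuous f -> qper 0 f -> normLinf f \is a fin_num.
Proof.
move=> cf pf; rewrite ge0_fin_numE ?Lnorm_ge0//.
have [M HM] := locbd_cont cf 0 1.
have M0 : 0 <= M by apply: le_trans (normr_ge0 (f 0)) (HM 0 _); rewrite lexx ler01.
apply: (@le_lt_trans _ _ M%:E); last exact: ltry.
apply/normLinf_le => // x; have [x0 [-> h]] := per_red pf x; exact: HM.
Qed.

Lemma supn_ge0 (f : R -> R) : 0 <= supn f.
Proof. by rewrite /supn fine_ge0// Lnorm_ge0. Qed.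

Lemma supn_ub (f : R -> R) : continuous f -> qper 0 f -> forall x, `|f x| <= supn f.
Proof.
move=> cf pf; apply/normLinf_le => //; first exact: supn_ge0.
by rewrite fineK// normLinf_fin.
Qed.

Lemma supn_le (f : R -> R) c : continuous f -> qper 0 f -> 0 <= c ->
  (forall x, `|f x| <= c) -> supn f <= c.
Proof.
move=> cf pf c0 /(normLinf_le cf pf c0).
by rewrite -{1}(fineK (normLinf_fin cf pf)) lee_fin.
Qed.

Lemma normL1E (f : R -> R) : L1loc f -> normL1 f = (nm1 f)%:E.
Proof.
move=> lf; rewrite /normL1 Lnorm1 /nm1 Int_itv//; last exact: L1loc_abs.
rewrite /Rintegral fineK; last first.
  by apply: integrable_fin_num => //; apply: L1loc_int; exact: L1loc_abs.
rewrite [RHS]integral_mkcond; apply: eq_integral => x _.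
by rewrite /= !patchE; case: ifP => // _; rewrite /= normr0.
Qed.

Definition Nd d : R := supn (yd d) + nm1 (qd d) + (supn (Ud d) + nm1 (wd d)) + nm1 (nd d).

(** The continuous components are compared everywhere and nu only a.e.; [okd] then fixes [qd] and
    [wd] up to null sets. *)
Definition rep X d := [/\ yof X = yd d, Uof X = Ud d, L1loc (nuof X) & aeeq (nuof X) (nd d)].

Lemma okd_cont al d : okd al d -> continuous (yd d) /\ continuous (Ud d).
Proof. by case=> /AC_cont + /AC_cont. Qed.

Lemma normV_E (f f' : R -> R) : abscont f f' -> qper 0 f -> normV f = (supn f + nm1 f')%:E.
Proof.
move=> Hf pf; rewrite /normV EFinD; congr (_ + _)%E.
  by rewrite fineK// normLinf_fin//; exact: AC_cont Hf.
have h := wderivE Hf.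
have Wf : W11loc f by apply/W11locP; exists f'.
rewrite normL1E; last exact: AC_L1 (AC_wderiv Wf).
by congr EFin; apply: nm1_ae => //; [exact: AC_L1 (AC_wderiv Wf)|exact: AC_L1 Hf].
Qed.

Lemma rep_norm X d : okd 0 d -> rep X d -> normE X = (Nd d)%:E.
Proof.
move=> [Hy HU py pU [ln pn]] [eY eU lx ex].
rewrite /normE eY eU (normV_E Hy)// (normV_E HU)// (normL1E lx).
by rewrite (nm1_ae lx ln ex) -!EFinD.
Qed.

Lemma rep_E al X d : okd al d -> rep X d -> E X.
Proof.
move=> [Hy HU py pU [ln pn]] [eY eU lx ex].
split.
- split; first by apply/W11locP; exists (qd d); rewrite eY.
  by exists al => x; rewrite eY py.
- split; first by apply/W11locP; exists (wd d); rewrite eU.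
  by move=> x; rewrite eU pU addr0.
- split=> //.
  have h := rlb_ae (rlb_shift 1) ex.
  by apply: aeS3 h ex pn => x -> -> ->.
Qed.

Definition tr d : triple R := ((yd d, Ud d), nd d).

Lemma rep_tr al d : okd al d -> rep (tr d) d.
Proof. by move=> [_ _ _ _ [ln _]]; split=> //; exact: aeeq_refl. Qed.

Definition data_of X := Data (yof X) (Uof X) (wderiv (yof X)) (wderiv (Uof X)) (nuof X).

Lemma E_okd X : E X -> V1 (yof X) -> okd 1 (data_of X) /\ rep X (data_of X).
Proof.
move=> [[Wy _] [WU pU] [ln pn]] [_ py]; split.
  split=> //=; [exact: AC_wderiv|exact: AC_wderiv|].
  by move=> x; rewrite addr0 pU.
by split=> //; exact: aeeq_refl.
Qed.

Lemma rep_sub X Y d e : rep X d -> rep Y e -> rep (X - Y) (subd d e).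
Proof.
move=> [a1 b1 c1 d1] [a2 b2 c2 d2]; split.
- by apply/funext => x; rewrite /= -a1 -a2.
- by apply/funext => x; rewrite /= -b1 -b2.
- exact: L1locB.
- by apply: aeS2 d1 d2 => x /= <- <-.
Qed.

Lemma rep_sc (k : R) X d : rep X d -> rep (k *: X) (scd k d).
Proof.
move=> [a1 b1 c1 d1]; split.
- by apply/funext => x; rewrite /= -a1.
- by apply/funext => x; rewrite /= -b1.
- exact: L1locZ.
- by apply: aeS d1 => x /= <-.
Qed.

Definition eqd d e := [/\ yd d = yd e, Ud d = Ud e, aeeq (qd d) (qd e), aeeq (wd d) (wd e) & aeeq (nd d) (nd e)].

Lemma rep_eqd X d al : rep X d -> okd al d -> eqd (data_of X) d.
Proof.
move=> [a1 b1 c1 d1] [Hy HU _ _ _]; split=> //=.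
  by rewrite a1; exact: wderivE.
by rewrite b1; exact: wderivE.
Qed.

Lemma Qk_ext (y g g' : R -> R) x : continuous y -> L1loc g -> L1loc g' -> aeeq g g' ->
  Qk y g x = Qk y g' x /\ Pk y g x = Pk y g' x.
Proof.
move=> cy lg lg' gg.
have hA : Ak y g x = Ak y g' x.
  rewrite /Ak; congr (_ * _); apply: Int_ae.
  - by apply: L1locM_cont => //; exact/contexp/contN.
  - by apply: L1locM_cont => //; exact/contexp/contN.
  - by apply: aeS gg => z ->.
have hB : Bk y g x = Bk y g' x.
  rewrite /Bk; congr (_ * _); apply: Int_ae.
  - by apply: L1locM_cont => //; exact/contexp/contB1.
  - by apply: L1locM_cont => //; exact/contexp/contB1.
  - by apply: aeS gg => z ->.
by rewrite /Qk /Pk hA hB.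
Qed.

Lemma eqd_vf d e : okd 1 d -> okd 1 e -> eqd d e -> eqd (vf d) (vf e).
Proof.
move=> od oe [ey eU eq ew en]; have [lg pg] := okd_g od; have [lg' pg'] := okd_g oe.
have gg : aeeq (gd d) (gd e) by apply: aeS2 eq en => x; rewrite /gd eU => -> ->.
have [cy _] := okd_cont oe.
have hQ : Qd d = Qd e by apply/funext => x; rewrite /Qd ey; have [->] := Qk_ext x cy lg lg' gg.
have hP : Pd d = Pd e by apply/funext => x; rewrite /Pd ey; have [_ ->] := Qk_ext x cy lg lg' gg.
split=> //=.
- by apply/funext => x; rewrite hQ.
- by apply: aeS3 eq en ew => x -> -> _; rewrite hP eU.
- by apply: aeS3 eq en ew => x -> _ ->; rewrite hP hQ eU.
Qed.

(** Here [P_kernel] and [Q_kernel] replace the integrals over the whole line by the folded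
    kernels. *)
Lemma vfield_vf X : E X -> V1 (yof X) -> vfield X = tr (vf (data_of X)).
Proof.
move=> EX VX; have [ok _] := E_okd EX VX; have [lg pg] := okd_g ok; have [Hy _ py _ _] := ok.
have hQ x : Q X x = Qd (data_of X) x by exact: (Q_kernel x Hy py lg pg).
have hP x : P X x = Pd (data_of X) x by exact: (P_kernel x Hy py lg pg).
rewrite /vfield /tr /=; congr (_, _, _); apply/funext => x; first by rewrite hQ.
by rewrite hQ hP.
Qed.

Lemma rep_vfield X d : rep X d -> okd 1 d -> rep (vfield X) (vf d).
Proof.
move=> rX od; have EX := rep_E od rX.
have VX : V1 (yof X).
  have [[Wy _] _ _] := EX; split=> //; have [-> _ _ _] := rX.
  by have [_ _ py _ _] := od.
have [ok rd] := E_okd EX VX; have [h1 h2 _ _ h5] := eqd_vf ok od (rep_eqd rX od).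
rewrite (vfield_vf EX VX); split=> //.
by have [_ _ _ _ [l _]] := okd_vf ok.
Qed.

Lemma Nd_ge0 al d : okd al d -> 0 <= Nd d.
Proof.
move=> ok; have [lq _] := okd_q ok; have [lw _] := okd_w ok; have [_ _ _ _ [ln _]] := ok.
have := nm1_ge0 lq; have := nm1_ge0 lw; have := nm1_ge0 ln.
have := supn_ge0 (yd d); have := supn_ge0 (Ud d); rewrite /Nd; rlra.
Qed.

Lemma supnD (f g : R -> R) : continuous f -> continuous g -> qper 0 f -> qper 0 g ->
  supn (fun x => f x + g x) <= supn f + supn g.
Proof.
move=> cf cg pf pg; apply: supn_le.
- by move=> x; apply: cvgD; [exact: cf|exact: cg].
- by move=> x; rewrite pf pg; rlra.
- by rewrite addr_ge0 ?supn_ge0.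
- by move=> x; apply: le_trans (ler_normD _ _) _; apply: lerD; exact: supn_ub.
Qed.

Lemma NdD d e : okd 0 d -> okd 0 e -> Nd (addd d e) <= Nd d + Nd e.
Proof.
move=> od oe; have [lq _] := okd_q od; have [lw _] := okd_w od; have [_ _ py pU [ln _]] := od.
have [lq' _] := okd_q oe; have [lw' _] := okd_w oe; have [_ _ py' pU' [ln' _]] := oe.
have [cy cU] := okd_cont od; have [cy' cU'] := okd_cont oe.
have := supnD cy cy' py py'; have := supnD cU cU' pU pU'.
have := nm1D lq lq'; have := nm1D lw lw'; have := nm1D ln ln'.
by rewrite /Nd /=; rlra.
Qed.

Lemma NdZ k d : okd 0 d -> Nd (scd k d) <= `|k| * Nd d.
Proof.
move=> od; have [lq _] := okd_q od; have [lw _] := okd_w od; have [_ _ py pU [ln _]] := od.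
have [cy cU] := okd_cont od.
have S (f : R -> R) : continuous f -> qper 0 f -> supn (fun x => k * f x) <= `|k| * supn f.
  move=> cf pf; apply: supn_le.
  - exact: contZ.
  - by move=> x; rewrite pf; rlra.
  - by rewrite mulr_ge0// supn_ge0.
  - by move=> x; rewrite normrM ler_wpM2l// supn_ub.
have := S _ cy py; have := S _ cU pU.
by rewrite /Nd /= !nm1Z//; rlra.
Qed.

Lemma Nd_closed d e : okd 1 d -> okd 1 e -> closed_by (Nd (subd d e)) d e.
Proof.
move=> od oe; have os := okd_sub od oe; rewrite subrr in os.
have [lq _] := okd_q os; have [lw _] := okd_w os; have [_ _ py pU [ln _]] := os.
have [cy cU] := okd_cont os.
have := nm1_ge0 lq; have := nm1_ge0 lw; have := nm1_ge0 ln.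
have := supn_ge0 (yd (subd d e)); have := supn_ge0 (Ud (subd d e)).
rewrite /Nd => h1 h2 h3 h4 h5; split.
- by move=> x; have := supn_ub cy py x; rewrite /=; rlra.
- by move=> x; have := supn_ub cU pU x; rewrite /=; rlra.
- by rewrite /= in h5 *; rlra.
- by rewrite /= in h5 *; rlra.
- by rewrite /= in h5 *; rlra.
Qed.

Lemma Nd_le d b : okd 0 d -> 0 <= b -> (forall (i : cmp) (x : R), `|cmpd i d x| <= b) -> Nd d <= 5 * b.
Proof.
move=> od b0 H; have [lq _] := okd_q od; have [lw _] := okd_w od; have [_ _ py pU [ln _]] := od.
have [cy cU] := okd_cont od.
have := supn_le cy py b0 (H CY); have := supn_le cU pU b0 (H CU).
have := nm1_sup lq (H CQ); have := nm1_sup lw (H CW); have := nm1_sup ln (H CN).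
by rewrite /Nd; rlra.
Qed.

(** [vf_pt] is integrated over a period: the weights |q| and |w| contribute their L^1 norms, which
    are at most B. *)
Lemma vf_N B : 1 <= B -> exists2 L, 0 <= L & forall d e, okd 1 d -> okd 1 e ->
  bdd B d -> bdd B e -> Nd (subd (vf d) (vf e)) <= L * Nd (subd d e).
Proof.
move=> B1; have [K K1 HK] := vf_pt B1.
exists (2 + K + K * (B + 2) + K * (2 * B + 2)); first nra.
move=> d e od oe bd be; set D := Nd (subd d e).
have cl := Nd_closed od oe; rewrite -/D in cl.
have H := HK d e D od oe bd be cl.
have os : okd 0 (subd d e) by have := okd_sub od oe; rewrite subrr.
have ov : okd 0 (subd (vf d) (vf e)) by have := okd_sub (okd_vf od) (okd_vf oe); rewrite subrr.
have D0 : 0 <= D := Nd_ge0 os.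
have [cy cU cq cw cn] := cl.
have [lq _] := okd_q od; have [lw _] := okd_w od; have [_ _ _ _ [ln _]] := od.
have [lqs _] := okd_q os; have [lws _] := okd_w os; have [_ _ _ _ [lns _]] := os.
have [lqv _] := okd_q ov; have [lwv _] := okd_w ov; have [_ _ pyv pUv [lnv _]] := ov.
have [cyv cUv] := okd_cont ov.
have [bq bw bn _] := bd.
have K0 : 0 <= K by rlra.
have h1 : supn (yd (subd (vf d) (vf e))) <= D by apply: supn_le.
have h2 : supn (Ud (subd (vf d) (vf e))) <= K * D.
  apply: supn_le => //; first exact: mulr_ge0.
  by move=> x; have [h _ _] := H x; rewrite /= -opprD normrN.
have h3 : nm1 (qd (subd (vf d) (vf e))) <= D by exact: cw.
have la := L1loc_abs.
have h4 : nm1 (wd (subd (vf d) (vf e))) <= K * (D * B + D + D).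
  apply: le_trans (nm1_le (g := fun x => K * (D * `|qd d x| + `|qd d x - qd e x| + `|nd d x - nd e x|)) _ _ _) _ => //.
  - by apply/L1locZ/L1locD; [apply: L1locD; [exact/L1locZ/la|exact: la]|exact: la].
  - by apply: aeT => x; have [_ h _] := H x.
  rewrite IntZ; last by apply/L1locD; [apply: L1locD; [exact/L1locZ/la|exact: la]|exact: la].
  rewrite ler_wpM2l// IntD; [|by apply: L1locD; [exact/L1locZ/la|exact: la]|exact: la].
  rewrite IntD; [|exact/L1locZ/la|exact: la]; rewrite IntZ; last exact: la.
  by apply: lerD => //; apply: lerD => //; rewrite ler_wpM2l.
have h5 : nm1 (nd (subd (vf d) (vf e))) <= K * (D * B + D * B + D + D).
  have lz1 : L1loc (fun x => D * `|qd d x| + D * `|wd d x|).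
    by apply: L1locD; exact/L1locZ/la.
  have lz2 : L1loc (fun x => D * `|qd d x| + D * `|wd d x| + `|qd d x - qd e x|).
    by apply: L1locD => //; exact: la.
  have lz3 : L1loc (fun x => D * `|qd d x| + D * `|wd d x| + `|qd d x - qd e x| + `|wd d x - wd e x|).
    by apply: L1locD => //; exact: la.
  apply: le_trans (nm1_le (g := fun x => K * (D * `|qd d x| + D * `|wd d x| + `|qd d x - qd e x|
      + `|wd d x - wd e x|)) _ _ _) _ => //.
  - exact: L1locZ.
  - by apply: aeT => x; have [_ _ h] := H x.
  rewrite IntZ// ler_wpM2l// IntD//; last exact: la.
  rewrite IntD//; last exact: la.
  rewrite IntD; [|exact/L1locZ/la|exact/L1locZ/la]; rewrite !IntZ; [|exact: la|exact: la].
  by do 2 (apply: lerD => //); apply: lerD; rewrite ler_wpM2l.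
rewrite /Nd; rlra.
Qed.

End norms.

(** * Gronwall's lemma and uniqueness *)

Section curves.
Context {R : realType}.
Local Notation mu := (@lebesgue_measure R).
Implicit Types (d e : data R) (B D x r T K c L : R) (X Y : triple R).

(** D will be a norm along a curve, not differentiable in general, so increments are bounded
    instead. The comparison function carries an extra slope eta that absorbs eps; in the end eta
    tends to 0. *)
Lemma gronwall (D : R -> R) L T : 0 <= L -> 0 <= T -> (forall t, 0 <= D t) ->
  (forall t eps, 0 <= t <= T -> 0 < eps -> exists2 dl : R, 0 < dl &
    forall s, 0 <= s <= T -> `|s - t| < dl -> `|D s - D t| <= `|s - t| * (L * D t + eps)) ->
  D T <= expR (L * T) * D 0.
Proof.
move=> L0 T0 D0 HD.
have key eta : 0 < eta -> D T <= expR (L * T) * (D 0 + eta * T).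
  move=> e0; apply: (@real_induction _ (fun t => D t <= expR (L * t) * (D 0 + eta * t)) 0 T) => //.
  - by rewrite !mulr0 expR0 addr0 mul1r.
  - move=> t /andP[t0 tT] Ht; have tt : 0 <= t <= T by rewrite t0 ltW.
    have [dl dl0 H] := HD t eta tt e0; exists dl => // s ts sd sT.
    have hs : `|s - t| = s - t by rewrite ger0_norm//; rlra.
    have : `|D s - D t| <= (s - t) * (L * D t + eta).
      by rewrite -hs; apply: H; rewrite ?hs; [apply/andP; split|]; rlra.
    move=> /(le_trans (ler_norm _)) h.
    have Ee : expR (L * s) = expR (L * t) * expR (L * (s - t)) by rewrite -expRD; congr expR; rlra.
    have E1 : 1 <= expR (L * t) by rewrite -expR0 ler_expR mulr_ge0.
    have E2 : 1 + L * (s - t) <= expR (L * (s - t)) by exact: expR_ge1Dx.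
    rewrite Ee; set A := expR (L * t) in Ht E1 *; set Z := expR _ in E2 *.
    have Ls : 0 <= L * (s - t) by apply: mulr_ge0 => //; rlra.
    have V0 : 0 <= D 0 + eta * t by apply: addr_ge0 => //; apply: mulr_ge0; rlra.
    have V1 : 0 <= eta * (s - t) by apply: mulr_ge0; rlra.
    have -> : D 0 + eta * s = (D 0 + eta * t) + eta * (s - t) by rlra.
    set V := D 0 + eta * t in Ht V0 *; set W := eta * (s - t) in V1 *.
    have AV : 0 <= A * V by apply: mulr_ge0 => //; rlra.
    have h1 : A * V * (1 + L * (s - t)) <= A * V * Z by exact: ler_wpM2l.
    have h2 : 1 * 1 * W <= A * Z * W.
      by apply: ler_wpM2r => //; apply: ler_pM => //; rlra.
    have h3 : (s - t) * L * D t <= (s - t) * L * (A * V).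
      by apply: ler_wpM2l => //; rewrite mulrC.
    rewrite {}/W in h2 V1 *; rlra.
  - move=> t /andP[t0 tT] Hs; rewrite leNgt; apply/negP => Dt.
    have tt : 0 <= t <= T by rewrite ltW.
    have [dl dl0 H] := HD t 1 tt ltr01.
    set Et := expR (L * t) * (D 0 + eta * t) in Dt.
    pose m := L * D t + 1; have m0 : 0 < m by have := mulr_ge0 L0 (D0 t); rewrite /m; rlra.
    (* Stepping back by a changes D by at most a m, less than the excess of D t over [Et], which
       contradicts the bound already known at t - a. *)
    pose a := Num.min (Num.min (dl / 2) t) ((D t - Et) / m / 2).
    have q0 : 0 < (D t - Et) / m by rewrite divr_gt0// subr_gt0.
    have a0 : 0 < a by rewrite /a !lt_min; apply/andP; split; [apply/andP; split|]; rlra.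
    have [a1 a2 a3] : [/\ a <= dl / 2, a <= t & a <= (D t - Et) / m / 2].
      by rewrite /a; split; rewrite !ge_min lexx ?orbT.
    have hs : `|t - a - t| = a by rewrite (_ : t - a - t = - a) ?normrN ?gtr0_norm//; rlra.
    have : `|D (t - a) - D t| <= a * m.
      by rewrite -{2}hs; apply: H; rewrite ?hs; [apply/andP; split|]; rlra.
    rewrite ler_norml => /andP[h _].
    have h1 : D (t - a) <= expR (L * (t - a)) * (D 0 + eta * (t - a)).
      by apply: Hs; apply/andP; split; rlra.
    have h2 : expR (L * (t - a)) * (D 0 + eta * (t - a)) <= Et.
      apply: ler_pM; [exact: expR_ge0|by apply: addr_ge0 => //; apply: mulr_ge0; rlra| |].
        by rewrite ler_expR; apply: ler_wpM2l => //; rlra.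
      by rewrite lerD2l; apply: ler_wpM2l; rlra.
    have h3 : a * m < D t - Et.
      by rewrite -ltr_pdivlMr//; rlra.
    rlra.
rewrite leNgt; apply/negP => H.
pose A := expR (L * T) * (T + 1).
have A0 : 0 < A by apply: mulr_gt0; [exact: expR_gt0|rlra].
pose eta := (D T - expR (L * T) * D 0) / A / 2.
have eta0 : 0 < eta by rewrite /eta; apply: divr_gt0 => //; apply: divr_gt0 => //; rlra.
have := key _ eta0.
have : expR (L * T) * (eta * T) <= eta * A.
  rewrite /A mulrCA; apply: ler_wpM2l; first exact: ltW.
  by apply: ler_wpM2l; [exact: expR_ge0|rlra].
have : eta * A = (D T - expR (L * T) * D 0) / 2.
  by rewrite /eta mulrAC divfK// gt_eqF.
have : 0 <= eta * T by apply: mulr_ge0 => //; exact: ltW.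
have := expR_ge0 (L * T).
rlra.
Qed.

Definition rest (d : R -> data R) s t := subd (subd (d s) (d t)) (scd (s - t) (vf (d t))).

(** Differentiability in E with derivative [vf], stated on the undivided remainder: s = t is then no
    exception, and linear maps such as relabelings carry it over. *)
Definition dcurve (d : R -> data R) := (forall t, 0 <= t -> okd 1 (d t)) /\
  forall t eps, 0 <= t -> 0 < eps -> exists2 dl : R, 0 < dl &
    forall s, 0 <= s -> `|s - t| < dl -> Nd (rest d s t) <= `|s - t| * eps.

Lemma okd_rest (d : R -> data R) s t : dcurve d -> 0 <= t -> 0 <= s -> okd 0 (rest d s t).
Proof.
move=> [ok _] t0 s0; have h1 := okd_sub (ok s s0) (ok t t0).
have := okd_sub h1 (okd_scale (s - t) (okd_vf (ok t t0))).
by rewrite !subrr mulr0 subr0.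
Qed.

Lemma data_ext d e : (forall i x, cmpd i d x = cmpd i e x) -> d = e.
Proof.
case: d => a b c d0 f; case: e => a' b' c' d' f' H.
congr Data; apply/funext => x.
- exact: (H CY).
- exact: (H CU).
- exact: (H CQ).
- exact: (H CW).
- exact: (H CN).
Qed.

Lemma okd_sub0 al d e : okd al d -> okd al e -> okd 0 (subd d e).
Proof. by move=> od oe; have := okd_sub od oe; rewrite subrr. Qed.

Lemma okd_scale0 k d : okd 0 d -> okd 0 (scd k d).
Proof. by move=> od; have := okd_scale k od; rewrite mulr0. Qed.

Lemma okd_add0 d e : okd 0 d -> okd 0 e -> okd 0 (addd d e).
Proof. by move=> od oe; exact: okd_add. Qed.

Lemma NdB d e : okd 0 d -> okd 0 e -> Nd (subd d e) <= Nd d + Nd e.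
Proof.
move=> od oe; have -> : subd d e = addd d (scd (-1) e).
  by apply: data_ext => -[] x /=; rlra.
have := NdD od (okd_scale0 (-1) oe); have := NdZ (-1) oe; rewrite normrN1; rlra.
Qed.

Lemma subd_trans d e f : subd d f = addd (subd e f) (subd d e).
Proof. by apply: data_ext => -[] x /=; rlra. Qed.

Lemma subd_transB d e f : subd e f = subd (subd d f) (subd d e).
Proof. by apply: data_ext => -[] x /=; rlra. Qed.

Lemma subd_scd k d e v : subd d e = addd (subd (subd d e) (scd k v)) (scd k v).
Proof. by apply: data_ext => -[] x /=; rlra. Qed.

(** Read in both directions, the increment W bounds the change of the norm from above and from below
    by the triangle inequality. *)
Lemma subd_step k d d' e e' v w :
  let W := addd (scd k (subd v w)) (subd (subd (subd d' d) (scd k v)) (subd (subd e' e) (scd k w))) in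
  subd d' e' = addd (subd d e) W /\ subd d e = subd (subd d' e') W.
Proof. by split; apply: data_ext => -[] x /=; rlra. Qed.

Lemma dcurve_gronwall B : 1 <= B -> exists2 L, 0 <= L & forall (d e : R -> data R) T, 0 <= T ->
  dcurve d -> dcurve e -> (forall t, 0 <= t <= T -> bdd B (d t) /\ bdd B (e t)) ->
  Nd (subd (d T) (e T)) <= expR (L * T) * Nd (subd (d 0) (e 0)).
Proof.
move=> B1; have [L L0 HL] := vf_N B1; exists L => // d e T T0 cd ce Hb.
have [okd_ Hd] := cd; have [oke He] := ce.
have oks t : 0 <= t -> okd 0 (subd (d t) (e t)) by move=> t0; exact: okd_sub0 (okd_ t t0) (oke t t0).
(* [gronwall] asks for a function nonnegative on the whole line, whereas the states are controlled
   for t >= 0 only. *)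
pose D t := if 0 <= t then Nd (subd (d t) (e t)) else 0.
have := @gronwall D L T L0 T0; rewrite /D T0 lexx; apply => [t|t eps /andP[t0 tT] eps0].
  by case: ifPn => // t0; exact: Nd_ge0 (oks t t0).
have e2 : 0 < eps / 2 by rlra.
have [d1 d10 H1] := Hd t _ t0 e2; have [d2 d20 H2] := He t _ t0 e2.
exists (Num.min d1 d2); first by rewrite lt_min d10.
move=> s /andP[s0 sT]; rewrite lt_min => /andP[s1 s2]; rewrite s0 t0.
have r1 := H1 s s0 s1; have r2 := H2 s s0 s2.
have [bd be] : bdd B (d t) /\ bdd B (e t) by apply: Hb; rewrite t0.
have hv := HL _ _ (okd_ t t0) (oke t t0) bd be.
have o1 := okd_rest cd t0 s0; have o2 := okd_rest ce t0 s0.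
have ov := okd_sub0 (okd_vf (okd_ t t0)) (okd_vf (oke t t0)).
set N1 := Nd (subd (d t) (e t)); set N2 := Nd (subd (d s) (e s)).
pose W := addd (scd (s - t) (subd (vf (d t)) (vf (e t)))) (subd (rest d s t) (rest e s t)).
have oW : okd 0 W by apply: okd_add0; [exact: okd_scale0 ov|exact: (okd_sub0 o1 o2)].
have NW : Nd W <= `|s - t| * (L * N1 + eps).
  apply: le_trans (NdD (okd_scale0 _ ov) (okd_sub0 o1 o2)) _.
  have h1 := NdZ (s - t) ov; have h2 := NdB o1 o2.
  have h3 : `|s - t| * Nd (subd (vf (d t)) (vf (e t))) <= `|s - t| * (L * N1) by exact: ler_wpM2l.
  clear -h1 h2 h3 r1 r2; rlra.
have [E1 E2] := subd_step (s - t) (d t) (d s) (e t) (e s) (vf (d t)) (vf (e t)).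
have g1 : N2 <= N1 + Nd W by rewrite /N2 E1; apply: (NdD (oks t t0) oW).
have g2 : N1 <= N2 + Nd W by rewrite /N1 E2; apply: (NdB (oks s s0) oW).
by clear -g1 g2 NW; rewrite ler_norml; apply/andP; split; rlra.
Qed.

End curves.

(** * Uniqueness of solutions and identification of [St] *)

Section solutions.
Context {R : realType}.
Local Notation mu := (@lebesgue_measure R).
Implicit Types (d e : data R) (B D x r T K c L : R) (X Y : triple R).

(** The primitive of |f| from 0 is nondecreasing and gains nothing over a period, so it vanishes
    identically, and with it its derivative |f| a.e. *)
Lemma nm1_eq0 (f : R -> R) : L1loc f -> aeper f -> nm1 f = 0 -> aeeq f (fun=> 0).
Proof.
move=> lf pf f0; have la := L1loc_abs lf; have pa := aeper_abs pf.
pose F x := Int (fun z => `|f z|) 0 x.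
have pF : qper 0 F.
  move=> x; rewrite /F -(Int_chasles _ 0 x) (aeper_Int x la pa).
  by move: f0; rewrite /nm1 => ->.
have F0 x : F x = 0.
  have [x' [-> /andP[x0 x1]]] := per_red pF x; apply/eqP; rewrite eq_le; apply/andP; split.
    have := Int_chasles (fun z => `|f z|) 0 x' 1.
    have : 0 <= Int (fun z => `|f z|) x' 1 by apply: Int_ge0W.
    by rewrite -/(nm1 f) f0 -/(F x'); rlra.
  by apply: Int_ge0W.
have A1 : abscont (fun=> 0 : R) (fun z => `|f z|).
  by split=> // a b; have := Int_chasles (fun z => `|f z|) 0 a b; rewrite -/(F a) -/(F b) !F0; rlra.
apply: aeS (AC_uniq A1 (AC_cst 0)) => x h; exact: normr0_eq0.
Qed.

Lemma Nd0_rep X al d e : okd al d -> okd al e -> Nd (subd d e) = 0 -> rep X d -> rep X e.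
Proof.
move=> od oe N0 [a b c h]; have os := okd_sub0 od oe.
have [lq _] := okd_q os; have [lw _] := okd_w os; have [_ _ py pU [ln pn]] := os.
have [cy cU] := okd_cont os.
have h1 := nm1_ge0 lq; have h2 := nm1_ge0 lw; have h3 := nm1_ge0 ln.
have h4 := supn_ge0 (yd (subd d e)); have h5 := supn_ge0 (Ud (subd d e)).
have n0 : nm1 (nd (subd d e)) = 0 by rewrite /Nd in N0; rlra.
have y0 : supn (yd (subd d e)) = 0 by rewrite /Nd in N0; rlra.
have u0 : supn (Ud (subd d e)) = 0 by rewrite /Nd in N0; rlra.
split=> //.
- rewrite a; apply/funext => x; have := supn_ub cy py x.
  by rewrite y0 normr_le0 /= subr_eq0 => /eqP.
- rewrite b; apply/funext => x; have := supn_ub cU pU x.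
  by rewrite u0 normr_le0 /= subr_eq0 => /eqP.
- apply: aeS2 h (nm1_eq0 ln pn n0) => x -> /= /eqP.
  by rewrite subr_eq0 => /eqP.
Qed.

Lemma okd_V1 X d : okd 1 d -> rep X d -> V1 (yof X).
Proof.
move=> ok rX; have [[Wy _] _ _] := rep_E ok rX; have [e _ _ _] := rX.
by split=> // x; rewrite e; have [_ _ -> _ _] := ok.
Qed.

Lemma sol_dcurve X0 (X : R -> triple R) : global_solution X0 X -> dcurve (fun t => data_of (X t)).
Proof.
move=> [_ V1X CX].
have ok t : 0 <= t -> okd 1 (data_of (X t)) /\ rep (X t) (data_of (X t)).
  by move=> t0; have [Et _ _ _] := CX t t0; exact: E_okd Et (V1X t t0).
split=> [t /ok[]//|t eps t0 eps0].
have [Et Et' H _] := CX t t0; have [okt rt] := ok t t0.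
pose W s := subd (scd (s - t)^-1 (subd (data_of (X s)) (data_of (X t)))) (vf (data_of (X t))).
have HW s : 0 <= s -> okd 0 (W s) /\ normE ((s - t)^-1 *: (X s - X t) - vfield (X t)) = (Nd (W s))%:E.
  move=> s0; have [oks rs] := ok s s0.
  have oW : okd 0 (W s) by apply: okd_sub0 (okd_vf okt); apply: okd_scale0; exact: okd_sub0 okt.
  by split=> //; apply: rep_norm => //; apply: rep_sub; [exact/rep_sc/rep_sub|exact: rep_vfield].
have he : (0 < eps%:E)%E by rewrite lte_fin.
have := H _ (open_ereal_lt' he); move=> /nbhs_ballP[dl dl0 Hdl]; exists dl => // s s0 sd.
(* The limit of the difference quotients ignores s = t, where the remainder is 0. *)
have [st|st] := eqVneq s t.
  have -> : rest (fun t => data_of (X t)) s t = scd 0 (vf (data_of (X t))).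
    by rewrite st; apply: data_ext => -[] z /=; rlra.
  have := NdZ 0 (okd_vf okt); rewrite st subrr normr0; rlra.
have [oW NW] := HW s s0.
have -> : rest (fun t => data_of (X t)) s t = scd (s - t) (W s).
  have st0 : s - t != 0 by rewrite subr_eq0.
  have Hs (a b : R) : (s - t) * ((s - t)^-1 * a - b) = a - (s - t) * b.
    by rewrite mulrBr mulrA divff// mul1r.
  by apply: data_ext => -[] z /=; rewrite Hs.
apply: le_trans (NdZ _ oW) _; apply: ler_wpM2l => //.
have hb : ball t dl s by rewrite /ball/= distrC.
have hi : `[0, +oo[%classic s by rewrite /= in_itv/= s0.
by have := Hdl s hb st hi; rewrite /= NW lte_fin => /ltW.
Qed.

(** The distance to the initial state is continuous in time, hence bounded on [0, T]; reflecting
    time by |t| makes it a continuous function on the whole line. The bound may depend on the curve,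
    which suffices for uniqueness. *)
Lemma dcurve_bdd (d : R -> data R) T : dcurve d -> 0 <= T ->
  exists2 B, 1 <= B & forall t, 0 <= t <= T -> bdd B (d t).
Proof.
move=> cd T0; have [ok Hd] := cd.
have os (s t : R) : okd 0 (subd (d `|s|) (d `|t|)) by exact: okd_sub0 (ok _ _) (ok _ _).
pose m (t : R) := Nd (subd (d `|t|) (d `|(0:R)|)).
have cm : continuous m.
  apply/contP => t eps eps0.
  have [dl dl0 H] := Hd `|t| 1 (normr_ge0 _) ltr01.
  have V0 := Nd_ge0 (okd_vf (ok `|t| (normr_ge0 _))); set V := Nd _ in V0.
  exists (Num.min dl (eps / (2 + V))); first by rewrite lt_min dl0 divr_gt0//; rlra.
  move=> s; rewrite lt_min => /andP[sd se].
  have ts : `| `|s| - `|t| | <= `|s - t| by exact: ler_dist_dist.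
  have r1 := H `|s| (normr_ge0 _) (le_lt_trans ts sd); rewrite mulr1 in r1.
  have or := okd_rest cd (normr_ge0 t) (normr_ge0 s).
  have ov := okd_vf (ok `|t| (normr_ge0 _)).
  have h1 : Nd (subd (d `|s|) (d `|t|)) <= `|s - t| * (1 + V).
    rewrite (subd_scd (`|s| - `|t|) (d `|s|) (d `|t|) (vf (d `|t|))).
    have h2 := NdD or (okd_scale0 (`|s| - `|t|) ov); have h3 := NdZ (`|s| - `|t|) ov.
    have : `| `|s| - `|t| | * V <= `|s - t| * V by exact: ler_wpM2r.
    rewrite -/V in h3; rlra.
  have h2 : `|s - t| * (1 + V) < eps.
    move: se; rewrite ltr_pdivlMr; last rlra.
    by apply: le_lt_trans; apply: ler_wpM2l => //; rlra.
  have g1 : m s <= m t + Nd (subd (d `|s|) (d `|t|)).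
    by rewrite /m (subd_trans _ (d `|t|)); exact: NdD (os t 0) (os s t).
  have g2 : m t <= m s + Nd (subd (d `|s|) (d `|t|)).
    by rewrite /m (subd_transB (d `|s|)); exact: NdB (os s 0) (os s t).
  by clear -g1 g2 h1 h2; rewrite ltr_norml; apply/andP; split; rlra.
have [K HK] := locbd_cont cm 0 T.
have ok0 := ok _ (normr_ge0 (0:R)).
have [q0 w0 n0 u0] := Nn_bdd ok0 (lexx (Nn (d `|(0:R)|))); set B0 := Nn _ in q0 w0 n0 u0.
exists (Num.max 1 (B0 + K)); first by rewrite le_max lexx.
move=> t tT; have t0 : 0 <= t by case/andP: tT.
have mK : m t <= K by exact: le_trans (ler_norm _) (HK t tT).
have [_ cU cq cw cn] := Nd_closed (ok _ (normr_ge0 t)) ok0.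
rewrite -/(m t) (ger0_norm t0) in cU cq cw cn.
have okt := ok t t0.
have [lq _] := okd_q okt; have [lw _] := okd_w okt; have [_ _ _ _ [ln _]] := okt.
have [lq0 _] := okd_q ok0; have [lw0 _] := okd_w ok0; have [_ _ _ _ [ln0 _]] := ok0.
have tri (f g : R -> R) : L1loc f -> L1loc g -> nm1 f <= nm1 (fun x => f x - g x) + nm1 g.
  move=> lf lg; have := nm1D (L1locB lf lg) lg.
  by congr (_ <= _); congr nm1; apply/funext => x; rewrite subrK.
have t1 := tri _ _ lq lq0; have t2 := tri _ _ lw lw0; have t3 := tri _ _ ln ln0.
suff [h1 h2 h3 h4] : bdd (B0 + K) (d t).
  split; [move: h1|move: h2|move: h3|move=> x; move: (h4 x)]; by rewrite le_max => ->; rewrite orbT.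
split.
- apply: le_trans t1 _; rewrite addrC; apply: lerD => //; exact: le_trans cq mK.
- apply: le_trans t2 _; rewrite addrC; apply: lerD => //; exact: le_trans cw mK.
- apply: le_trans t3 _; rewrite addrC; apply: lerD => //; exact: le_trans cn mK.
move=> x.
have := ler_normD (Ud (d t) x - Ud (d `|(0:R)|) x) (Ud (d `|(0:R)|) x); rewrite subrK.
have := cU x; have := u0 x; clear -mK; rlra.
Qed.

Lemma dcurve_uniq (d e : R -> data R) T : 0 <= T -> dcurve d -> dcurve e ->
  Nd (subd (d 0) (e 0)) = 0 -> Nd (subd (d T) (e T)) = 0.
Proof.
move=> T0 cd ce N0; have [B1 b1 H1] := dcurve_bdd cd T0; have [B2 b2 H2] := dcurve_bdd ce T0.
have bddW B B' d' : B <= B' -> bdd B d' -> bdd B' d'.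
  move=> BB [h1 h2 h3 h4]; split; [rlra|rlra|rlra|move=> x; have := h4 x; rlra].
have bm : 1 <= Num.max B1 B2 by rewrite le_max b1.
have [L L0 HL] := dcurve_gronwall bm.
have : Nd (subd (d T) (e T)) <= expR (L * T) * Nd (subd (d 0) (e 0)).
  apply: HL => // t tT; split.
    by apply: bddW (H1 t tT); rewrite le_max lexx.
  by apply: bddW (H2 t tT); rewrite le_max lexx orbT.
rewrite N0 mulr0 => h; apply/eqP; rewrite eq_le h.
by have [ok _] := cd; have [ok' _] := ce; exact: Nd_ge0 (okd_sub0 (ok T T0) (ok' T T0)).
Qed.

Lemma cvg_rate (u : R -> \bar R) (K dl t : R) : 0 < dl -> 0 <= K ->
  (forall s, 0 <= s -> s != t -> `|s - t| < dl -> exists2 r, u s = r%:E & 0 <= r <= K * `|s - t|) ->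
  u s @[s --> within `[0, +oo[ t^'] --> 0%E.
Proof.
move=> dl0 K0 H.
have near_ (P : R -> Prop) (e : R) : 0 < e -> (forall s, 0 <= s -> s != t -> `|s - t| < e -> P s) ->
    \forall s \near within `[0, +oo[ t^', P s.
  move=> e0 HP; apply/nbhs_ballP; exists e => // s sb st; rewrite /= in_itv/= andbT => s0.
  by apply: HP => //; rewrite distrC.
apply/fine_cvgP; split.
  by apply: (near_ _ dl) => // s s0 st sd; have [r -> _] := H s s0 st sd.
apply/cvgr0Pnorm_lt => eta e0.
have e1 : 0 < Num.min dl (eta / (K + 1)) by rewrite lt_min dl0 divr_gt0//; rlra.
apply: (near_ _ _ e1) => s s0 st; rewrite lt_min => /andP[sd se].
have [r rE /andP[r0 rK]] := H s s0 st sd.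
rewrite /= rE /= ger0_norm//; apply: le_lt_trans rK _.
move: se; rewrite ltr_pdivlMr; last rlra.
by have := normr_ge0 (s - t); rlra.
Qed.

Lemma cvg_rate0 (u : R -> \bar R) (K dl t : R) : 0 < dl -> 0 <= K ->
  (forall s, 0 <= s -> `|s - t| < dl -> exists2 r, u s = r%:E & 0 <= r <= K * `|s - t|) ->
  u s @[s --> within `[0, +oo[ (nbhs t)] --> 0%E.
Proof.
move=> dl0 K0 H.
have near_ (P : R -> Prop) (e : R) : 0 < e -> (forall s, 0 <= s -> `|s - t| < e -> P s) ->
    \forall s \near within `[0, +oo[ (nbhs t), P s.
  move=> e0 HP; apply/nbhs_ballP; exists e => // s sb; rewrite /= in_itv/= andbT => s0.
  by apply: HP => //; rewrite distrC.
apply/fine_cvgP; split.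
  by apply: (near_ _ dl) => // s s0 sd; have [r -> _] := H s s0 sd.
apply/cvgr0Pnorm_lt => eta e0.
have e1 : 0 < Num.min dl (eta / (K + 1)) by rewrite lt_min dl0 divr_gt0//; rlra.
apply: (near_ _ _ e1) => s s0; rewrite lt_min => /andP[sd se].
have [r rE /andP[r0 rK]] := H s s0 sd.
rewrite /= rE /= ger0_norm//; apply: le_lt_trans rK _.
move: se; rewrite ltr_pdivlMr; last rlra.
by have := normr_ge0 (s - t); rlra.
Qed.

(** Existence comes from [global_curve]. [St] picks some global solution, and any two agree in E by
    [dcurve_uniq], so the constructed curve represents the picked one as well. *)
Lemma St_rep X0 d0 r c : rep X0 d0 -> okd 1 d0 -> perd d0 -> bddr r d0 ->
  (forall x, `|yd d0 x - x| <= r) -> 0 < c -> cocd c d0 ->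
  exists d : R -> data R, [/\ d 0 = d0, dcurve d &
   forall t, 0 <= t -> [/\ okd 1 (d t), perd (d t), exists2 c', 0 < c' & cocd c' (d t),
     nm1 (nd (d t)) = nm1 (nd d0) & rep (St t X0) (d t) /\ exists r', bddr r' (d t)]].
Proof.
move=> rX0 ok0 pd0 bd0 by0 c0 co0.
have [d [d0E Hok HK]] := global_curve ok0 pd0 bd0 by0 c0 co0.
have ok t : 0 <= t -> okd 1 (d t) by move=> /Hok[].
have okr (s t : R) : 0 <= t -> 0 <= s -> okd 0 (rest d s t).
  move=> t0 s0; apply: okd_sub0; first exact: okd_sub0 (ok s s0) (ok t t0).
  exact/okd_scale0/okd_vf/ok.
have Nr t : 0 <= t -> exists2 K, 0 <= K & forall s, 0 <= s -> `|s - t| < 1 ->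
    Nd (rest d s t) <= K * (s - t) ^+ 2 /\ Nd (subd (vf (d s)) (vf (d t))) <= K * `|s - t|.
  move=> t0; have t1 : 0 <= t + 1 by rlra.
  have [K K0 H] := HK _ t1; exists (5 * K); first rlra.
  move=> s s0; rewrite ltr_norml => /andP[s1 s2].
  have tt : t <= t + 1 by rlra. have st : s <= t + 1 by rlra.
  split; rewrite -mulrA; apply: Nd_le.
  - exact: okr.
  - by apply: mulr_ge0 => //; exact: sqr_ge0.
  - move=> i x; have [_ _ _ _] := H s t i x t0 tt s0 st.
    by case: i.
  - exact: okd_sub0 (okd_vf (ok s s0)) (okd_vf (ok t t0)).
  - exact: mulr_ge0.
  - move=> i x; have [_ _ _ + _] := H s t i x t0 tt s0 st.
    by case: i.
have cd : dcurve d.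
  split=> // t eps t0 eps0; have [K K0 H] := Nr t t0.
  exists (Num.min 1 (eps / (K + 1))); first by rewrite lt_min ltr01 divr_gt0//; rlra.
  move=> s s0; rewrite lt_min => /andP[s1 s2]; have [h _] := H s s0 s1.
  apply: le_trans h _; rewrite -[X in _ * X]real_normK ?num_real// expr2 mulrA [leRHS]mulrC.
  apply: ler_wpM2r => //.
  by move: s2; rewrite ltr_pdivlMr; [have := normr_ge0 (s - t); rlra|rlra].
(* The initial condition is an equality of triples, while the curve starts from a representative
   that may differ from X0 on a null set. *)
pose X t := if t == 0 then X0 else tr (d t).
have rX t : 0 <= t -> rep (X t) (d t).
  move=> t0; rewrite /X; case: eqVneq => [->|_]; first by rewrite d0E.
  exact: rep_tr (ok t t0).
have gX : global_solution X0 X.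
  split; first by rewrite /X eqxx.
    by move=> t t0; exact: okd_V1 (ok t t0) (rX t t0).
  move=> t t0; have [K K0 H] := Nr t t0; split.
  - exact: rep_E (ok t t0) (rX t t0).
  - exact: rep_E (okd_vf (ok t t0)) (rep_vfield (rX t t0) (ok t t0)).
  - apply: (@cvg_rate _ K 1) => // s s0 st s1; have [h _] := H s s0 s1.
    pose W := scd (s - t)^-1 (rest d s t).
    have oW : okd 0 W by apply: okd_scale0; exact: okr.
    exists (Nd W).
      apply: rep_norm => //.
      have -> : W = subd (scd (s - t)^-1 (subd (d s) (d t))) (vf (d t)).
        have st0 : s - t != 0 by rewrite subr_eq0.
        have Hs (a b : R) : (s - t)^-1 * (a - (s - t) * b) = (s - t)^-1 * a - b.
          by rewrite mulrBr mulrA mulVf// mul1r.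
        by apply: data_ext => -[] z /=; rewrite Hs.
      by apply: rep_sub; [exact/rep_sc/rep_sub/rX/t0/rX|exact: rep_vfield (rX t t0) (ok t t0)].
    rewrite (Nd_ge0 oW)/=; apply: le_trans (NdZ _ (okr s t t0 s0)) _.
    rewrite normfV ler_pdivrMl; last by rewrite normr_gt0 subr_eq0.
    by rewrite mulrCA -expr2 real_normK ?num_real.
  - apply: (@cvg_rate0 _ K 1) => // s s0 s1; have [_ h] := H s s0 s1.
    have o := okd_sub0 (okd_vf (ok s s0)) (okd_vf (ok t t0)).
    exists (Nd (subd (vf (d s)) (vf (d t)))).
      by apply: rep_norm => //; apply: rep_sub; [exact: rep_vfield (rX s s0) (ok s s0)|exact: rep_vfield (rX t t0) (ok t t0)].
    by rewrite (Nd_ge0 o).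
exists d; split=> // t t0; have [okt pt c1 n1] := Hok t t0; split=> //; split; last first.
  have [K K0 H] := HK t t0; exists K => i x ni.
  by have [h _ _ _ _] := H t t i x t0 (lexx _) t0 (lexx _); exact: h.
have gS : global_solution X0 (xget (fun=> X0) (global_solution X0)).
  by apply: xgetPex; exists X.
have cS := sol_dcurve gS; set S := xget _ _ in gS cS *.
have okS := cS.1; have [S0 VS CS] := gS.
have [ES _ _ _] := CS t t0; have [_ rS] := E_okd ES (VS t t0).
apply: (Nd0_rep (okS t t0) okt _ rS); apply: (dcurve_uniq t0 cS cd).
have rS0 : rep (S 0) (d 0) by rewrite S0 d0E.
have ok00 := ok 0 (lexx _); have okS0 := okS 0 (lexx _).
have [ey eU eq ew en] := rep_eqd rS0 ok00.
have o0 := okd_sub0 okS0 ok00.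
have [lq _] := okd_q o0; have [lw _] := okd_w o0; have [_ _ py pU [ln pn]] := o0.
have [cy cU] := okd_cont o0.
have nz (f : R -> R) : L1loc f -> aeeq f (fun=> 0) -> nm1 f = 0.
  move=> lf f0; rewrite (nm1_ae lf (L1loc_cst 0) f0) /nm1 Int_cst normr0; rlra.
have sz (f : R -> R) : (forall x, f x = 0) -> supn f <= 0.
  move=> f0; have -> : f = fun=> 0 by exact/funext.
  by apply: supn_le => // [x|x|x]; [exact: cst_continuous|rlra|rewrite normr0].
have e1 : supn (yd (subd (data_of (S 0)) (d 0))) <= 0 by apply: sz => x; rewrite /= -ey subrr.
have e2 : supn (Ud (subd (data_of (S 0)) (d 0))) <= 0 by apply: sz => x; rewrite /= -eU subrr.
have e3 : nm1 (qd (subd (data_of (S 0)) (d 0))) = 0 by apply: nz => //; apply: aeS eq => x /= ->; rewrite subrr.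
have e4 : nm1 (wd (subd (data_of (S 0)) (d 0))) = 0 by apply: nz => //; apply: aeS ew => x /= ->; rewrite subrr.
have e5 : nm1 (nd (subd (data_of (S 0)) (d 0))) = 0 by apply: nz => //; apply: aeS en => x /= ->; rewrite subrr.
have := supn_ge0 (yd (subd (data_of (S 0)) (d 0))); have := supn_ge0 (Ud (subd (data_of (S 0)) (d 0))).
by rewrite /Nd e3 e4 e5; rlra.
Qed.

End solutions.

(** * Equivariance under relabelings *)

Section relabeling.
Context {R : realType}.
Local Notation mu := (@lebesgue_measure R).
Implicit Types (d e : data R) (B D x r T K c C L : R) (X Y : triple R) (f k : R -> R).

(** The factor f' on [qd] and [wd] is the chain rule. The map is linear in d, so the remainder of a
    relabeled curve is the relabeled remainder. *)
Definition relabel_data f f' d := Data (fun x => yd d (f x)) (fun x => Ud d (f x))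
  (fun x => qd d (f x) * f' x) (fun x => wd d (f x) * f' x) (fun x => nd d (f x) * f' x).

Lemma rlb_aeper f f' g : rlb f f' -> aeper g -> aeper (fun x => g (f x) * f' x).
Proof.
move=> rf pg; have [Hf pf _] := rf.
apply: aeS2 (rlb_ae rf pg) (AC_aeper Hf pf) => x /= h1 h2.
by rewrite pf h1 h2.
Qed.

Lemma okd_rl al f f' d : rlb f f' -> okd al d -> okd al (relabel_data f f' d).
Proof.
move=> rf [Hy HU py pU [ln pn]]; have [_ pf _] := rf; split=> /=.
- exact: rlb_AC.
- exact: rlb_AC.
- by move=> x; rewrite pf py.
- by move=> x; rewrite pf pU.
- by split; [exact: (rlb_int rf ln).1|exact: rlb_aeper].
Qed.

(** f carries [x, x + 1] onto [f x, f x + 1] and g is transported as a density, so the folded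
    integrals are related by substitution. *)
Lemma PQk_rl f f' (y g : R -> R) x : rlb f f' -> continuous y -> L1loc g ->
  Pk (fun z => y (f z)) (fun z => g (f z) * f' z) x = Pk y g (f x) /\
  Qk (fun z => y (f z)) (fun z => g (f z) * f' z) x = Qk y g (f x).
Proof.
move=> rf cy lg; have [_ pf _] := rf.
have hA : Ak (fun z => y (f z)) (fun z => g (f z) * f' z) x = Ak y g (f x).
  rewrite /Ak; congr (_ * _).
  have l : L1loc (fun z => expR (- y z) * g z).
    by apply: L1locM_cont => //; exact/contexp/contN.
  rewrite -pf (rlb_int rf l).2; congr Int; apply/funext => z; exact: mulrA.
have hB : Bk (fun z => y (f z)) (fun z => g (f z) * f' z) x = Bk y g (f x).
  rewrite /Bk; congr (_ * _).
  have l : L1loc (fun z => expR (y z - 1) * g z).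
    by apply: L1locM_cont => //; exact/contexp/contB1.
  rewrite -pf (rlb_int rf l).2; congr Int; apply/funext => z; exact: mulrA.
by rewrite /Pk /Qk hA hB.
Qed.

Lemma vf_rl f f' d : rlb f f' -> okd 1 d -> vf (relabel_data f f' d) = relabel_data f f' (vf d).
Proof.
move=> rf ok; have [lg _] := okd_g ok; have [cy _] := okd_cont ok.
have gE : gd (relabel_data f f' d) = fun x => gd d (f x) * f' x.
  by apply/funext => x; rewrite /gd /=; rlra.
have hP x : Pd (relabel_data f f' d) x = Pd d (f x).
  by rewrite /Pd gE; have [-> _] := PQk_rl x rf cy lg.
have hQ x : Qd (relabel_data f f' d) x = Qd d (f x).
  by rewrite /Qd gE; have [_ ->] := PQk_rl x rf cy lg.
by apply: data_ext => -[] x; rewrite /= ?hP ?hQ; rlra.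
Qed.

Lemma nm1_rl f f' g : rlb f f' -> L1loc g -> aeper g -> nm1 (fun x => g (f x) * f' x) = nm1 g.
Proof.
move=> rf lg pg; have [Hf pf [c [C [c0 H]]]] := rf.
have [l1 h1] := rlb_int rf (L1loc_abs lg).
rewrite /nm1 -(aeper_Int (f 0) (L1loc_abs lg) (aeper_abs pg)) -pf add0r h1.
apply: Int_ae => //; first exact/L1loc_abs/(rlb_int rf lg).1.
apply: aeS H => x /andP[cf _]; rewrite normrM [ `|f' x|]ger0_norm//.
by apply: le_trans cf; exact: ltW.
Qed.

Lemma Nd_rl f f' d : rlb f f' -> okd 0 d -> Nd (relabel_data f f' d) <= Nd d.
Proof.
move=> rf od; have [lq pq] := okd_q od; have [lw pw] := okd_w od; have [_ _ py pU [ln pn]] := od.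
have [cy cU] := okd_cont od; have [cy' cU'] := okd_cont (okd_rl rf od).
have [_ _ py' pU' _] := okd_rl rf od.
rewrite /Nd /= !nm1_rl//; do 2 (apply: lerD => //); apply: lerD => //.
  by apply: supn_le => //; [exact: supn_ge0|move=> x; exact: supn_ub].
by apply: supn_le => //; [exact: supn_ge0|move=> x; exact: supn_ub].
Qed.

Lemma dcurve_rl f f' (d : R -> data R) : rlb f f' -> dcurve d -> dcurve (fun t => relabel_data f f' (d t)).
Proof.
move=> rf cd; have [ok H] := cd; split=> [t t0|t eps t0 eps0]; first exact: okd_rl (ok t t0).
have [dl dl0 Hd] := H t eps t0 eps0; exists dl => // s s0 st.
have -> : rest (fun t => relabel_data f f' (d t)) s t = relabel_data f f' (rest d s t).
  by rewrite /rest vf_rl//; [apply: data_ext => -[] x /=; rlra|exact: ok].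
by apply: le_trans (Nd_rl rf (okd_rest cd t0 s0)) _; exact: Hd.
Qed.

Lemma rep_rl al X d f f' : rlb f f' -> okd al d -> rep X d -> rep (relabel X f) (relabel_data f f' d).
Proof.
move=> rf ok [hy hU lX eX]; have [Hf _ _] := rf; have := okd_rl rf ok => -[_ _ _ _ [ln _]].
have e : aeeq (nuof (relabel X f)) (nd (relabel_data f f' d)).
  by apply: aeS2 (rlb_ae rf eX) (wderivE Hf) => x /= -> ->.
split=> //.
- by apply/funext => x; rewrite /= -hy.
- by apply/funext => x; rewrite /= -hU.
- apply: L1loc_ae ln (aeeq_sym e).
  have [lX' _] := rlb_int rf lX.
  apply: measurable_funM; first exact: measurableT_comp (L1loc_meas lX) (rlb_meas rf).
  by apply: L1loc_meas; apply: AC_L1 (AC_wderiv _); apply/W11locP; exists f'.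
Qed.

(** Membership in F read on data. The upper bound C replaces the L^infinity conditions; by the
    identity it also bounds U_xi^2 <= y_xi nu. *)
Definition good d := [/\ okd 1 d, {ae mu, forall x, ident d x},
  {ae mu, forall x, 0 <= qd d x}, {ae mu, forall x, 0 <= nd d x} &
  exists c C, 0 < c /\ {ae mu, forall x, c <= qd d x + nd d x <= C}].

Lemma good_rl f f' d : rlb f f' -> good d -> good (relabel_data f f' d).
Proof.
move=> rf [ok Hi Hq Hn [c [C [c0 H]]]]; have [Hf pf [b [B [b0 K]]]] := rf.
split; first exact: okd_rl.
- apply: aeS (rlb_ae rf Hi) => x; rewrite /ident /= => h.
  have -> : qd d (f x) * f' x * (nd d (f x) * f' x) = qd d (f x) * nd d (f x) * f' x ^+ 2.
    by rewrite expr2; rlra.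
  by rewrite h !exprMn; rlra.
- apply: aeS2 (rlb_ae rf Hq) K => x h /andP[h1 _]; apply: mulr_ge0 => //; rlra.
- apply: aeS2 (rlb_ae rf Hn) K => x h /andP[h1 _]; apply: mulr_ge0 => //; rlra.
- exists (c * b), (C * B); split; first exact: mulr_gt0.
  apply: aeS2 (rlb_ae rf H) K => x /andP[h1 h2] /andP[h3 h4] /=.
  rewrite -mulrDl; apply/andP; split; apply: ler_pM => //; rlra.
Qed.

Lemma good_bdd M d : good d -> nm1 (nd d) <= M -> bdd (Num.max 1 (size_bound M)) d.
Proof.
move=> [ok Hi Hq Hn _] hM; apply: (Nn_bdd ok); rewrite le_max; apply/orP; right.
apply: le_trans (Nn_NB ok Hi Hq Hn) _.
have [_ _ _ _ [ln _]] := ok; have n0 := nm1_ge0 ln.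
have : (1 + nm1 (nd d)) ^+ 2 <= (1 + M) ^+ 2 by apply: lerXn2r; rewrite ?nnegrE; rlra.
rewrite /size_bound; rlra.
Qed.

Lemma good_bounds d : good d -> exists C, {ae mu, forall x, [/\ `|qd d x| <= C, `|wd d x| <= C & `|nd d x| <= C]}.
Proof.
move=> [ok Hi Hq Hn [c [C [c0 H]]]]; exists C.
have H1 := aeS2 (fun x h1 h2 => conj h1 h2) Hq Hn.
apply: aeS3 Hi H1 H => x hi [q0 n0] /andP[_ hC].
have w2 : wd d x ^+ 2 <= C ^+ 2.
  have := sqr_ge0 (qd d x * Ud d x); rewrite exprMn => hs.
  have h : qd d x * nd d x <= C * C by apply: ler_pM => //; rlra.
  rewrite /ident in hi; rewrite [C ^+ 2]expr2; rlra.
rewrite (ger0_norm q0) (ger0_norm n0); split; try rlra.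
by rewrite -ler_sqr ?nnegrE//; [rewrite real_normK ?num_real|rlra].
Qed.

End relabeling.

(** * Bounded periodic representatives of elements of F *)

Section representatives.
Context {R : realType}.
Local Notation mu := (@lebesgue_measure R).
Implicit Types (d e : data R) (B D x r T K c C L : R) (X Y : triple R) (f k : R -> R).

Lemma Lfun_infP (f : R -> R) : (f : R -> R) \in Lfun mu +oo <->
  measurable_fun setT f /\ exists M, {ae mu, forall x, `|f x| <= M}.
Proof.
have fT : f \_ setT = f by apply/funext => x; rewrite patchE in_setT.
split=> [/andP[mf /set_mem nf]|[mf [M HM]]].
  split; first exact: set_mem mf.
  have [M HM] : exists M, {ae mu, forall x, `|(f \_ setT) x| <= M}.
    by apply: Lnorm_inf_fin; rewrite fT.
  by exists M; move: HM; rewrite fT.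
apply/andP; split; first exact: mem_set.
apply: mem_set; apply: (@le_lt_trans _ _ M%:E); last exact: ltry.
by rewrite -fT; apply/Lnorm_infP; rewrite fT.
Qed.

Lemma F_good X : F X -> good (data_of X) /\ rep X (data_of X).
Proof.
move=> [[EX VX] [Wy WU] /Lfun_infP[_ [K2 HK2]] [Hq Hn [c c0 Hc]] Hi].
have [ok rX] := E_okd EX VX; split=> //; split=> //.
have [Hy _ py _ _] := ok; have [K1 HK1] := qper_Linf py Wy Hy.
exists c, (K1 + K2); split=> //; apply: aeS3 HK1 HK2 Hc => x /= h1 h2 ->/=.
by apply: lerD; [exact: le_trans (ler_norm _) h1|exact: le_trans (ler_norm _) h2].
Qed.

Lemma good_F X d : good d -> rep X d -> F X.
Proof.
move=> gd_ rX; have [ok Hi Hq Hn [c [C [c0 Hc]]]] := gd_.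
have [Hy HU _ _ _] := ok; have [hy hU lX eX] := rX.
have [K HK] := good_bounds gd_.
have [_ _ eq ew _] := rep_eqd rX ok; rewrite /= in eq ew.
split.
- by split; [exact: rep_E ok rX|exact: okd_V1 ok rX].
- rewrite hy hU; split.
    by apply: (@AC_W1infloc _ _ _ K Hy); apply: aeS HK => x [].
  by apply: (@AC_W1infloc _ _ _ K HU); apply: aeS HK => x [].
- apply/Lfun_infP; split; first exact: L1loc_meas.
  by exists K; apply: aeS2 eX HK => x -> [].
- split; first by apply: aeS2 eq Hq => x ->.
    by apply: aeS2 eX Hn => x ->.
  by exists c => //; apply: aeS3 eq eX Hc => x -> -> /andP[].
- by apply: aeS2 (aeS2 (fun x h1 h2 => conj h1 h2) eq ew) (aeS2 (fun x h1 h2 => conj h1 h2) eX Hi) => x [-> ->] [-> h]; rewrite hU.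
Qed.

Lemma aeper_int (g : R -> R) (k : int) : aeper g -> aeeq (fun x => g (x + k%:~R)) g.
Proof.
move=> pg; have nat_ (n : nat) : aeeq (fun x => g (x + n%:R)) g.
  elim: n => [|n IH]; first by apply: aeT => x; rewrite addr0.
  apply: aeS2 (rlb_ae (rlb_shift n%:R) pg) IH => x h <-.
  by rewrite -h -natr1 addrA.
case: k => n; first exact: nat_.
apply: aeS (rlb_ae (rlb_shift (Negz n)%:~R) (nat_ n.+1)) => x.
by rewrite NegzE mulrNz subrK => ->.
Qed.

Lemma measurable_setb (b : R -> bool) : measurable_fun setT b -> measurable [set x | b x].
Proof. by move=> mb; rewrite -[X in measurable X]setTI; exact: (mb measurableT [set true]). Qed.

(** Euler's scheme runs at every xi, so all a.e. conditions, periodicity included, must be made to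
    hold everywhere without changing y and U. *)
Lemma good_everywhere d : good d -> exists d0 r c,
  [/\ eqd d d0, okd 1 d0, perd d0, bddr r d0 & [/\ forall x, `|yd d0 x - x| <= r, 0 < c & cocd c d0]].
Proof.
move=> [ok Hi Hq Hn [c [C [c0 Hc]]]].
have [lq pq] := okd_q ok; have [lw pw] := okd_w ok; have [Hy HU py pU [ln pn]] := ok.
have [cy cU] := okd_cont ok.
pose gp x := [&& qd d x * nd d x == qd d x ^+ 2 * Ud d x ^+ 2 + wd d x ^+ 2,
  0 <= qd d x, 0 <= nd d x, c <= qd d x + nd d x & qd d x + nd d x <= C].
pose sh (k : R) x := [&& qd d (x + k) == qd d x, wd d (x + k) == wd d x & nd d (x + k) == nd d x].
pose Bt (k : R) x := gp (x + k) && sh k x.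
pose b (n : nat) x := Bt n%:R x && Bt (- n%:R) x.
(* The points all of whose integer translates meet the pointwise conditions with the same values of
   q, w, n. S is measurable, of full measure and invariant under integer shifts. *)
pose S := [set x | forall n, b n x].
have mq := L1loc_meas lq; have mw := L1loc_meas lw; have mn := L1loc_meas ln.
have mU : measurable_fun setT (Ud d) := cont_meas cU.
have mX2 (g : R -> R) : measurable_fun setT g -> measurable_fun setT (fun x => g x ^+ 2).
  by move=> mg; exact: (measurable_funX 2 mg).
have mgp : measurable_fun setT gp.
  do ![apply: measurable_and]; [apply: measurable_fun_eqr|apply: measurable_fun_ler|apply: measurable_fun_ler|apply: measurable_fun_ler|apply: measurable_fun_ler]; try exact: measurable_cst.
  - exact: measurable_funM.
  - by apply: measurable_funD; [apply: measurable_funM; exact: mX2|exact: mX2].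
  - exact: mq.
  - exact: mn.
  - exact: measurable_funD.
  - exact: measurable_funD.
have msh (g : R -> R) (k : R) : measurable_fun setT g -> measurable_fun setT (fun x => g (x + k)).
  by move=> mg; apply: measurableT_comp mg (rlb_meas (rlb_shift k)).
have mBt (k : R) : measurable_fun setT (Bt k).
  apply: measurable_and; first exact: (measurableT_comp mgp (rlb_meas (rlb_shift k))).
  by do ![apply: measurable_and]; apply: measurable_fun_eqr => //; exact: msh.
have mS : measurable S.
  have -> : S = \bigcap_n [set x | b n x].
    by apply/seteqP; split=> x h n; [move=> _; exact: h|exact: h].
  by apply: bigcapT_measurable => n; apply: measurable_setb; exact: measurable_and.
have aegp : {ae mu, forall x, gp x}.
  apply: aeS2 (aeS2 (fun x h1 h2 => conj h1 h2) Hi Hc) (aeS2 (fun x h1 h2 => conj h1 h2) Hq Hn).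
  by move=> x [hi /andP[h1 h2]] [h3 h4]; rewrite /gp h1 h2 h3 h4 hi eqxx.
have aeBt (k : int) : {ae mu, forall x, Bt k%:~R x}.
  apply: aeS2 (rlb_ae (rlb_shift k%:~R) aegp) (aeS3 (fun x h1 h2 h3 => And3 h1 h2 h3)
    (aeper_int k pq) (aeper_int k pw) (aeper_int k pn)) => x h [h1 h2 h3].
  by rewrite /Bt h /sh h1 h2 h3 !eqxx.
have aeSs : {ae mu, forall x, S x}.
  apply: ae_foralln => n; have h := aeBt (- n%:Z); rewrite mulrNz in h.
  by apply: aeS2 (aeBt n%:Z) h => x; rewrite /b => -> ->.
have SB x (k : int) : S x -> Bt k%:~R x.
  move=> Sx; case: k => n; first by have /andP[] := Sx n.
  by rewrite NegzE mulrNz; have /andP[] := Sx n.+1.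
have Ss x (k : int) : S x -> S (x + k%:~R).
  move=> Sx; suff h j : Bt j%:~R (x + k%:~R).
    by move=> n; apply/andP; split; [exact: (h n%:Z)|have := h (- n%:Z); rewrite mulrNz].
  have /andP[g1 /and3P[/eqP a1 /eqP a2 /eqP a3]] := SB x (k + j) Sx.
  have /andP[g2 /and3P[/eqP b1 /eqP b2 /eqP b3]] := SB x k Sx.
  by rewrite /Bt /sh -addrA -intrD g1 a1 a2 a3 b1 b2 b3 !eqxx.
have S1 x : S (x + 1) <-> S x.
  split=> [h|h]; last exact: (Ss x 1).
  by have := Ss _ (-1) h; rewrite mulrNz addrK.
pose mix (g g' : R -> R) x := (g \_ S) x + (g' \_ (~` S)) x.
have mixS g g' x : S x -> mix g g' x = g x.
  by move=> h; rewrite /mix !patchE mem_set// memNset ?addr0//; apply: contrapT => /contrapT; apply.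
have mixN g g' x : ~ S x -> mix g g' x = g' x.
  by move=> h; rewrite /mix !patchE memNset// mem_set// add0r.
have mixL g g' : L1loc g -> L1loc g' -> L1loc (mix g g').
  by move=> lg lg'; apply: L1locD; apply: L1loc_patch => //; exact: measurableC.
have mixae g g' : aeeq g (mix g g') by apply: aeS aeSs => x h; rewrite mixS.
have lU : L1loc (fun x => Ud d x ^+ 2) by apply: L1loc_cont; exact: contX2.
(* Off S the values q = 1, w = 0, n = U^2 satisfy the identity, are periodic and have q + n >= 1;
   hence the final constant [Num.min c 1]. *)
pose d0 := Data (yd d) (Ud d) (mix (qd d) (fun=> 1)) (mix (wd d) (fun=> 0)) (mix (nd d) (fun x => Ud d x ^+ 2)).
have pd0 : perd d0.
  move=> x /=; case: (pselect (S x)) => h.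
    have h1 := (S1 x).2 h; rewrite !mixS//.
    by have /andP[_ /and3P[/eqP a1 /eqP a2 /eqP a3]] := SB x 1 h.
  have h1 : ~ S (x + 1) by move/S1.
  by rewrite !mixN// pU addr0.
have ok0 : okd 1 d0.
  split=> //=.
  - by apply: AC_ae Hy _ _; [exact: mixL lq (L1loc_cst 1)|exact: mixae].
  - by apply: AC_ae HU _ _; [exact: mixL lw (L1loc_cst 0)|exact: mixae].
  - by split; [exact: mixL|apply: aeT => x; have [_ _] := pd0 x].
have [K1 HK1] := locbd_cont cU 0 1.
have UK x : `|Ud d x| <= K1 by have [x' [-> h]] := per_red pU x; exact: HK1.
have cyx : continuous (fun x => yd d x - x).
  by move=> x; apply: cvgB; [exact: cy|exact: cvg_id].
have pyx : qper 0 (fun x => yd d x - x) by move=> x; rewrite py; rlra.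
have [K2 HK2] := locbd_cont cyx 0 1.
have yK x : `|yd d x - x| <= K2.
  by have [x' [e h]] := per_red pyx x; rewrite e; exact: HK2.
have K10 : 0 <= K1 := le_trans (normr_ge0 _) (UK 0).
have K20 : 0 <= K2 := le_trans (normr_ge0 _) (yK 0).
have gS x : S x -> gp x by move=> h; have /andP[] := SB x 0 h; rewrite addr0.
have K12 := sqr_ge0 K1.
have C0 := normr_ge0 C.
exists d0, (1 + `|C| + K1 + K1 ^+ 2 + K2), (Num.min c 1); split=> //.
- by split=> //=; exact: mixae.
- move=> i x ni; case: (pselect (S x)) => h.
    have /and5P[/eqP hi h1 h2 h3 h4] := gS x h.
    have CC := ler_norm C.
    case: i ni => //= _; rewrite ?mixS//.
    + by have := UK x; rlra.
    + by rewrite ger0_norm//; rlra.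
    + suff : `|wd d x| <= `|C| by rlra.
      have s0 := sqr_ge0 (qd d x * Ud d x); rewrite exprMn in s0.
      have hh : qd d x * nd d x <= `|C| * `|C| by apply: ler_pM => //; rlra.
      by rewrite -ler_sqr ?nnegrE// real_normK ?num_real// [leRHS]expr2; rlra.
    + by rewrite ger0_norm//; rlra.
  case: i ni => //= _; rewrite ?mixN//.
  + by have := UK x; rlra.
  + by rewrite normr1; rlra.
  + by rewrite normr0; rlra.
  + rewrite normrX; have : `|Ud d x| ^+ 2 <= K1 ^+ 2 by apply: lerXn2r; rewrite ?nnegrE.
    by rlra.
- split; first by move=> x; have := yK x; rewrite /=; rlra.
    by rewrite lt_min c0 ltr01.
  move=> x; case: (pselect (S x)) => h.
    have /and5P[/eqP hi h1 h2 h3 h4] := gS x h.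
    by rewrite /ident /= !mixS//; split=> //; rewrite ge_min h3.
  have U2 := sqr_ge0 (Ud d x).
  rewrite /ident /= !mixN//; split=> //; first by rewrite expr1n expr0n/=; rlra.
  by rewrite ge_min; apply/orP; right; rlra.
Qed.

End representatives.

(** * Stability *)

Section stability.
Context {R : realType}.
Local Notation mu := (@lebesgue_measure R).
Implicit Types (d e : data R) (B D x r c C L : R) (X Y : triple R) (f k : R -> R).

Lemma rep_h X d : okd 1 d -> rep X d -> h X = nm1 (nd d).
Proof.
by move=> [_ _ _ _ [ln _]] [_ _ lX eX]; rewrite /h normL1E//= (nm1_ae lX ln eX).
Qed.

Lemma cocd_good d r c : okd 1 d -> bddr r d -> 0 < c -> cocd c d -> good d.
Proof.
move=> ok bd c0 H; split=> //; [by apply: aeT => x; have [] := H x|by apply: aeT => x; have [] := H x|by apply: aeT => x; have [] := H x|].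
exists c, (r + r); split=> //; apply: aeT => x; have [_ _ _ ->] := H x.
have nq : CQ <> CY by []. have nn : CN <> CY by [].
by apply: lerD; apply: le_trans (ler_norm _) _; [exact: (bd CQ x nq)|exact: (bd CN x nn)].
Qed.

Lemma St_data X : F X -> exists d : R -> data R, [/\ dcurve d, rep X (d 0) &
  forall t, 0 <= t -> [/\ good (d t), rep (St t X) (d t) & nm1 (nd (d t)) = h X]].
Proof.
move=> /F_good[gX [hy hU lX eX]].
have [d0 [r [c [[ey eU eq ew en] ok0 pd0 bd0 [by0 c0 co0]]]]] := good_everywhere gX.
have rX0 : rep X d0.
  by split.
have [d [d0E cd H]] := St_rep rX0 ok0 pd0 bd0 by0 c0 co0.
exists d; split=> //; first by rewrite d0E.
move=> t t0; have [okt _ [c' c'0 co'] nt [rt [r' br']]] := H t t0.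
by split=> //; [exact: cocd_good br' c'0 co'|rewrite nt (rep_h ok0 rX0)].
Qed.

(** Gronwall is run on the two relabeled curves with f and g fixed. The flow conserves h and
    relabeling preserves the L^1 norm of nu, so [good_bdd] gives a bound in M alone and L is uniform
    over all states and relabelings. *)
Lemma relabel_stable (M T : R) : 0 <= T -> exists2 C : R, 0 < C &
  forall X Y f (g : R -> R) (t : R), F X -> F Y -> h X <= M -> h Y <= M -> G f -> G g -> 0 <= t <= T ->
  (normE (relabel (St t X) f - relabel (St t Y) g)%R <=
    C%:E * normE (relabel X f - relabel Y g)%R)%E.
Proof.
move=> T0; have b1 : 1 <= Num.max 1 (size_bound M) by rewrite le_max lexx.
have [L L0 HL] := dcurve_gronwall b1; exists (expR (L * T)); first exact: expR_gt0.
move=> X Y f g t /St_data[d [cd rX HX]] /St_data[e [ce rY HY]] hX hY /G_rlb rf /G_rlb rg /andP[t0 tT].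
have cd' := dcurve_rl rf cd; have ce' := dcurve_rl rg ce.
have [okd' _] := cd'; have [oke' _] := ce'; have [okd_ _] := cd; have [oke_ _] := ce.
have rep_ (s : R) Z W : 0 <= s -> rep Z (d s) -> rep W (e s) ->
    normE (relabel Z f - relabel W g) = (Nd (subd (relabel_data f (wderiv f) (d s)) (relabel_data g (wderiv g) (e s))))%:E.
  move=> s0 rZ rW; apply: rep_norm; first exact: okd_sub0 (okd' s s0) (oke' s s0).
  by apply: rep_sub; [exact: rep_rl rf (okd_ s s0) rZ|exact: rep_rl rg (oke_ s s0) rW].
have [_ rXt _] := HX t t0; have [_ rYt _] := HY t t0.
rewrite (rep_ t)// (rep_ 0)// -EFinM lee_fin.
have : Nd (subd (relabel_data f (wderiv f) (d t)) (relabel_data g (wderiv g) (e t))) <=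
    expR (L * t) * Nd (subd (relabel_data f (wderiv f) (d 0)) (relabel_data g (wderiv g) (e 0))).
  apply: (HL (fun s => relabel_data f (wderiv f) (d s)) (fun s => relabel_data g (wderiv g) (e s)) t t0 cd' ce').
  move=> s /andP[s0 _]; have [gs _ ns] := HX s s0; have [gs' _ ns'] := HY s s0.
  have [[_ _ _ _ [ln pn]] _ _ _ _] := gs; have [[_ _ _ _ [ln' pn']] _ _ _ _] := gs'.
  split; apply: good_bdd; try exact: good_rl.
    by rewrite (nm1_rl rf ln pn) ns.
  by rewrite (nm1_rl rg ln' pn') ns'.
move=> /le_trans; apply; apply: ler_wpM2r.
  exact: Nd_ge0 (okd_sub0 (okd' 0 (lexx _)) (oke' 0 (lexx _))).
by rewrite ler_expR; exact: ler_wpM2l.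
Qed.

Lemma rl_comp f f' k k' d : relabel_data k k' (relabel_data f f' d) = relabel_data (fun x => f (k x)) (fun x => f' (k x) * k' x) d.
Proof. by apply: data_ext => -[] x /=; rewrite ?mulrA. Qed.

(** The normalizing map has derivative (q + n) / (1 + h), bounded above and away from 0. Its inverse
    p thus satisfies (q + n)(p) p' = 1 + h, the condition that defines [F0]. *)
Lemma Pi1_rep X d : good d -> rep X d -> exists p p', [/\ rlb p p',
  rep (Pi1 X) (relabel_data p p' d) & {ae mu, forall x, (qd d (p x) + nd d (p x)) * p' x = 1 + h X}].
Proof.
move=> gd_ rX; have [ok _ _ Hn [c [C [c0 H]]]] := gd_.
have [Hy _ py _ [ln pn]] := ok; have [hy _ lX eX] := rX.
have hE := rep_h ok rX; have h0 : 0 <= h X by rewrite hE; exact: nm1_ge0.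
have h1 : 0 < 1 + h X by rlra.
pose f x := (1 + h X)^-1 * (yof X x + primitive (nuof X) x).
pose f' x := (1 + h X)^-1 * (qd d x + nuof X x).
have Hf : abscont f f' by apply: ACZ; apply: ACD; [rewrite hy|exact: AC_prim].
have rf : rlb f f'.
  split=> //.
    move=> x; have : Int (nuof X) x (x + 1) = h X.
      rewrite (Int_ae _ _ lX ln eX) (aeper_Int x ln pn) hE /nm1.
      apply: Int_ae => //; first exact: L1loc_abs.
      by apply: aeS Hn => z hz; rewrite ger0_norm.
    rewrite /Int /f => e; have -> : primitive (nuof X) (x + 1) = primitive (nuof X) x + h X by rlra.
    have -> : yof X (x + 1) = yof X x + 1 by rewrite hy py.
    have : (1 + h X)^-1 * (1 + h X) = 1 by rewrite mulVf// gt_eqF.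
    by rlra.
  exists ((1 + h X)^-1 * c), ((1 + h X)^-1 * C); split; first by rewrite mulr_gt0// invr_gt0.
  apply: aeS2 H eX => x /andP[hc hC] e; rewrite /f' e.
  have i0 : 0 <= (1 + h X)^-1 by rewrite invr_ge0 ltW.
  by apply/andP; split; exact: ler_wpM2l.
have [p [p' [rp fp pf]]] := rlb_inv rf.
exists p, p'; split=> //.
  by rewrite /Pi1 -/f (inverseE fp pf); exact: rep_rl rp ok rX.
have A1 := rlb_AC rp Hf.
have A2 : abscont (fun x => f (p x)) (fun=> 1).
  by have := AC_id (R := R); congr abscont; apply/funext => x; rewrite pf.
apply: aeS2 (AC_uniq A1 A2) (rlb_ae rp eX) => x; rewrite /f' => h2 h3.
rewrite h3 -mulrA in h2.
by rewrite -[LHS](mulVKf (lt0r_neq0 h1)) h2 mulr1.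
Qed.

(** f - id is periodic, so its integral over [-a, 1 - a] is a - 1/2, as over [0, 1]; the integral of
    id there is 1/2 - a. *)
Lemma qper1_shift_int f (a : R) : continuous f -> qper 1 f -> a = Int f 0 1 ->
  Int (fun x => f (x - a)) 0 1 = 0.
Proof.
move=> cf pf aE; have lf := L1loc_cont cf; have li : L1loc (fun x : R => x) by apply: L1loc_cont => x; exact: cvg_id.
rewrite (Int_shift (- a) 0 1 lf).
have lp : L1loc (fun x => f x - x) by exact: L1locB.
have pp : aeper (fun x => f x - x) by apply: aeT => x; rewrite pf; rlra.
have h1 := aeper_Int (- a) lp pp.
rewrite IntB// IntB// in h1.
have Hi u v : Int (fun x : R => x) u v = (v * v - u * u) / 2.
  have := ACE u v (ACM (AC_id (R := R)) (AC_id (R := R))).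
  have -> : (fun x : R => 1 * id x + id x * 1) = fun x => 2 * x by apply/funext => x /=; rlra.
  by rewrite IntZ//=; rlra.
rewrite !Hi -aE in h1; rewrite add0r [1 - a]addrC; rlra.
Qed.

Lemma Pi_rep X d : F X -> good d -> rep X d -> exists p p', [/\ rlb p p',
  rep (Pi X) (relabel_data p p' d), H (Pi X) & h (Pi X) = h X].
Proof.
move=> FX gd_ rX; have [p [p' [rp rp1 He]]] := Pi1_rep gd_ rX.
set a := \int[mu]_(x in `[0, 1]) yof (Pi1 X) x.
pose k x := x + (- a); have rk : rlb k (fun=> 1) := rlb_shift (- a).
have g1 := good_rl rp gd_; have [ok1 _ _ _ _] := g1.
have r2 := rlb_comp rp rk; have g2 := good_rl r2 gd_; have [ok2 _ _ _ _] := g2.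
have rP : rep (Pi X) (relabel_data (fun x => p (k x)) (fun x => p' (k x) * 1) d).
  rewrite -rl_comp; have [hy hU lX eX] := rp1; split.
  - by apply/funext => x; exact: (congr1 (fun u => u (x - a)) hy).
  - by apply/funext => x; exact: (congr1 (fun u => u (x - a)) hU).
  - exact: (L1loc_shift (- a) lX).
  - by apply: aeS (rlb_ae rk eX) => x /= <-; rewrite mulr1.
have [[_ _ _ _ [ln pn]] _ _ _ _] := gd_; have [ok _ _ _ _] := gd_.
have hP : h (Pi X) = h X by rewrite (rep_h ok2 rP) (rep_h ok rX) (nm1_rl r2 ln pn).
exists (fun x => p (k x)), (fun x => p' (k x) * 1).
split; [exact: r2|exact: rP| |exact: hP]; split; first split.
- exact: good_F g2 rP.
- have [_ _ eq _ _] := rep_eqd rP ok2; have [_ _ _ eX] := rP.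
  rewrite hP; apply: aeS3 eq eX (rlb_ae rk He) => x /= -> -> <-.
  by rewrite !mulr1 mulrDl.
have [cy _] := okd_cont ok1; have [_ _ py1 _ _] := ok1; have [hy _ _ _] := rp1.
have aE : a = Int (yd (relabel_data p p' d)) 0 1 by rewrite Int_itv//; [rewrite /a hy|exact: L1loc_cont].
have := qper1_shift_int cy py1 aE; rewrite Int_itv//; last exact: (L1loc_shift (- a) (L1loc_cont cy)).
by rewrite /Pi /Pi2 /= -/a hy.
Qed.

(** If [Pi X] is X relabeled by p, then relabeling it further by p^-1 o f undoes p and leaves X
    relabeled by f. *)
Lemma Pi_relabel X d f f' : F X -> good d -> rep X d -> rlb f f' ->
  exists2 k, G k & rep (relabel (Pi X) k) (relabel_data f f' d).
Proof.
move=> FX gd_ rX rf; have [ok _ _ _ _] := gd_.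
have [p [p' [rp rP _ _]]] := Pi_rep FX gd_ rX.
have [k [k' [rk pk kp]]] := rlb_inv rp; have rkf := rlb_comp rk rf.
exists (fun x => k (f x)); first exact: rlb_G rkf.
have [hy hU lX eX] := rep_rl rkf (okd_rl rp ok) rP; split=> //.
- by rewrite hy; apply/funext => x; rewrite /= kp.
- by rewrite hU; apply/funext => x; rewrite /= kp.
have [Hp _ _] := rp; have A1 := rlb_AC rk Hp.
have A2 : abscont (fun x => p (k x)) (fun=> 1).
  by have := AC_id (R := R); congr abscont; apply/funext => x; rewrite kp.
apply: aeS2 eX (rlb_ae rf (AC_uniq A1 A2)) => x -> /= h1.
by rewrite kp -mulrA [p' _ * _]mulrA h1 mul1r.
Qed.

(** Each pair of relabelings of X and Y is matched, with the same norm, by a pair for [Pi X] and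
    [Pi Y], so it competes in the infimum that defines [J]. *)
Lemma J_Pi X Y f (g : R -> R) : F X -> F Y -> G f -> G g ->
  (J (Pi X) (Pi Y) <= normE (relabel X f - relabel Y g)%R)%E.
Proof.
move=> FX FY /G_rlb rf /G_rlb rg; have [gX rX] := F_good FX; have [gY rY] := F_good FY.
have [k Gk rk] := Pi_relabel FX gX rX rf; have [l Gl rl_] := Pi_relabel FY gY rY rg.
have [okX _ _ _ _] := gX; have [okY _ _ _ _] := gY.
have os := okd_sub0 (okd_rl rf okX) (okd_rl rg okY).
have -> : normE (relabel X f - relabel Y g) = normE (relabel (Pi X) k - relabel (Pi Y) l).
  rewrite (rep_norm os (rep_sub (rep_rl rf okX rX) (rep_rl rg okY rY))).
  by rewrite (rep_norm os (rep_sub rk rl_)).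
by apply: ereal_inf_lbound; exists k => //; exists l.
Qed.

(** Both the flow and the projection [Pi] preserve h, so the images of a chain in [HM M] stay in
    [HM M]. *)
Lemma Sbar_HM (M t : R) X : 0 <= t -> HM M X -> HM M (Sbar t X).
Proof.
move=> t0 [[[FX _] _] hX]; have [d [_ _ Hd]] := St_data FX; have [g r n] := Hd t t0.
have Ft := good_F g r; have [ok _ _ _ _] := g.
have [p [p' [_ _ HP hP]]] := Pi_rep Ft g r.
by split=> //; rewrite hP (rep_h ok r) n.
Qed.

Lemma Sbar_J (M T : R) : 0 <= T -> exists2 C : R, 0 < C & forall X Y (t : R), HM M X -> HM M Y -> 0 <= t <= T ->
  (J (Sbar t X) (Sbar t Y) <= C%:E * J X Y)%E.
Proof.
move=> T0; have [C C0 HC] := relabel_stable M T0; exists C => // X Y t.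
move=> [[[FX _] _] hX] [[[FY _] _] hY] tT; have t0 : 0 <= t by case/andP: tT.
have SF Z : F Z -> F (St t Z).
  by move=> /St_data[d [_ _ Hd]]; have [g r _] := Hd t t0; exact: good_F g r.
rewrite /J -ereal_inf_pZl//; apply: le_ereal_inf_tmp => _ [_ [f Gf [g Gg <-]] <-].
exact: le_trans (J_Pi (SF _ FX) (SF _ FY) Gf Gg) (HC _ _ _ _ _ FX FY hX hY Gf Gg tT).
Qed.

Lemma J_ge0 X Y : (0 <= J X Y)%E.
Proof.
apply: le_ereal_inf_tmp => _ [f _ [g _ <-]].
by rewrite /normE /normV !adde_ge0// Lnorm_ge0.
Qed.

End stability.

Theorem theorem4p9 (R : realType) (T M : R) (T_gt0 : 0 < T) (M_gt0 : 0 < M) :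
  exists C : R, forall Xa Xb : triple R, HM M Xa -> HM M Xb ->
    forall t : R, 0 <= t <= T ->
      (dM M (Sbar t Xa) (Sbar t Xb) <= C%:E * dM M Xa Xb)%E.
Proof.
have [C C0 HC] := Sbar_J M (ltW T_gt0); exists C => Xa Xb Ha Hb t tT.
have t0 : 0 <= t by case/andP: tT.
(* C > 0 lets the factor pass inside the infimum, so that it suffices to treat each chain
   separately. *)
rewrite {2}/dM -ereal_inf_pZl//; apply: le_ereal_inf_tmp => _ [_ [N [Z [Z0 ZN HZ ->]] <-]].
apply: (@le_trans _ _ (\sum_(n < N) J (Sbar t (Z n)) (Sbar t (Z n.+1)))%E).
  (* The image of the chain under [Sbar t] is a chain joining the images of the two ends. *)
  apply: ereal_inf_lbound; exists N, (fun n => Sbar t (Z n)); split.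
  - by rewrite Z0.
  - by rewrite ZN.
  - by move=> n nN; exact: (Sbar_HM t0 (HZ n nN)).
  - reflexivity.
rewrite ge0_sume_distrr; last by move=> i _; exact: J_ge0.
apply: lee_sum => i _; exact: (HC _ _ _ (HZ _ (ltnW (ltn_ord i))) (HZ _ (ltn_ord i)) tT).
Qed.
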